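(* Let $k$ be a perfect field of characteristic $p>0$ and let $X$ be a smooth, geometrically irreducible scheme over $k$. The category $$\mathsf{Strat}(X,\infty)=\varinjlim_{(+),\,t\in\mathbb{N}}\mathsf{Strat}(X,t)$$ is a $k$-linear, abelian, rigid tensor category, on which, if $X$ has a rational point $x\in X(k)$, the functor $\omega_x$, sending $(E^{(i)},\sigma^{(i)}, i\in\mathbb N)$ to $E^{(0)}|_x$, is a fiber functor (with values in the category $\mathsf{Vec}_k$ of finite dimensional $k$-vector spaces).
   Context: Frobenius twists. Let $F_k:\operatorname{Spec} k\to\operatorname{Spec} k$ be the absolute Frobenius. Set $X^{(0)}=X$, and for $i\in\mathbb{Z}$ let $X^{(i+1)}=X^{(i)}\otimes_{k,F_k}k$ and $X^{(i-1)}=X^{(i)}\otimes_{k,F_k^{-1}}k$. Let $F^{(i)}:X^{(i)}\to X^{(i+1)}$ be the relative Frobenius over $k$. For integers $a<b$, $F^{(a,b)}:X^{(a)}\to X^{(b)}$ is the composite of the relative Frobenii $F^{(a)},\dots,F^{(b-1)}$, and $F^{(a,a)}=\mathrm{id}$. $t$-stratified bundles. Let $t\ge 0$ be an integer. A $t$-stratified bundle on $X$ is a sequence $(E^{(i)},\sigma^{(i)}, i\in\mathbb{N})$ (with $0\in\mathbb N$), where $E^{(i)}$ is a coherent sheaf on $X^{(i)}$, $\sigma^{(i)}:E^{(i)}\xrightarrow{\cong}F^{(i)*}E^{(i+1)}$ is an $\mathcal{O}_{X^{(i)}}$-isomorphism for each $i\ge 1$, and $\sigma^{(0)}:F^{(-t,0)*}E^{(0)}\xrightarrow{\cong}F^{(-t,1)*}E^{(1)}$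 is an $\mathcal{O}_{X^{(-t)}}$-isomorphism. A morphism $(D^{(i)},\tau^{(i)})\to(E^{(i)},\sigma^{(i)})$ is a sequence of $\mathcal{O}_{X^{(i)}}$-linear maps $f_i:D^{(i)}\to E^{(i)}$ commuting with all the $\tau^{(i)}$ and $\sigma^{(i)}$ (after the relevant Frobenius pullbacks). These form the category $\mathsf{Strat}(X,t)$; tensor products are taken termwise. The transition functor $(+):\mathsf{Strat}(X,t)\to\mathsf{Strat}(X,t+1)$ sends $(E^{(i)},\sigma^{(0)},\sigma^{(i)}, i\ge1)$ to $(E^{(i)},F^{(-t-1)*}\sigma^{(0)},\sigma^{(i)}, i\ge 1)$. A fiber functor is an exact, $k$-linear functor compatible with the tensor structure. *)

(* Defs.v *)
From HB Require Import structures.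
From mathcomp Require Import all_boot all_order all_algebra.
From mathcomp Require Import generic_quotient.
From mathcomp Require Import boolp classical_sets functions topology.

Set Implicit Arguments.
Unset Strict Implicit.
Unset Printing Implicit Defensive.

Import GRing.Theory.
Local Open Scope quotient_scope.
Local Open Scope classical_set_scope.
Local Open Scope ring_scope.

Definition semilin (R S : comPzRingType) (phi : R -> S)
    (M : lmodType R) (N : lmodType S) (g : M -> N) : Prop :=
  forall a x y, g (a *: x + y) = phi a *: g x + g y.

Notation lin := (semilin id).

Definition bilin (R : comPzRingType) (M N P : lmodType R) (b : M -> N -> P) :=
  (forall y, lin (b^~ y)) /\ (forall x, lin (b x)).

Section UniversalModule.
Variables (S : comPzRingType) (G : Type).

(** The S-module representing the functor P |-> {g : G -> P | adm g}.  It
    consists of formal sums of pairs (a, x), two sums being identified when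
    every admissible map to every S-module takes the same value on both. *)

Definition fsum (P : lmodType S) (g : G -> P) (s : seq (S * G)) : P :=
  \sum_(c <- s) c.1 *: g c.2.

Definition umod_rel (adm : forall P : lmodType S, (G -> P) -> Prop)
    (s t : {classic seq (S * G)}) : bool :=
  `[< forall (P : lmodType S) (g : G -> P), adm P g -> fsum g s = fsum g t >].

Variable adm : forall P : lmodType S, (G -> P) -> Prop.

Lemma umod_equiv : equiv_class_of (umod_rel adm).
Proof.
split.
- by move=> s; apply/asboolP.
- by move=> s t; apply/asboolP/asboolP => h P g a; rewrite h.
- by move=> t s u /asboolP h /asboolP h'; apply/asboolP => P g a; rewrite h // h'.
Qed.

Canonical umod_equiv_rel := EquivRelPack umod_equiv.

Definition umod : Type := {eq_quot umod_equiv_rel}.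

HB.instance Definition _ := Choice.on umod.

Definition uclass (s : seq (S * G)) : umod := \pi_({eq_quot umod_equiv_rel})%qT s.

Definition ugen (x : G) : umod := uclass [:: (1, x)].

(** The map corresponding to g; meaningful only when g is admissible *)
Definition ulift (P : lmodType S) (g : G -> P) (x : umod) : P :=
  fsum g (repr (x : {eq_quot umod_equiv_rel})).

Lemma uliftE (P : lmodType S) (g : G -> P) s :
  adm g -> ulift g (uclass s) = fsum g s.
Proof.
move=> ag; rewrite /ulift /uclass.
have /eqquotP/asboolP : (repr (\pi_({eq_quot umod_equiv_rel}) s) = s
  %[mod {eq_quot umod_equiv_rel}])%qT by rewrite reprK.
exact.
Qed.

Lemma umod_ext (x y : umod) :
  (forall (P : lmodType S) (g : G -> P), adm g -> ulift g x = ulift g y) ->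
  x = y.
Proof.
move=> h; rewrite -[x](reprK (x : {eq_quot umod_equiv_rel})).
rewrite -[y](reprK (y : {eq_quot umod_equiv_rel})).
by apply/eqquotP/asboolP => P g ag; apply: h.
Qed.

Definition uadd (x y : umod) : umod := uclass
  (repr (x : {eq_quot umod_equiv_rel}) ++ repr (y : {eq_quot umod_equiv_rel})).
Definition uscale (a : S) (x : umod) : umod := uclass
  [seq (a * c.1, c.2) | c <- repr (x : {eq_quot umod_equiv_rel})].
Definition uzero : umod := uclass [::].
Definition uopp : umod -> umod := uscale (-1).

Lemma ulift_add (P : lmodType S) (g : G -> P) x y : adm g ->
  ulift g (uadd x y) = ulift g x + ulift g y.
Proof. by move=> ag; rewrite uliftE // /fsum big_cat. Qed.

Lemma ulift_scale (P : lmodType S) (g : G -> P) a x : adm g ->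
  ulift g (uscale a x) = a *: ulift g x.
Proof.
move=> ag; rewrite uliftE // /fsum big_map scaler_sumr.
by apply: eq_bigr => c _; rewrite scalerA.
Qed.

Lemma ulift_zero (P : lmodType S) (g : G -> P) : adm g -> ulift g uzero = 0.
Proof. by move=> ag; rewrite uliftE // /fsum big_nil. Qed.

Fact uaddA : associative uadd.
Proof. by move=> x y z; apply: umod_ext => P g ag; rewrite !ulift_add // addrA. Qed.
Fact uaddC : commutative uadd.
Proof. by move=> x y; apply: umod_ext => P g ag; rewrite !ulift_add // addrC. Qed.
Fact uadd0 : left_id uzero uadd.
Proof.
by move=> x; apply: umod_ext => P g ag; rewrite ulift_add // ulift_zero // add0r.
Qed.
Fact uaddN : left_inverse uzero uopp uadd.
Proof.
move=> x; apply: umod_ext => P g ag.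
by rewrite ulift_add // ulift_zero // ulift_scale // scaleN1r addNr.
Qed.

HB.instance Definition _ := GRing.isZmodule.Build umod uaddA uaddC uadd0 uaddN.

Fact uscaleA a b x : uscale a (uscale b x) = uscale (a * b) x.
Proof. by apply: umod_ext => P g ag; rewrite !ulift_scale // scalerA. Qed.
Fact uscale1 : left_id 1 uscale.
Proof. by move=> x; apply: umod_ext => P g ag; rewrite ulift_scale // scale1r. Qed.
Fact uscaleDr : right_distributive uscale +%R.
Proof.
move=> a x y; apply: umod_ext => P g ag.
by rewrite ulift_add // !ulift_scale // ulift_add // scalerDr.
Qed.
Fact uscaleDl x : {morph uscale^~ x : a b / a + b}.
Proof.
move=> a b; apply: umod_ext => P g ag.
by rewrite ulift_add // !ulift_scale // scalerDl.
Qed.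

HB.instance Definition _ :=
  GRing.Zmodule_isLmodule.Build S umod uscaleA uscale1 uscaleDr uscaleDl.

Lemma ulift_lin (P : lmodType S) (g : G -> P) : adm g -> lin (ulift g).
Proof. by move=> ag a x y; rewrite ulift_add // ulift_scale. Qed.

Lemma ulift_gen (P : lmodType S) (g : G -> P) x : adm g -> ulift g (ugen x) = g x.
Proof. by move=> ag; rewrite uliftE // /fsum big_seq1 /= scale1r. Qed.

Lemma lin0 (R : comPzRingType) (M N : lmodType R) (f : M -> N) : lin f -> f 0 = 0.
Proof.
by move=> hf; move: (hf (-1) 0 0); rewrite scaler0 addr0 /= scaleN1r addNr.
Qed.

Lemma umod_decomp (x : umod) :
  x = fsum ugen (repr (x : {eq_quot umod_equiv_rel})).
Proof.
apply: umod_ext => P g ag.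
set s := repr _; have -> : ulift g x = fsum g s by [].
elim: s => [|c s ih]; first by rewrite /fsum !big_nil ulift_zero.
rewrite /fsum !big_cons (ulift_lin ag) ulift_gen //; congr (_ + _).
exact: ih.
Qed.

Lemma lin_fsum (P : lmodType S) (f : umod -> P) s :
  lin f -> f (fsum ugen s) = fsum (f \o ugen) s.
Proof.
move=> lf; elim: s => [|c s ih]; first by rewrite /fsum !big_nil lin0.
by rewrite /fsum !big_cons lf; congr (_ + _); exact: ih.
Qed.

Lemma umod_lin_ext (P : lmodType S) (f g : umod -> P) :
  lin f -> lin g -> (forall x, f (ugen x) = g (ugen x)) -> forall x, f x = g x.
Proof.
move=> lf lg fg x; rewrite [x]umod_decomp !lin_fsum // /fsum.
by apply: eq_bigr => c _ /=; rewrite fg.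
Qed.

End UniversalModule.

Arguments ugen {S G adm}.

(** S (x)_{R, phi} M *)
Definition bchg (R S : comPzRingType) (phi : R -> S) (M : lmodType R) : lmodType S :=
  @umod S M (fun P g => semilin phi g).

(** M (x)_R N *)
Definition tens (R : comPzRingType) (M N : lmodType R) : lmodType R :=
  @umod R (M * N)%type (fun P g => bilin (fun x y => g (x, y))).

Record opens (T : topologicalType) := Opens { oset :> set T; osetP : open oset }.

Definition mem_opens (T : topologicalType) (U : opens T) : T -> Prop := oset U.
Coercion mem_opens : opens >-> Funclass.

Definition opensT (T : topologicalType) : opens T := Opens openT.

Record ringed_space := RingedSpace {
  rsp :> topologicalType;
  rO : opens rsp -> comPzRingType;
  rres : forall U V : opens rsp, V `<=` U -> {rmorphism rO U -> rO V};
  rres_id : forall (U : opens rsp) (h : U `<=` U) f, rres h f = f;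
  rres_comp : forall (U V W : opens rsp) (h : V `<=` U) (h' : W `<=` V)
    (h'' : W `<=` U) f, rres h' (rres h f) = rres h'' f;
  rsep : forall (I : Type) (U : opens rsp) (V : I -> opens rsp)
    (h : forall i, V i `<=` U), (U : set rsp) `<=` \bigcup_i V i ->
    forall f g, (forall i, rres (h i) f = rres (h i) g) -> f = g;
  rglue : forall (I : Type) (U : opens rsp) (V : I -> opens rsp)
    (h : forall i, V i `<=` U), (U : set rsp) `<=` \bigcup_i V i ->
    forall s : (forall i, rO (V i)),
    (forall i j (W : opens rsp) (hi : W `<=` V i) (hj : W `<=` V j),
       rres hi (s i) = rres hj (s j)) ->
    exists f, forall i, rres (h i) f = s i
}.

Definition inv_at (X : ringed_space) (U : opens X) (f : rO U) (x : X) : Prop :=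
  exists (V : opens X) (h : V `<=` U), V x /\ exists g, rres h f * g = 1.

Definition locally_ringed (X : ringed_space) : Prop :=
  forall (x : X) (U : opens X), U x ->
    ~ inv_at (0 : rO U) x /\
    forall f g : rO U, inv_at (f + g) x -> inv_at f x \/ inv_at g x.

Definition prime_ideal (R : comPzRingType) (I : set R) : Prop :=
  [/\ I 0, forall a b, I a -> I b -> I (a + b), forall a b, I b -> I (a * b),
      ~ I 1 & forall a b, I (a * b) -> I a \/ I b].

Definition is_localization (R S : comPzRingType) (f : R) (phi : R -> S) : Prop :=
  [/\ exists g, phi f * g = 1,
      forall s, exists a n, s * phi f ^+ n = phi a
    & forall a, phi a = 0 -> exists n, f ^+ n * a = 0].

(** U is isomorphic to Spec O(U): the map x |-> {f | f(x) = 0} is a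
    homeomorphism from U to Spec O(U), and it identifies the structure sheaves
    on the basis of principal open sets. *)
Definition is_affine (X : ringed_space) (U : opens X) : Prop :=
  [/\ forall I : set (rO U), prime_ideal I ->
        exists! x : X, U x /\ I = [set f | ~ inv_at f x],
      forall (V : opens X) x, V `<=` U -> V x ->
        exists f : rO U, inv_at f x /\ U `&` [set y | inv_at f y] `<=` V
    & forall (f : rO U) (V : opens X) (h : V `<=` U),
        (V : set X) = U `&` [set y | inv_at f y] -> is_localization f (rres h)].

Record scheme := Scheme {
  srs :> ringed_space;
  scheme_local : locally_ringed srs;
  scheme_cover : forall x : srs, exists U : opens srs, is_affine U /\ U x
}.

(** The comorphism is indexed by all pairs of open sets with f(V) in U, so that
    no equality of open sets is ever transported along. *)
Record smor (Y X : scheme) := SMor {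
  sfun :> Y -> X;
  scont : continuous sfun;
  scom : forall (U : opens X) (V : opens Y),
    V `<=` sfun @^-1` U -> {rmorphism rO U -> rO V};
  scom_res : forall (U U' : opens X) (V V' : opens Y)
    (h : V `<=` sfun @^-1` U) (h' : V' `<=` sfun @^-1` U')
    (hU : U' `<=` U) (hV : V' `<=` V) f,
    rres hV (scom h f) = scom h' (rres hU f);
  scom_local : forall (U : opens X) (V : opens Y) (h : V `<=` sfun @^-1` U) f y,
    V y -> inv_at (scom h f) y -> inv_at f (sfun y)
}.

Definition smor_eq (Y X : scheme) (g h : smor Y X) : Prop :=
  (forall y, g y = h y) /\
  forall (U : opens X) (V : opens Y) (hg : V `<=` g @^-1` U)
    (hh : V `<=` h @^-1` U) f, scom hg f = scom hh f.

(** e = g \o h *)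
Definition smor_comp (Z Y X : scheme) (g : smor Y X) (h : smor Z Y)
    (e : smor Z X) : Prop :=
  (forall z, e z = g (h z)) /\
  forall (U : opens X) (V : opens Y) (W : opens Z) (hg : V `<=` g @^-1` U)
    (hh : W `<=` h @^-1` V) (he : W `<=` e @^-1` U) f,
    scom he f = scom hh (scom hg f).

Record kscheme (k : fieldType) := KScheme {
  ksch :> scheme;
  kstr : {rmorphism k -> rO (opensT ksch)}
}.

Definition kst (k : fieldType) (X : kscheme k) (U : opens X) (a : k) : rO U :=
  rres (@subsetT _ (U : set X) : U `<=` opensT X) (kstr X a).

(** g is a morphism over Spec K -> Spec k. *)
Definition smor_over (k K : fieldType) (phi : k -> K) (Y : kscheme K)
    (X : kscheme k) (g : smor Y X) : Prop :=
  forall (U : opens X) (V : opens Y) (h : V `<=` g @^-1` U) a,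
    scom h (kst U a) = kst V (phi a).

(** Y = X (x)_{k, phi} K, as a fibre product. *)
Definition is_base_change (k K : fieldType) (phi : k -> K) (X : kscheme k)
    (Y : kscheme K) (pr : smor Y X) : Prop :=
  smor_over phi pr /\
  forall (Z : kscheme K) (g : smor Z X), smor_over phi g ->
    exists h : smor Z Y, [/\ smor_over id h, smor_comp pr h g &
      forall h' : smor Z Y, smor_over id h' -> smor_comp pr h' g -> smor_eq h h'].

Definition irreducible_space (T : topologicalType) : Prop :=
  (exists x : T, True) /\
  forall U V : opens T, U !=set0 -> V !=set0 -> U `&` V !=set0.

Definition geom_irreducible (k : fieldType) (X : kscheme k) : Prop :=
  forall (K : fieldType) (phi : {rmorphism k -> K}) (Y : kscheme K)
    (pr : smor Y X), is_base_change phi pr -> irreducible_space Y.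

Definition subring (A : comPzRingType) (S : set A) : Prop :=
  [/\ S 1, forall a b, S a -> S b -> S (a - b) & forall a b, S a -> S b -> S (a * b)].

Definition finite_type (R A : comPzRingType) (phi : R -> A) : Prop :=
  exists s : seq A, forall S : set A, subring S -> (forall r, S (phi r)) ->
    (forall a, a \in s -> S a) -> S = setT.

Definition formally_smooth (R A : comPzRingType) (phi : R -> A) : Prop :=
  forall (B C : comPzRingType) (beta : {rmorphism R -> B}) (q : {rmorphism B -> C}),
    (forall c, exists b, q b = c) ->
    (forall b b', q b = 0 -> q b' = 0 -> b * b' = 0) ->
    forall f : {rmorphism A -> C}, (forall r, f (phi r) = q (beta r)) ->
    exists g : {rmorphism A -> B},
      (forall a, q (g a) = f a) /\ (forall r, g (phi r) = beta r).

(** Locally of finite presentation and formally smooth; over a field, finite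
    type and finite presentation agree. *)
Definition smooth (k : fieldType) (X : kscheme k) : Prop :=
  forall x : X, exists U : opens X, [/\ is_affine U, U x,
    finite_type (@kst k X U) & formally_smooth (@kst k X U)].

(** A k-morphism Spec k -> X is given by its image point and the evaluation of
    functions near that point. *)
Record rational_point (k : fieldType) (X : kscheme k) := RationalPoint {
  rpt :> X;
  rev : forall U : opens X, U rpt -> {rmorphism rO U -> k};
  rev_res : forall (U V : opens X) (h : V `<=` U) (hU : U rpt) (hV : V rpt) f,
    rev hV (rres h f) = rev hU f;
  rev_kst : forall (U : opens X) (hU : U rpt) a, rev hU (kst U a) = a;
  rev_local : forall (U : opens X) (hU : U rpt) f, rev hU f != 0 -> inv_at f rpt
}.

Section Frobenius.
Variables (p : nat) (k : fieldType).
Hypothesis charkp : p \in [pchar k].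
Hypothesis kperf : forall a : k, exists b, b ^+ p = a.

Definition frobk : {rmorphism k -> k} := pFrobenius_aut charkp.

Definition frobkV_fun (a : k) : k := sval (cid (kperf a)).

Lemma frobkVK : cancel frobkV_fun frobk.
Proof. by move=> a; rewrite /frobkV_fun; case: cid => b. Qed.

Lemma frobkK : cancel frobk frobkV_fun.
Proof. by move=> a; apply: (fmorph_inj frobk); rewrite frobkVK. Qed.

Fact frobkV_zmod : zmod_morphism frobkV_fun.
Proof. by move=> a b; apply: (can_inj frobkK); rewrite rmorphB !frobkVK. Qed.
Fact frobkV_monoid : monoid_morphism frobkV_fun.
Proof.
by split=> [|a b]; apply: (can_inj frobkK); rewrite ?rmorphM ?rmorph1 !frobkVK.
Qed.
HB.instance Definition _ := GRing.isZmodMorphism.Build k k frobkV_fun frobkV_zmod.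
HB.instance Definition _ := GRing.isMonoidMorphism.Build k k frobkV_fun frobkV_monoid.

Definition frobkV : {rmorphism k -> k} := frobkV_fun.

Fixpoint rmiter n (f : {rmorphism k -> k}) : {rmorphism k -> k} :=
  if n is m.+1 then (f \o rmiter m f : k -> k) else (idfun : k -> k).

(** The i-th power of the inverse of the Frobenius of k, for an integer i *)
Definition frobz (i : int) : {rmorphism k -> k} :=
  match i with Posz n => rmiter n frobkV | Negz n => rmiter n.+1 frobk end.

(** As k is perfect, the Frobenius twist X^(i) is X with its structure morphism
    to Spec k composed with the (-i)-th power of the Frobenius of Spec k;
    see [twist_base_change]. *)
Definition twist (i : int) (X : kscheme k) : kscheme k :=
  @KScheme k X (kstr X \o frobz i).

Lemma rmiterS n (f : {rmorphism k -> k}) a : rmiter n.+1 f a = rmiter n f (f a).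
Proof. by elim: n => [|n ih] //=; rewrite -ih. Qed.

Lemma frobz1 i a : frobz (i + 1) (frobk a) = frobz i a.
Proof.
case: i => [n|[|n]].
- have -> : Posz n + 1 = Posz n.+1 by rewrite -addn1 PoszD.
  by rewrite /frobz rmiterS /= frobkK.
- by [].
have -> : Negz n.+1 + 1 = Negz n.
  by rewrite !NegzE -addn1 PoszD opprD addrNK.
by rewrite /frobz [RHS]rmiterS.
Qed.

Variable X : kscheme k.

Lemma charO (U : opens X) : p%:R = 0 :> rO U.
Proof. by rewrite -(rmorph_nat (rres (@subsetT _ (U : set X) : U `<=` opensT X) \o kstr X
  : {rmorphism k -> rO U})) (pcharf0 charkp) rmorph0. Qed.

Definition frob_fun (U : opens X) (f : rO U) : rO U := f ^+ p.

Fact frob_zmod U : zmod_morphism (@frob_fun U).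
Proof.
have frobD (x y : rO U) : (x + y) ^+ p = x ^+ p + y ^+ p.
  have pp := pcharf_prime charkp; have defp := prednK (prime_gt0 pp).
  rewrite exprDn big_ord_recr subnn -defp big_ord_recl /= defp.
  rewrite subn0 mulr1 mul1r bin0 binn big1 ?addr0 // => i _.
  have /dvdnP[q ->] : (p %| 'C(p, bump 0 i))%N.
    by apply: prime_dvd_bin => //=; rewrite -{2}defp ltnS (valP i).
  by rewrite -mulr_natl natrM charO mulr0 mul0r.
move=> x y; rewrite /frob_fun; apply/eqP; rewrite eq_sym subr_eq -frobD.
by rewrite subrK.
Qed.
Fact frob_monoid U : monoid_morphism (@frob_fun U).
Proof. by split=> [|x y]; rewrite /frob_fun ?expr1n ?exprMn. Qed.
HB.instance Definition _ U :=
  GRing.isZmodMorphism.Build _ _ (@frob_fun U) (@frob_zmod U).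
HB.instance Definition _ U :=
  GRing.isMonoidMorphism.Build _ _ (@frob_fun U) (@frob_monoid U).

Definition frob (U : opens X) : {rmorphism rO U -> rO U} := @frob_fun U.

Lemma frobE U (f : rO U) : frob U f = f ^+ p. Proof. by []. Qed.

Lemma frob_res (U V : opens X) (h : V `<=` U) f : frob V (rres h f) = rres h (frob U f).
Proof. by rewrite !frobE rmorphXn. Qed.

Definition id_smor (i j : int) : smor (twist i X) (twist j X).
Proof.
apply: (@SMor (twist i X) (twist j X) id _ (fun U V h => rres h)).
- by move=> x.
- by move=> U U' V V' h h' hU hV f; rewrite !(rres_comp _ _ (subset_trans hV h)).
- move=> U V h f y Vy [W [hW [Wy [g hg]]]].
  by exists W, (subset_trans hW h); split=> //; exists g; rewrite -(rres_comp h hW).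
Defined.

Lemma twist0 U a : @kst k (twist 0 X) U a = @kst k X U a.
Proof. by []. Qed.

Lemma twist_base_change (i : int) :
  @is_base_change k k frobk (twist i X) (twist (i + 1) X) (id_smor (i + 1) i).
Proof.
split=> [U V h a|Z g hg].
  rewrite /kst /= (frobz1 i a); exact: rres_comp.
pose h : smor Z (twist (i + 1) X) :=
  @SMor Z (twist (i + 1) X) g (@scont _ _ g) (@scom _ _ g)
    (@scom_res _ _ g) (@scom_local _ _ g).
exists h; split.
- move=> U V hV a; rewrite -[a]frobkVK.
  by rewrite -[RHS](hg U V hV); congr (scom _ _); rewrite /kst /= frobz1.
- split=> // U V W hU hV hW f /=.
  by rewrite -(scom_res hW hV hU (@subset_refl _ W)) rres_id.
- move=> h' _ [h1 h2]; split=> [z|U V hU hV f]; first exact: h1.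
  by rewrite /h /= (h2 U U V (@subset_refl _ _) hV hU f) /= rres_id.
Qed.

(** The relative Frobenius F^(i) : X^(i) -> X^(i+1) is, on the scheme underlying
    all the twists of X, the identity on points and f |-> f ^+ p on functions. *)
Definition rel_frob (i : int) : smor (twist i X) (twist (i + 1) X).
Proof.
apply: (@SMor (twist i X) (twist (i + 1) X) id _
  (fun U V h => rres h \o frob U : {rmorphism rO U -> rO V})).
- by move=> x.
- move=> U U' V V' h h' hU hV f /=.
  by rewrite frob_res !(rres_comp _ _ (subset_trans hV h)).
- move=> U V h f y Vy [W [hW [Wy [g hg]]]].
  exists W, (subset_trans hW h); split=> //.
  move: hg; rewrite /= (rres_comp h hW (subset_trans hW h)) -frob_res frobE.
  rewrite -(prednK (prime_gt0 (pcharf_prime charkp))) exprS -mulrA.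
  by exists (rres (subset_trans hW h) f ^+ p.-1 * g).
Defined.

Lemma rel_frob_over (i : int) : smor_over id (rel_frob i).
Proof.
move=> U V h a; rewrite /kst /= -frob_res.
rewrite !(rres_comp _ _ (@subsetT _ (V : set X) : V `<=` opensT X)).
rewrite frobE -(frobz1 i a) -!rmorphXn; congr (rres _ (kstr X _)).
Qed.

End Frobenius.


Definition fingen (R : comPzRingType) (M : lmodType R) : Prop :=
  exists (I : finType) (v : I -> M), forall x, exists c : I -> R,
    x = \sum_i c i *: v i.

Definition rscal (R S : comPzRingType) (phi : {rmorphism R -> S})
  (P : lmodType S) : Type := P.

Section Rscal.
Variables (R S : comPzRingType) (phi : {rmorphism R -> S}) (P : lmodType S).
HB.instance Definition _ := GRing.Zmodule.on (rscal phi P).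
Definition rscale (a : R) (x : rscal phi P) : rscal phi P := phi a *: (x : P).
Fact rscaleA a b x : rscale a (rscale b x) = rscale (a * b) x.
Proof. by rewrite /rscale rmorphM scalerA. Qed.
Fact rscale1 : left_id 1 rscale.
Proof. by move=> x; rewrite /rscale rmorph1 scale1r. Qed.
Fact rscaleDr : right_distributive rscale +%R.
Proof. by move=> a x y; rewrite /rscale scalerDr. Qed.
Fact rscaleDl x : {morph rscale^~ x : a b / a + b}.
Proof. by move=> a b; rewrite /rscale rmorphD scalerDl. Qed.
HB.instance Definition _ :=
  GRing.Zmodule_isLmodule.Build R (rscal phi P) rscaleA rscale1 rscaleDr rscaleDl.
End Rscal.

Section ModuleLemmas.
Variables (R S : comPzRingType) (phi : {rmorphism R -> S}).

Lemma semilinD (M : lmodType R) (N : lmodType S) (g : M -> N) :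
  semilin phi g -> {morph g : x y / x + y}.
Proof. by move=> hg x y; rewrite -[x]scale1r hg rmorph1 !scale1r. Qed.

Lemma semilin0 (M : lmodType R) (N : lmodType S) (g : M -> N) :
  semilin phi g -> g 0 = 0.
Proof.
move=> hg; have := semilinD hg 0 0; rewrite addr0.
by move/(congr1 (fun z => z - g 0)); rewrite addrK subrr => <-.
Qed.

Lemma semilinZ (M : lmodType R) (N : lmodType S) (g : M -> N) :
  semilin phi g -> forall a x, g (a *: x) = phi a *: g x.
Proof. by move=> hg a x; rewrite -[_ *: x]addr0 hg (semilin0 hg) addr0. Qed.

Lemma bchg_gen (M : lmodType R) : semilin phi (ugen : M -> bchg phi M).
Proof.
move=> a x y; apply: (@umod_ext S M (fun P g => semilin phi g)) => P g ag.
by rewrite (ulift_lin ag) !ulift_gen // ag.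
Qed.

Lemma bchg_bij (M : lmodType R) (N : lmodType S) (g : M -> N) :
  semilin phi g ->
  (forall (P : lmodType S) (h : M -> P), semilin phi h ->
     exists2 h' : N -> P, lin h' & forall x, h' (g x) = h x) ->
  (forall (P : lmodType S) (h h' : N -> P), lin h -> lin h' ->
     (forall x, h (g x) = h' (g x)) -> forall y, h y = h' y) ->
  bijective (ulift g : bchg phi M -> N).
Proof.
move=> hg hex huniq; have lg : lin (ulift g : bchg phi M -> N) by apply: ulift_lin.
have [h' lh' h'E] := hex _ _ (@bchg_gen M).
exists h' => [x|y].
  apply: (umod_lin_ext (f := h' \o _) (g := id)) => [a u v||m] //=.
    by rewrite lg lh'.
  by rewrite ulift_gen.
apply: (huniq N ((ulift g : bchg phi M -> N) \o h') id) => [a u v||m] //=.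
  by rewrite lh' lg.
by rewrite h'E ulift_gen.
Qed.

Lemma bchg_univ (M : lmodType R) (N : lmodType S) (g : M -> N) :
  semilin phi g -> bijective (ulift g : bchg phi M -> N) ->
  forall (P : lmodType S) (h : M -> P), semilin phi h ->
     exists2 h' : N -> P, lin h' & forall x, h' (g x) = h x.
Proof.
move=> hg [gi giK Kgi] P h hh; have lg : lin (ulift g : bchg phi M -> N) by exact: ulift_lin.
have lgi : lin gi.
  by move=> a x y; apply: (can_inj giK); rewrite Kgi lg /= !Kgi.
exists ((ulift h : bchg phi M -> P) \o gi) => [a x y|x] /=.
  by rewrite lgi (ulift_lin hh).
have -> : gi (g x) = ugen x by apply: (can_inj giK); rewrite Kgi ulift_gen.
by rewrite ulift_gen.
Qed.

Lemma bchg_uniq (M : lmodType R) (N : lmodType S) (g : M -> N) :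
  semilin phi g -> bijective (ulift g : bchg phi M -> N) ->
  forall (P : lmodType S) (h h' : N -> P), lin h -> lin h' ->
     (forall x, h (g x) = h' (g x)) -> forall y, h y = h' y.
Proof.
move=> hg [gi giK Kgi] P h h' lh lh' hE y; rewrite -[y]Kgi.
have lg : lin (ulift g : bchg phi M -> N) by exact: ulift_lin.
apply: (umod_lin_ext (f := h \o _) (g := h' \o _)) => [a u v|a u v|m] /=.
- by rewrite lg lh.
- by rewrite lg lh'.
- by rewrite ulift_gen.
Qed.

Lemma slift_lin G (adm : forall P : lmodType R, (G -> P) -> Prop) (P : lmodType S) (g : G -> rscal phi P) :
  adm (rscal phi P) g -> semilin phi (ulift g : @umod R G adm -> P).
Proof. by move=> ag a x y; exact: (ulift_lin ag a x y). Qed.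

Lemma umod_semilin_ext G (adm : forall P : lmodType R, (G -> P) -> Prop) (P : lmodType S) (f g : @umod R G adm -> P) :
  semilin phi f -> semilin phi g -> (forall x, f (ugen x) = g (ugen x)) ->
  forall x, f x = g x.
Proof.
exact: (@umod_lin_ext R G adm (rscal phi P)).
Qed.

End ModuleLemmas.

Lemma tens_gen (R : comPzRingType) (M N : lmodType R) :
  bilin (fun x y => ugen (x, y) : tens M N).
Proof.
split=> [y|x] a u v;
  apply: (@umod_ext R _ (fun P g => bilin (fun x y => g (x, y)))) => P g ag; rewrite (ulift_lin ag) !ulift_gen //.
- exact: ag.1.
- exact: ag.2.
Qed.

Lemma umod_fingen (S : comPzRingType) G
  (adm : forall P : lmodType S, (G -> P) -> Prop) (I : finType) (v : I -> @umod S G adm) :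
  (forall x, exists c : I -> S, ugen x = \sum_i c i *: v i) -> fingen (umod adm).
Proof.
move=> h; exists I, v => x; rewrite [x]umod_decomp.
elim: (repr _) => [|[a y] s [c IH]].
  exists (fun=> 0); rewrite /fsum big_nil big1 // => i _; exact: scale0r.
have [d dE] := h y; exists (fun i => a * d i + c i).
rewrite /fsum big_cons [X in _ + X]IH dE scaler_sumr -big_split.
by apply: eq_bigr => i _; rewrite scalerDl scalerA.
Qed.

Section TensorBaseChange.
Variables (R S : comPzRingType) (phi : {rmorphism R -> S}).
Variables (M N : lmodType R) (M' N' : lmodType S) (f : M -> M') (g : N -> N').
Hypothesis flin : semilin phi f.
Hypothesis glin : semilin phi g.

Definition tens_bchg : tens M N -> tens M' N' :=
  ulift (fun c => ugen (f c.1, g c.2) : rscal phi (tens M' N')).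

Lemma tens_bchg_adm : bilin (fun x y => ugen (f x, g y) : rscal phi (tens M' N')).
Proof.
split=> [y|x] a u v.
- by rewrite flin; exact: (tens_gen _ _).1.
- by rewrite glin; exact: (tens_gen _ _).2.
Qed.

Lemma tens_bchg_lin : semilin phi tens_bchg.
Proof. exact/slift_lin/tens_bchg_adm. Qed.

Lemma tens_bchg_gen x y : tens_bchg (ugen (x, y)) = ugen (f x, g y).
Proof. by rewrite /tens_bchg ulift_gen //; exact: tens_bchg_adm. Qed.

Lemma tens_bchg_bij :
  bijective (ulift f : bchg phi M -> M') -> bijective (ulift g : bchg phi N -> N') ->
  bijective (ulift tens_bchg : bchg phi (tens M N) -> tens M' N').
Proof.
move=> fb gb.
have Eu := bchg_univ flin fb; have Eq := bchg_uniq flin fb.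
have Du := bchg_univ glin gb; have Dq := bchg_uniq glin gb.
have bg := @tens_gen _ M N; have bgV := @tens_gen _ M' N'.
apply: bchg_bij tens_bchg_lin _ _ => [P j lg|P j j' lg lg' gE].
- have /choice[f1 f1E] : forall d : N, exists f1 : M' -> P,
      lin f1 /\ forall x, f1 (f x) = j (ugen (x, d)).
    move=> d; have [|f1 lf fE] := Eu P (fun x => j (ugen (x, d))); last by exists f1.
    by move=> a x y; rewrite (bg.1 d) lg.
  have f1l e : semilin phi (fun d => f1 d e).
    move=> a x y; have [l1 e1] := f1E (a *: x + y).
    have [l2 e2] := f1E x; have [l3 e3] := f1E y.
    apply: (Eq P _ (fun e => phi a *: f1 x e + f1 y e)) => //.
      by move=> b u v; rewrite l2 l3 !scalerDr !scalerA mulrC addrACA.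
    by move=> z; rewrite e1 e2 e3 (bg.2 z) lg.
  have /choice[f2 f2E] : forall e : M', exists f2 : N' -> P,
      lin f2 /\ forall d, f2 (g d) = f1 d e.
    by move=> e; have [f2 lf fE] := Du P _ (f1l e); exists f2.
  have b2 : bilin (fun x y => f2 x y).
    split=> [d|e]; last by have [] := f2E e.
    move=> a x y; have [l1 e1] := f2E (a *: x + y).
    have [l2 e2] := f2E x; have [l3 e3] := f2E y.
    apply: (Dq P _ (fun d => a *: f2 x d + f2 y d)) => //.
      by move=> b u v; rewrite l2 l3 !scalerDr !scalerA mulrC addrACA.
    by move=> z; rewrite e1 e2 e3; exact: (f1E z).1.
  exists (ulift (fun c => f2 c.1 c.2) : tens M' N' -> P); first exact: ulift_lin.
  apply: (umod_semilin_ext (phi := phi)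
            (f := (ulift (fun c => f2 c.1 c.2) : tens M' N' -> P) \o tens_bchg)) => //=.
    move=> a x y /=; rewrite tens_bchg_lin.
    exact: (ulift_lin (g := fun c => f2 c.1 c.2) b2).
  by move=> [x y]; rewrite /= tens_bchg_gen ulift_gen //= (f2E _).2 (f1E _).2.
- apply: umod_lin_ext => // -[e d].
  apply: (Eq P (fun e => j (ugen (e, d))) (fun e => j' (ugen (e, d)))) => [a x y|a x y|x].
  + by rewrite (bgV.1 d) lg.
  + by rewrite (bgV.1 d) lg'.
  apply: (Dq P (fun d => j (ugen (f x, d))) (fun d => j' (ugen (f x, d))))
    => [a u v|a u v|y].
  + by rewrite (bgV.2 _) lg.
  + by rewrite (bgV.2 _) lg'.
  by rewrite -tens_bchg_gen gE.
Qed.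

End TensorBaseChange.

Lemma linZ (R : comPzRingType) (M N : lmodType R) (f : M -> N) : lin f ->
  forall a x, f (a *: x) = a *: f x.
Proof. by move=> lf a x; rewrite -[a *: x]addr0 lf (lin0 lf) addr0. Qed.

Lemma linD (R : comPzRingType) (M N : lmodType R) (f : M -> N) : lin f ->
  {morph f : x y / x + y}.
Proof. by move=> lf x y; rewrite -[x in LHS]scale1r lf scale1r. Qed.

Lemma lin_comp (R : comPzRingType) (M N P : lmodType R) (f : N -> P) (g : M -> N) :
  lin f -> lin g -> lin (f \o g).
Proof. by move=> lf lg a x y; rewrite /= lg lf. Qed.

Section Sheaves.
Variable X : scheme.

Record aff := Aff { aop :> opens X; affP : is_affine aop }.

(** A coherent sheaf on a locally noetherian scheme, given by its sections over
    the affine open sets, which form a base of the topology: over an affine U it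
    is the sheaf of modules attached to a finitely generated O(U)-module, i.e.
    O(V) (x)_{O(U)} E(U) -> E(V) is an isomorphism for V in U affine. *)
Record coh := Coh {
  csec :> forall U : aff, lmodType (rO U);
  cres : forall U V : aff, (V : set X) `<=` U -> csec U -> csec V;
  cres_lin : forall (U V : aff) (h : (V : set X) `<=` U), semilin (rres h) (cres h);
  cres_id : forall (U : aff) (h : (U : set X) `<=` U) s, cres h s = s;
  cres_comp : forall (U V W : aff) (h : (V : set X) `<=` U)
    (h' : (W : set X) `<=` V) (h'' : (W : set X) `<=` U) s,
    cres h' (cres h s) = cres h'' s;
  cqc : forall (U V : aff) (h : (V : set X) `<=` U),
    bijective (ulift (@cres U V h) : bchg (rres h) (csec U) -> csec V);
  cfg : forall U : aff, fingen (csec U)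
}.

Record cmor (E D : coh) := CMor {
  cfun :> forall U : aff, E U -> D U;
  cfun_lin : forall U, lin (@cfun U);
  cfun_res : forall (U V : aff) (h : (V : set X) `<=` U) s,
    cfun (cres h s) = cres h (cfun s)
}.

Lemma cmor_ext (E D : coh) (f g : cmor E D) :
  (forall U s, f U s = g U s) -> f = g.
Proof.
case: f g => [f fl fr] [g gl gr] /= fg.
have e : f = g by apply: functional_extensionality_dep => U; exact/funext/fg.
by move: e fl fr gl gr => -> *; congr CMor; exact: Prop_irrelevance.
Qed.

Definition ciso (E D : coh) (f : cmor E D) : Prop := forall U, bijective (f U).

Definition cid_mor (E : coh) : cmor E E :=
  @CMor E E (fun U => id) (fun U a x y => erefl) (fun U V h s => erefl).

Definition ccomp (E D C : coh) (g : cmor D C) (f : cmor E D) : cmor E C.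
Proof.
apply: (@CMor E C (fun U => g U \o f U)) => [U a x y|U V h s] /=.
- by rewrite (cfun_lin f) (cfun_lin g).
- by rewrite !cfun_res.
Defined.

Definition cadd (E D : coh) (f g : cmor E D) : cmor E D.
Proof.
apply: (@CMor E D (fun U s => f U s + g U s)) => [U a x y|U V h s] /=.
- by rewrite (cfun_lin f) (cfun_lin g) scalerDr addrACA.
- by rewrite !cfun_res (semilinD (@cres_lin D _ _ h)).
Defined.

Definition czero (E D : coh) : cmor E D.
Proof.
apply: (@CMor E D (fun U s => 0)) => [U a x y|U V h s] /=.
- by rewrite scaler0 addr0.
- by rewrite (semilin0 (@cres_lin D _ _ h)).
Defined.

Definition cscale (E D : coh) (c : rO (opensT X)) (f : cmor E D) : cmor E D.
Proof.
apply: (@CMor E D (fun U s =>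
  rres (@subsetT _ (U : set X) : (U : opens X) `<=` opensT X) c *: f U s))
  => [U a x y|U V h s] /=.
- by rewrite (cfun_lin f) scalerDr !scalerA mulrC.
- rewrite cfun_res (semilinZ (@cres_lin D _ _ h)); congr (_ *: _).
  by rewrite (rres_comp _ _ (@subsetT _ (V : set X) : (V : opens X) `<=` opensT X)).
Defined.

Section Inverse.
Variables (E D : coh) (f : cmor E D) (hf : ciso f).

Fact cinv_ex (U : aff) : exists g : D U -> E U, cancel g (f U).
Proof. by case: (hf U) => g _ gK; exists g. Qed.

Definition cinv_fun (U : aff) : D U -> E U := sval (cid (cinv_ex U)).

Lemma cinv_funK U : cancel (@cinv_fun U) (f U).
Proof. exact: (svalP (cid (cinv_ex U))). Qed.

Fact cinv_lin U : lin (@cinv_fun U).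
Proof.
by move=> a x y; apply: (bij_inj (hf _)); rewrite cinv_funK (cfun_lin f) !cinv_funK.
Qed.

Fact cinv_res (U V : aff) (h : (V : set X) `<=` U) s :
  cinv_fun (cres h s) = cres h (cinv_fun s).
Proof. by apply: (bij_inj (hf _)); rewrite cfun_res !cinv_funK. Qed.

Definition cinv : cmor D E := CMor cinv_lin cinv_res.

Lemma cinvK U : cancel (cinv U) (f U).
Proof. exact: cinv_funK. Qed.

Lemma cinvVK U : cancel (f U) (cinv U).
Proof. by move=> x; apply: (bij_inj (hf U)); rewrite cinvK. Qed.

End Inverse.

Lemma cinv_iso (E D : coh) (f : cmor E D) (hf : ciso f) : ciso (cinv hf).
Proof.
by move=> U; exists (f U); [exact: cinvK|exact: cinvVK].
Qed.

Lemma ccomp_iso (E D C : coh) (g : cmor D C) (f : cmor E D) :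
  ciso g -> ciso f -> ciso (ccomp g f).
Proof. by move=> hg hf U; exact: bij_comp. Qed.

Section TensorProduct.
Variables E D : coh.

Definition tsec (U : aff) : lmodType (rO U) := tens (E U) (D U).

Definition tres (U V : aff) (h : (V : set X) `<=` U) : tsec U -> tsec V :=
  tens_bchg (rres h) (@cres E _ _ h) (@cres D _ _ h).

Lemma tres_lin (U V : aff) (h : (V : set X) `<=` U) : semilin (rres h) (tres h).
Proof. exact: tens_bchg_lin (@cres_lin E _ _ h) (@cres_lin D _ _ h). Qed.

Lemma tres_gen (U V : aff) (h : (V : set X) `<=` U) x y :
  tres h (ugen (x, y)) = ugen (cres h x, cres h y).
Proof. exact: tens_bchg_gen (@cres_lin E _ _ h) (@cres_lin D _ _ h) x y. Qed.

Lemma tres_id (U : aff) (h : (U : set X) `<=` U) s : tres h s = s.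
Proof.
apply: (umod_lin_ext (f := tres h) (g := id)) => [a x y||[x y]] //.
- by rewrite (tres_lin h) rres_id.
- by rewrite tres_gen !cres_id.
Qed.

Lemma tres_comp (U V W : aff) (h : (V : set X) `<=` U)
  (h' : (W : set X) `<=` V) (h'' : (W : set X) `<=` U) s :
  tres h' (tres h s) = tres h'' s.
Proof.
apply: (umod_semilin_ext (phi := rres h'') (f := tres h' \o tres h)) => [a x y||[x y]].
- by rewrite /= (tres_lin h) (tres_lin h') (rres_comp _ _ h'').
- exact: tres_lin.
- by rewrite /= !tres_gen !(cres_comp _ _ h'').
Qed.

Lemma tqc (U V : aff) (h : (V : set X) `<=` U) :
  bijective (ulift (tres h) : bchg (rres h) (tsec U) -> tsec V).
Proof.
exact: tens_bchg_bij (@cres_lin E _ _ h) (@cres_lin D _ _ h) (cqc E h) (cqc D h).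
Qed.

Lemma tfg (U : aff) : fingen (tsec U).
Proof.
have [I [v vE]] := cfg E U; have [J [w wE]] := cfg D U.
have [b1 b2] := @tens_gen _ (E U) (D U).
apply: (@umod_fingen _ _ _ (I * J)%type (fun c => ugen (v c.1, w c.2))) => -[x y].
have [c cE] := vE x; have [d dE] := wE y.
have sumE K (M N : lmodType (rO U)) (f : M -> N) (F : K -> M) s : lin f ->
    f (\sum_(i <- s) F i) = \sum_(i <- s) f (F i).
  move=> lf; elim: s => [|i s ih]; first by rewrite !big_nil (lin0 lf).
  by rewrite !big_cons -ih -[F i]scale1r lf !scale1r.
have linZ (M N : lmodType (rO U)) (f : M -> N) a z : lin f -> f (a *: z) = a *: f z.
  by move=> lf; rewrite -[a *: z]addr0 lf (lin0 lf) addr0.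
exists (fun ij => c ij.1 * d ij.2); rewrite [x in ugen (x, _)]cE.
rewrite (sumE _ _ _ (fun x => ugen (x, y)) _ _ (b1 y)) -[RHS](pair_bigA _
  (fun i j => (c i * d j) *: (ugen (v i, w j) : tsec U))).
apply: eq_bigr => i _; rewrite (linZ _ _ (fun x => ugen (x, y)) _ _ (b1 y)).
rewrite [y]dE (sumE _ _ _ (fun z => ugen (v i, z)) _ _ (b2 _)) scaler_sumr.
apply: eq_bigr => j _.
by rewrite (linZ _ _ (fun z => ugen (v i, z)) _ _ (b2 _)) scalerA.
Qed.

Definition ctens : coh := Coh tres_lin tres_id tres_comp tqc tfg.

End TensorProduct.

Section TensorMap.
Variables (E E' D D' : coh) (f : cmor E E') (g : cmor D D').

Definition tmap_fun (U : aff) : ctens E D U -> ctens E' D' U :=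
  ulift (fun c => ugen (f U c.1, g U c.2) : ctens E' D' U).

Lemma tmap_adm (U : aff) :
  bilin (fun x y => ugen (f U x, g U y) : ctens E' D' U).
Proof.
split=> [y|x] a u v.
- rewrite (cfun_lin f); exact: (tens_gen _ _).1.
- rewrite (cfun_lin g); exact: (tens_gen _ _).2.
Qed.

Lemma tmap_lin (U : aff) : lin (@tmap_fun U).
Proof. exact/ulift_lin/tmap_adm. Qed.

Lemma tmap_gen (U : aff) x y :
  tmap_fun (ugen (x, y) : ctens E D U) = ugen (f U x, g U y).
Proof. by rewrite /tmap_fun ulift_gen //; exact: tmap_adm. Qed.

Lemma tmap_res (U V : aff) (h : (V : set X) `<=` U) (s : ctens E D U) :
  tmap_fun (cres h s) = cres h (tmap_fun s).
Proof.
apply: (umod_semilin_ext (phi := rres h) (f := @tmap_fun V \o cres h)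
          (g := cres h \o @tmap_fun U)) => [a x y|a x y|[x y]] /=.
- by rewrite (@tres_lin E D _ _ h) tmap_lin.
- by rewrite tmap_lin (@tres_lin E' D' _ _ h).
- by rewrite tres_gen !tmap_gen tres_gen !cfun_res.
Qed.

Definition tmap : cmor (ctens E D) (ctens E' D') := CMor tmap_lin tmap_res.

End TensorMap.

Lemma tmap_iso (E E' D D' : coh) (f : cmor E E') (g : cmor D D') :
  ciso f -> ciso g -> ciso (tmap f g).
Proof.
move=> hf hg U; exists (tmap (cinv hf) (cinv hg) U) => x.
- apply: (umod_lin_ext (f := tmap _ _ U \o tmap _ _ U) (g := id)) => [a u v||[u v]] //=.
    by rewrite !tmap_lin.
  by rewrite !tmap_gen !cinvVK.
- apply: (umod_lin_ext (f := tmap _ _ U \o tmap _ _ U) (g := id)) => [a u v||[u v]] //=.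
    by rewrite !tmap_lin.
  by rewrite !tmap_gen !cinvK.
Qed.

Definition osec (U : aff) : lmodType (rO U) := ((rO U)^o : lmodType (rO U)).

Definition ores (U V : aff) (h : (V : set X) `<=` U) : osec U -> osec V := rres h.

Lemma ores_lin (U V : aff) (h : (V : set X) `<=` U) : semilin (rres h) (ores h).
Proof. by move=> a x y; rewrite /ores rmorphD rmorphM. Qed.

Lemma oqc (U V : aff) (h : (V : set X) `<=` U) :
  bijective (ulift (ores h) : bchg (rres h) (osec U) -> osec V).
Proof.
apply: bchg_bij (ores_lin h) _ _ => [P g lg|P g g' lg lg' gE y].
- exists (fun a : osec V => (a : rO V) *: g 1) => [a x y|x].
    by rewrite scalerDl scalerA.
  by rewrite /ores -(semilinZ lg) /=; congr g; exact: mulr1.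
- have linZ (f : osec V -> P) : lin f -> f y = (y : rO V) *: f 1.
    by move=> lf; rewrite -[y in LHS]mulr1 -[y * 1]addr0 lf (lin0 lf) addr0.
  by rewrite !linZ //; have := gE 1; rewrite /ores rmorph1 => ->.
Qed.

Lemma ofg (U : aff) : fingen (osec U).
Proof.
exists unit, (fun=> 1) => x; exists (fun=> x).
by rewrite big_const card_unit /= addr0; symmetry; exact: mulr1.
Qed.

Definition cO : coh :=
  @Coh osec ores ores_lin (fun U h s => rres_id h s)
    (fun U V W h h' h'' s => rres_comp h h' h'' s) oqc ofg.

End Sheaves.


Section FrobeniusPullback.
Variables (p : nat) (k : fieldType).
Hypothesis charkp : p \in [pchar k].
Variable X : kscheme k.

Local Notation F := (frob charkp).

Section Pullback.
Variable E : coh X.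

(** The Frobenius is the identity on points, so the pullback of E is
    O(U) (x)_{F, O(U)} E(U) over each affine U. *)
Definition psec (U : aff X) : lmodType (rO U) := bchg (F U) (E U).

Definition pres (U V : aff X) (h : (V : set X) `<=` U) : psec U -> psec V :=
  ulift (fun s => ugen (cres h s) : rscal (rres h) (psec V)).

Lemma pres_adm (U V : aff X) (h : (V : set X) `<=` U) :
  semilin (F U) (fun s => ugen (cres h s) : rscal (rres h) (psec V)).
Proof.
move=> a x y; rewrite (@cres_lin _ E _ _ h) bchg_gen.
by rewrite frob_res.
Qed.

Lemma pres_lin (U V : aff X) (h : (V : set X) `<=` U) : semilin (rres h) (pres h).
Proof. exact/slift_lin/pres_adm. Qed.

Lemma pres_gen (U V : aff X) (h : (V : set X) `<=` U) s :
  pres h (ugen s) = ugen (cres h s).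
Proof. by rewrite /pres ulift_gen //; exact: pres_adm. Qed.

Lemma pres_id (U : aff X) (h : (U : set X) `<=` U) s : pres h s = s.
Proof.
apply: (umod_lin_ext (f := pres h) (g := id)) => [a x y||x] //.
- by rewrite (pres_lin h) rres_id.
- by rewrite pres_gen !cres_id.
Qed.

Lemma pres_comp (U V W : aff X) (h : (V : set X) `<=` U)
  (h' : (W : set X) `<=` V) (h'' : (W : set X) `<=` U) s :
  pres h' (pres h s) = pres h'' s.
Proof.
apply: (umod_semilin_ext (phi := rres h'') (f := pres h' \o pres h)) => [a x y||x].
- by rewrite /= (pres_lin h) (pres_lin h') (rres_comp _ _ h'').
- exact: pres_lin.
- by rewrite /= !pres_gen !(cres_comp _ _ h'').
Qed.

Lemma pqc (U V : aff X) (h : (V : set X) `<=` U) :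
  bijective (ulift (pres h) : bchg (rres h) (psec U) -> psec V).
Proof.
have Eu := bchg_univ (@cres_lin _ E _ _ h) (cqc E h).
have Eq := bchg_uniq (@cres_lin _ E _ _ h) (cqc E h).
apply: bchg_bij (pres_lin h) _ _ => [P g lg|P g g' lg lg' gE].
- have g0l : @semilin _ _ (rres h) (E U) (rscal (F V) P) (fun s => g (ugen s)).
    by move=> a x y; rewrite bchg_gen lg -frob_res.
  have [f lf fE] := Eu _ _ g0l.
  have af : semilin (F V) (f : E V -> P) by move=> a x y; exact: lf.
  exists (ulift (f : E V -> P) : psec V -> P); first exact: ulift_lin.
  apply: (umod_semilin_ext (phi := rres h)
            (f := (ulift (f : E V -> P) : psec V -> P) \o pres h)) => //=.
    by move=> a x y /=; rewrite (pres_lin h) (ulift_lin af).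
  by move=> s; rewrite /= pres_gen ulift_gen //= fE.
- apply: umod_lin_ext => // s.
  apply: (Eq (rscal (F V) P) (fun s => g (ugen s)) (fun s => g' (ugen s)))
    => [a x y|a x y|x].
  + by rewrite bchg_gen lg.
  + by rewrite bchg_gen lg'.
  by rewrite -pres_gen gE.
Qed.

Lemma pfg (U : aff X) : fingen (psec U).
Proof.
have [I [v vE]] := cfg E U.
apply: (@umod_fingen _ _ _ I (fun i => ugen (v i))) => x.
have [c cE] := vE x; exists (fun i => F U (c i)); rewrite [x in LHS]cE.
elim: (index_enum I) => [|i s ih].
  by rewrite !big_nil (semilin0 (@bchg_gen _ _ (F U) (E U))).
by rewrite !big_cons -ih bchg_gen.
Qed.

Definition fpull : coh X := Coh pres_lin pres_id pres_comp pqc pfg.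

End Pullback.

Section PullbackMap.
Variables (E D : coh X) (f : cmor E D).

Definition pmap_fun (U : aff X) : fpull E U -> fpull D U :=
  ulift (fun s => ugen (f U s) : fpull D U).

Lemma pmap_adm (U : aff X) : semilin (F U) (fun s => ugen (f U s) : fpull D U).
Proof. by move=> a x y; rewrite (cfun_lin f) bchg_gen. Qed.

Lemma pmap_lin (U : aff X) : lin (@pmap_fun U).
Proof. exact/ulift_lin/pmap_adm. Qed.

Lemma pmap_gen (U : aff X) s : pmap_fun (ugen s : fpull E U) = ugen (f U s).
Proof. by rewrite /pmap_fun ulift_gen //; exact: pmap_adm. Qed.

Lemma pmap_res (U V : aff X) (h : (V : set X) `<=` U) (s : fpull E U) :
  pmap_fun (cres h s) = cres h (pmap_fun s).
Proof.
apply: (umod_semilin_ext (phi := rres h) (f := @pmap_fun V \o cres h)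
          (g := cres h \o @pmap_fun U)) => [a x y|a x y|x] /=.
- by rewrite (@pres_lin E _ _ h) pmap_lin.
- by rewrite pmap_lin (@pres_lin D _ _ h).
- by rewrite pres_gen !pmap_gen pres_gen !cfun_res.
Qed.

Definition pmap : cmor (fpull E) (fpull D) := CMor pmap_lin pmap_res.

End PullbackMap.

Lemma pmap_ext (E D : coh X) (f g : cmor (fpull E) D) :
  (forall U s, f U (ugen s) = g U (ugen s)) -> f = g.
Proof.
move=> fg; apply: cmor_ext => U s.
have lf := @cfun_lin _ _ _ f U; have lg := @cfun_lin _ _ _ g U.
exact: umod_lin_ext lf lg (fg U) s.
Qed.

Lemma pmap_id (E : coh X) : pmap (cid_mor E) = cid_mor (fpull E).
Proof. by apply: pmap_ext => U s; rewrite /= pmap_gen. Qed.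

Lemma pmap_comp (E D C : coh X) (g : cmor D C) (f : cmor E D) :
  pmap (ccomp g f) = ccomp (pmap g) (pmap f).
Proof. by apply: pmap_ext => U s; rewrite /= !pmap_gen. Qed.

Lemma pmap_add (E D : coh X) (f g : cmor E D) :
  pmap (cadd f g) = cadd (pmap f) (pmap g).
Proof.
by apply: pmap_ext => U s; rewrite /= !pmap_gen /= (semilinD (@bchg_gen _ _ (F U) (D U))).
Qed.

Lemma pmap_zero (E D : coh X) : pmap (czero E D) = czero (fpull E) (fpull D).
Proof.
by apply: pmap_ext => U s; rewrite /= !pmap_gen /= (semilin0 (@bchg_gen _ _ (F U) (D U))).
Qed.

Lemma pmap_scale (E D : coh X) c (f : cmor E D) :
  pmap (cscale c f) = cscale (F (opensT X) c) (pmap f).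
Proof.
apply: pmap_ext => U s; rewrite /= !pmap_gen /=.
by rewrite (semilinZ (@bchg_gen _ _ (F U) (D U))) frob_res.
Qed.

Lemma pmap_iso (E D : coh X) (f : cmor E D) : ciso f -> ciso (pmap f).
Proof.
move=> hf U; exists (pmap (cinv hf) U) => x.
- change (ccomp (pmap (cinv hf)) (pmap f) U x = cid_mor _ U x).
  rewrite -pmap_comp -pmap_id; congr (pmap _ U x).
  by apply: cmor_ext => V s; exact: cinvVK.
- change (ccomp (pmap f) (pmap (cinv hf)) U x = cid_mor _ U x).
  rewrite -pmap_comp -pmap_id; congr (pmap _ U x).
  by apply: cmor_ext => V s; exact: cinvK.
Qed.

(** Pullback of a sheaf on X^(i) along F^(i-n, i) *)
Fixpoint fpulln (n : nat) (E : coh X) : coh X :=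
  if n is m.+1 then fpull (fpulln m E) else E.

Fixpoint pmapn (n : nat) (E D : coh X) (f : cmor E D) :
    cmor (fpulln n E) (fpulln n D) :=
  if n is m.+1 then pmap (pmapn m f) else f.

Section PullbackTensor.
Variables E D : coh X.

Lemma ugen_bij (U : aff X) (M : lmodType (rO U)) :
  bijective (ulift (ugen : M -> bchg (F U) M) : bchg (F U) M -> bchg (F U) M).
Proof.
exists id => x; apply: (umod_lin_ext
    (f := ulift (ugen : M -> bchg (F U) M) : bchg (F U) M -> bchg (F U) M) (g := id))
  => //= [|s]; by [apply: ulift_lin; exact: bchg_gen|rewrite ulift_gen //; exact: bchg_gen].
Qed.

(** F^*(E (x) D) -> F^*E (x) F^*D, 1 (x) (e (x) d) |-> (1 (x) e) (x) (1 (x) d) *)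
Definition mu_fun (U : aff X) : fpull (ctens E D) U -> ctens (fpull E) (fpull D) U :=
  ulift (tens_bchg (F U) (ugen : E U -> fpull E U) (ugen : D U -> fpull D U)).

Lemma mu_adm (U : aff X) : semilin (F U)
  (tens_bchg (F U) (ugen : E U -> fpull E U) (ugen : D U -> fpull D U)).
Proof. by apply: tens_bchg_lin; exact: bchg_gen. Qed.

Lemma mu_lin (U : aff X) : lin (@mu_fun U).
Proof. exact/ulift_lin/mu_adm. Qed.

Lemma mu_gen (U : aff X) (e : E U) (d : D U) :
  mu_fun (ugen (ugen (e, d) : ctens E D U)) = ugen (ugen e, ugen d).
Proof.
rewrite /mu_fun ulift_gen; last exact: mu_adm.
by rewrite tens_bchg_gen //; exact: bchg_gen.
Qed.

Lemma mu_res (U V : aff X) (h : (V : set X) `<=` U) (s : fpull (ctens E D) U) :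
  mu_fun (cres h s) = cres h (mu_fun s).
Proof.
apply: (umod_semilin_ext (phi := rres h) (f := @mu_fun V \o cres h)
          (g := cres h \o @mu_fun U)) => [a x y|a x y|t].
- by rewrite /= (@pres_lin (ctens E D) _ _ h) mu_lin.
- by rewrite /= mu_lin (@tres_lin _ (fpull E) (fpull D) _ _ h).
pose f1 (t : ctens E D U) := mu_fun (cres h (ugen t : fpull (ctens E D) U)).
pose f2 (t : ctens E D U) := cres h (mu_fun (ugen t : fpull (ctens E D) U)).
apply: (umod_semilin_ext (phi := rres h \o F U) (f := f1) (g := f2)) => [a x y|a x y|[x y]].
- by rewrite /f1 bchg_gen (@cres_lin _ (fpull (ctens E D)) _ _ h) mu_lin.
- by rewrite /f2 bchg_gen mu_lin (@cres_lin _ (ctens (fpull E) (fpull D)) _ _ h).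
rewrite /f1 /f2 mu_gen /= pres_gen /= (tres_gen (E := E) (D := D) h) mu_gen.
by rewrite (tres_gen (E := fpull E) (D := fpull D) h) /= !pres_gen.
Qed.

Definition mu : cmor (fpull (ctens E D)) (ctens (fpull E) (fpull D)) :=
  CMor mu_lin mu_res.

Lemma mu_iso : ciso mu.
Proof.
move=> U; apply: tens_bchg_bij; try exact: bchg_gen; exact: ugen_bij.
Qed.

End PullbackTensor.

Fixpoint mun n (E D : coh X) :
    cmor (fpulln n (ctens E D)) (ctens (fpulln n E) (fpulln n D)) :=
  if n is m.+1 then ccomp (mu (fpulln m E) (fpulln m D)) (pmap (mun m E D))
  else cid_mor (ctens E D).

Lemma mun_iso n E D : ciso (mun n E D).
Proof.
elim: n => [|n ih] /=; first by move=> U; exists id.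
by apply: ccomp_iso; [exact: mu_iso|exact: pmap_iso].
Qed.

(** O -> F^*O, 1 |-> 1 (x) 1 *)
Definition eta_fun (U : aff X) (a : cO X U) : fpull (cO X) U :=
  (a : rO U) *: ugen (1 : cO X U).

Lemma eta_lin (U : aff X) : lin (@eta_fun U).
Proof. by move=> a x y; rewrite /eta_fun scalerDl -scalerA. Qed.

Lemma eta_res (U V : aff X) (h : (V : set X) `<=` U) (s : cO X U) :
  eta_fun (cres h s) = cres h (eta_fun s).
Proof.
rewrite /eta_fun /= (semilinZ (@pres_lin (cO X) _ _ h)) pres_gen.
by congr (_ *: ugen _); rewrite /= /ores rmorph1.
Qed.

Definition eta : cmor (cO X) (fpull (cO X)) := CMor eta_lin eta_res.

Lemma eta_iso : ciso eta.
Proof.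
move=> U; pose f (a : cO X U) : cO X U := F U a.
have fl : semilin (F U) f by move=> a x y; rewrite /f rmorphD rmorphM.
pose g : fpull (cO X) U -> cO X U := ulift f.
have lg : lin g by exact: (ulift_lin fl).
have gg (b : cO X U) : g (ugen b) = f b by rewrite /g ulift_gen.
exists g => [a|x].
  rewrite /= /eta_fun (linZ lg) gg /f rmorph1; exact: mulr1.
apply: (umod_lin_ext (f := @eta_fun U \o g) (g := id)) => // [|b].
  exact: lin_comp (@eta_lin U) lg.
rewrite /= gg /f /eta_fun -(semilinZ (@bchg_gen _ _ (F U) (cO X U))).
by congr ugen; exact: mulr1.
Qed.

(** A t-stratified bundle is a sequence E of coherent sheaves, E i living on
    X^(i), together with the following data. *)
Record stratification (t : nat) (E : nat -> coh X) := Stratification {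
  sig0 : cmor (fpulln t (E 0)) (fpulln t.+1 (E 1));
  sig : forall i, cmor (E i.+1) (fpull (E i.+2));
  sig0_iso : ciso sig0;
  sig_iso : forall i, ciso (sig i)
}.

Definition is_strat_mor t (D E : nat -> coh X) (tau : stratification t D)
    (sigma : stratification t E) (f : forall i, cmor (D i) (E i)) : Prop :=
  ccomp (pmapn t.+1 (f 1)) (sig0 tau) = ccomp (sig0 sigma) (pmapn t (f 0)) /\
  forall i, ccomp (pmap (f i.+2)) (sig tau i) = ccomp (sig sigma i) (f i.+1).

(** The transition functor (+) *)
Definition strat_plus t (E : nat -> coh X) (sigma : stratification t E) :
    stratification t.+1 E :=
  @Stratification t.+1 E (pmap (sig0 sigma)) (sig sigma)
    (pmap_iso (sig0_iso sigma)) (sig_iso sigma).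

(** On morphisms, (+) leaves the sequence f unchanged. *)
Lemma strat_plus_mor t D E (tau : stratification t D) (sigma : stratification t E) f :
  is_strat_mor tau sigma f -> is_strat_mor (strat_plus tau) (strat_plus sigma) f.
Proof.
move=> [f0 fS]; split=> //=; rewrite -!pmap_comp; congr pmap.
exact: f0.
Qed.

Fixpoint strat_plusn n t E (sigma : stratification t E) : stratification (n + t) E :=
  if n is m.+1 then strat_plus (strat_plusn m sigma) else sigma.

(** The image in Strat(X, s) under the (s - t)-fold iterate of (+) *)
Definition to_stage s t (h : (t <= s)%N) E (sigma : stratification t E) :
    stratification s E :=
  ecast r (stratification r E) (subnK h) (strat_plusn (s - t) sigma).

Lemma to_stageS s t (h : (t <= s)%N) (h' : (t <= s.+1)%N) E (sigma : stratification t E) :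
  to_stage h' sigma = strat_plus (to_stage h sigma).
Proof.
rewrite /to_stage; move: (subnK h) (subnK h').
move: (s - t)%N (s.+1 - t)%N => n n' e; case: s / e h h' => _ _ e'.
have en : n' = n.+1 by apply: (@addIn t); rewrite e'.
by move: e'; rewrite en => e'; rewrite (eq_irrelevance e' erefl).
Qed.

Lemma to_stage_mor s s' t t' (h : (t <= s)%N) (h' : (t' <= s)%N)
  (g : (t <= s')%N) (g' : (t' <= s')%N) D E (tau : stratification t D)
  (sigma : stratification t' E) f : (s <= s')%N ->
  is_strat_mor (to_stage h tau) (to_stage h' sigma) f ->
  is_strat_mor (to_stage g tau) (to_stage g' sigma) f.
Proof.
move=> + hf; elim: s' g g' => [|s' ih] g g'.
  by case: s h h' hf => // h h' hf _; rewrite (bool_irrelevance g h) (bool_irrelevance g' h').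
rewrite leq_eqVlt => /predU1P[e|]; last first.
  rewrite ltnS => ss'; have l := leq_trans h ss'; have l' := leq_trans h' ss'.
  by rewrite (to_stageS l) (to_stageS l'); exact/strat_plus_mor/ih.
case: _ / e g g' {ih} => g g'.
by rewrite (bool_irrelevance g h) (bool_irrelevance g' h').
Qed.

Record strat_bundle := StratBundle {
  stg : nat;
  ssh :> nat -> coh X;
  sstr : stratification stg ssh
}.

(** f is a morphism in the colimit: it is a morphism of Strat(X, s) between the
    images of D and E, for some s.  As (+) is the identity on the sequences f,
    the transition maps between the sets of morphisms are inclusions and their
    colimit is the union. *)
Definition is_colim_mor (D E : strat_bundle) (f : forall i, cmor (D i) (E i)) : Prop :=
  exists s (h : (stg D <= s)%N) (h' : (stg E <= s)%N),
    is_strat_mor (to_stage h (sstr D)) (to_stage h' (sstr E)) f.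

Record shom (D E : strat_bundle) := SHom {
  hfun :> forall i, cmor (D i) (E i);
  hfunP : is_colim_mor hfun
}.

Lemma shom_ext (D E : strat_bundle) (f g : shom D E) :
  (forall i U s, f i U s = g i U s) -> f = g.
Proof.
case: f g => [f fP] [g gP] /= fg.
have e : f = g by apply: functional_extensionality_dep => i; exact/cmor_ext/fg.
by move: e fP gP => -> *; congr SHom; exact: Prop_irrelevance.
Qed.

Lemma colim_mor2 (A B C D : strat_bundle) f g : @is_colim_mor A B f ->
  @is_colim_mor C D g -> exists s
    (a : (stg A <= s)%N) (b : (stg B <= s)%N) (c : (stg C <= s)%N) (d : (stg D <= s)%N),
  is_strat_mor (to_stage a (sstr A)) (to_stage b (sstr B)) f /\
  is_strat_mor (to_stage c (sstr C)) (to_stage d (sstr D)) g.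
Proof.
move=> [s [a [b hf]]] [s' [c [d hg]]]; exists (maxn s s').
exists (leq_trans a (leq_maxl _ _)), (leq_trans b (leq_maxl _ _)).
exists (leq_trans c (leq_maxr _ _)), (leq_trans d (leq_maxr _ _)).
split; first exact: to_stage_mor (leq_maxl _ _) hf.
exact: to_stage_mor (leq_maxr _ _) hg.
Qed.

Lemma pmapn_id n (E : coh X) : pmapn n (cid_mor E) = cid_mor (fpulln n E).
Proof. by elim: n => //= n ->; rewrite pmap_id. Qed.

Lemma pmapn_comp n (E D C : coh X) (g : cmor D C) (f : cmor E D) :
  pmapn n (ccomp g f) = ccomp (pmapn n g) (pmapn n f).
Proof. by elim: n => //= n ->; rewrite pmap_comp. Qed.

Lemma pmapn_add n (E D : coh X) (f g : cmor E D) :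
  pmapn n (cadd f g) = cadd (pmapn n f) (pmapn n g).
Proof. by elim: n => //= n ->; rewrite pmap_add. Qed.

Lemma pmapn_zero n (E D : coh X) : pmapn n (czero E D) = czero _ _.
Proof. by elim: n => //= n ->; rewrite pmap_zero. Qed.

Lemma pmapn_scale n (E D : coh X) c (f : cmor E D) :
  pmapn n (cscale c f) = cscale (iter n (F (opensT X)) c) (pmapn n f).
Proof. by elim: n => //= n ->; rewrite pmap_scale. Qed.

Lemma ccompA (A B C D : coh X) (h : cmor C D) (g : cmor B C) (f : cmor A B) :
  ccomp h (ccomp g f) = ccomp (ccomp h g) f.
Proof. exact: cmor_ext. Qed.
Lemma ccomp1f (A B : coh X) (f : cmor A B) : ccomp (cid_mor B) f = f.
Proof. exact: cmor_ext. Qed.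
Lemma ccompf1 (A B : coh X) (f : cmor A B) : ccomp f (cid_mor A) = f.
Proof. exact: cmor_ext. Qed.
Lemma ccompDl (A B C : coh X) (g g' : cmor B C) (f : cmor A B) :
  ccomp (cadd g g') f = cadd (ccomp g f) (ccomp g' f).
Proof. exact: cmor_ext. Qed.
Lemma ccompDr (A B C : coh X) (g : cmor B C) (f f' : cmor A B) :
  ccomp g (cadd f f') = cadd (ccomp g f) (ccomp g f').
Proof. by apply: cmor_ext => U s /=; rewrite (linD (@cfun_lin _ _ _ g U)). Qed.
Lemma ccomp0l (A B C : coh X) (f : cmor A B) : ccomp (czero B C) f = czero A C.
Proof. exact: cmor_ext. Qed.
Lemma ccomp0r (A B C : coh X) (g : cmor B C) : ccomp g (czero A B) = czero A C.
Proof. by apply: cmor_ext => U s /=; rewrite (lin0 (@cfun_lin _ _ _ g U)). Qed.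
Lemma ccompZl (A B C : coh X) c (g : cmor B C) (f : cmor A B) :
  ccomp (cscale c g) f = cscale c (ccomp g f).
Proof. exact: cmor_ext. Qed.
Lemma ccompZr (A B C : coh X) c (g : cmor B C) (f : cmor A B) :
  ccomp g (cscale c f) = cscale c (ccomp g f).
Proof.
by apply: cmor_ext => U s /=; rewrite (linZ (@cfun_lin _ _ _ g U)).
Qed.

Section StratMorOps.
Variables (t : nat) (D E C : nat -> coh X).
Variables (tau : stratification t D) (sigma : stratification t E).
Variable rho : stratification t C.

Lemma strat_mor_id : is_strat_mor tau tau (fun i => cid_mor (D i)).
Proof.
by split=> [|i]; rewrite ?pmapn_id ?pmap_id ccomp1f ccompf1.
Qed.

Lemma strat_mor_comp g f : is_strat_mor sigma rho g -> is_strat_mor tau sigma f ->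
  is_strat_mor tau rho (fun i => ccomp (g i) (f i)).
Proof.
move=> [g0 gS] [f0 fS]; split=> [|i].
  by rewrite !pmapn_comp -ccompA f0 !ccompA g0.
by rewrite pmap_comp -ccompA fS !ccompA gS.
Qed.

Lemma strat_mor_add f g : is_strat_mor tau sigma f -> is_strat_mor tau sigma g ->
  is_strat_mor tau sigma (fun i => cadd (f i) (g i)).
Proof.
move=> [f0 fS] [g0 gS]; split=> [|i].
  by rewrite !pmapn_add ccompDl ccompDr f0 g0.
by rewrite pmap_add ccompDl ccompDr fS gS.
Qed.

Lemma strat_mor_zero : is_strat_mor tau sigma (fun i => czero (D i) (E i)).
Proof.
by split=> [|i]; rewrite ?pmapn_zero ?pmap_zero ccomp0l ccomp0r.
Qed.

Lemma strat_mor_scale (c : nat -> rO (opensT X)) f :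
  (forall i, F (opensT X) (c i.+1) = c i) -> is_strat_mor tau sigma f ->
  is_strat_mor tau sigma (fun i => cscale (c i) (f i)).
Proof.
move=> cE [f0 fS]; split=> [|i].
  by rewrite !pmapn_scale iterSr cE ccompZl ccompZr f0.
by rewrite pmap_scale cE ccompZl ccompZr fS.
Qed.

End StratMorOps.

Definition strat_tens_at s (D E : nat -> coh X) (tau : stratification s D)
    (sigma : stratification s E) : stratification s (fun i => ctens (D i) (E i)) :=
  @Stratification s (fun i => ctens (D i) (E i))
    (ccomp (cinv (mun_iso s.+1 (D 1%N) (E 1%N)))
       (ccomp (tmap (sig0 tau) (sig0 sigma)) (mun s (D 0%N) (E 0%N))))
    (fun i => ccomp (cinv (mu_iso (D i.+2) (E i.+2)))
       (tmap (sig tau i) (sig sigma i)))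
    (ccomp_iso (cinv_iso (mun_iso s.+1 (D 1%N) (E 1%N)))
       (ccomp_iso (tmap_iso (sig0_iso tau) (sig0_iso sigma)) (mun_iso s (D 0%N) (E 0%N))))
    (fun i => ccomp_iso (cinv_iso (mu_iso (D i.+2) (E i.+2)))
       (tmap_iso (sig_iso tau i) (sig_iso sigma i))).

Definition strat_tens (D E : strat_bundle) : strat_bundle :=
  StratBundle (strat_tens_at (to_stage (leq_maxl (stg D) (stg E)) (sstr D))
                             (to_stage (leq_maxr (stg D) (stg E)) (sstr E))).

Definition strat_one : strat_bundle :=
  @StratBundle 0 (fun=> cO X) (@Stratification 0 (fun=> cO X) eta (fun=> eta)
    eta_iso (fun=> eta_iso)).

End FrobeniusPullback.


Record lincat (k : fieldType) := LinCat {
  ob :> Type;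
  hom : ob -> ob -> lmodType k;
  idm : forall A, hom A A;
  comp : forall A B C, hom B C -> hom A B -> hom A C;
  compA : forall A B C D (h : hom C D) (g : hom B C) (f : hom A B),
    comp h (comp g f) = comp (comp h g) f;
  comp1m : forall A B (f : hom A B), comp (idm B) f = f;
  compm1 : forall A B (f : hom A B), comp f (idm A) = f;
  comp_bilin : forall A B C, bilin (@comp A B C)
}.

Arguments idm {k l} A.
Arguments comp {k l A B C} g f.

Section Abelian.
Variables (k : fieldType) (C : lincat k).

Definition is_iso (A B : C) (f : hom A B) : Prop :=
  exists g : hom B A, comp g f = idm A /\ comp f g = idm B.

Definition monic (A B : C) (f : hom A B) : Prop :=
  forall (D : C) (g h : hom D A), comp f g = comp f h -> g = h.

Definition epic (A B : C) (f : hom A B) : Prop :=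
  forall (D : C) (g h : hom B D), comp g f = comp h f -> g = h.

Definition is_kernel (A B K : C) (f : hom A B) (j : hom K A) : Prop :=
  comp f j = 0 /\
  forall (D : C) (g : hom D A), comp f g = 0 -> exists! h : hom D K, comp j h = g.

Definition is_cokernel (A B Q : C) (f : hom A B) (q : hom B Q) : Prop :=
  comp q f = 0 /\
  forall (D : C) (g : hom B D), comp g f = 0 -> exists! h : hom Q D, comp h q = g.

Definition is_zero_object (Z : C) : Prop :=
  forall A : C, (forall f : hom Z A, f = 0) /\ (forall f : hom A Z, f = 0).

Definition is_biproduct (A B P : C) (i : hom A P) (j : hom B P)
    (p : hom P A) (q : hom P B) : Prop :=
  [/\ comp p i = idm A, comp q j = idm B, comp p j = 0, comp q i = 0
    & comp i p + comp j q = idm P].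

Record abelian : Prop := Abelian {
  has_zero : exists Z : C, is_zero_object Z;
  has_biproducts : forall A B : C,
    exists (P : C) (i : hom A P) (j : hom B P) (p : hom P A) (q : hom P B),
      is_biproduct i j p q;
  has_kernels : forall (A B : C) (f : hom A B),
    exists (K : C) (j : hom K A), is_kernel f j;
  has_cokernels : forall (A B : C) (f : hom A B),
    exists (Q : C) (q : hom B Q), is_cokernel f q;
  monic_normal : forall (A B : C) (f : hom A B), monic f ->
    exists (D : C) (g : hom B D), is_kernel g f;
  epic_normal : forall (A B : C) (f : hom A B), epic f ->
    exists (D : C) (g : hom D A), is_cokernel g f
}.

Definition short_exact (A B D : C) (f : hom A B) (g : hom B D) : Prop :=
  is_kernel g f /\ is_cokernel f g.

End Abelian.

Record tensor_structure (k : fieldType) (C : lincat k) (T : C -> C -> C) (I : C) :=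
  TensorStructure {
  tmor : forall A A' B B' : C, hom A A' -> hom B B' -> hom (T A B) (T A' B');
  assoc : forall A B D : C, hom (T (T A B) D) (T A (T B D));
  assocV : forall A B D : C, hom (T A (T B D)) (T (T A B) D);
  braid : forall A B : C, hom (T A B) (T B A);
  lunit : forall A : C, hom (T I A) A;
  runit : forall A : C, hom (T A I) A;
  tmor_bilin : forall A A' B B', bilin (@tmor A A' B B');
  tmor_id : forall A B, tmor (idm A) (idm B) = idm (T A B);
  tmor_comp : forall (A A' A'' B B' B'' : C) (f' : hom A' A'') (f : hom A A')
    (g' : hom B' B'') (g : hom B B'),
    tmor (comp f' f) (comp g' g) = comp (tmor f' g') (tmor f g);
  assocK : forall A B D, comp (assocV A B D) (assoc A B D) = idm _;
  assocVK : forall A B D, comp (assoc A B D) (assocV A B D) = idm _;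
  assoc_nat : forall (A A' B B' D D' : C) (f : hom A A') (g : hom B B') (h : hom D D'),
    comp (tmor f (tmor g h)) (assoc A B D) = comp (assoc A' B' D') (tmor (tmor f g) h);
  braid_nat : forall (A A' B B' : C) (f : hom A A') (g : hom B B'),
    comp (tmor g f) (braid A B) = comp (braid A' B') (tmor f g);
  braid_sym : forall A B, comp (braid B A) (braid A B) = idm _;
  lunit_iso : forall A, is_iso (lunit A);
  lunit_nat : forall (A B : C) (f : hom A B),
    comp f (lunit A) = comp (lunit B) (tmor (idm I) f);
  runit_iso : forall A, is_iso (runit A);
  runit_nat : forall (A B : C) (f : hom A B),
    comp f (runit A) = comp (runit B) (tmor f (idm I));
  pentagon : forall A B D E,
    comp (assoc A B (T D E)) (assoc (T A B) D E) =
    comp (tmor (idm A) (assoc B D E))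
      (comp (assoc A (T B D) E) (tmor (assoc A B D) (idm E)));
  triangle : forall A B,
    comp (tmor (idm A) (lunit B)) (assoc A I B) = tmor (runit A) (idm B);
  hexagon : forall A B D,
    comp (assoc B D A) (comp (braid A (T B D)) (assoc A B D)) =
    comp (tmor (idm B) (braid A D)) (comp (assoc B A D) (tmor (braid A B) (idm D)));
  braid_unit : forall A, comp (lunit A) (braid A I) = runit A
}.

Definition rigid (k : fieldType) (C : lincat k) (T : C -> C -> C) (I : C)
    (S : tensor_structure T I) : Prop :=
  forall A : C, exists (A' : C) (ev : hom (T A' A) I) (coev : hom I (T A A')),
    comp (runit S A) (comp (tmor S (idm A) ev)
      (comp (assoc S A A' A) (tmor S coev (idm A)))) = lunit S A /\
    comp (lunit S A') (comp (tmor S ev (idm A'))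
      (comp (assocV S A' A A') (tmor S (idm A') coev))) = runit S A'.

(** u : k -> F(1) and J : F(A) (x) F(B) -> F(A (x) B) make F a symmetric tensor
    functor. *)
Record is_fiber_functor (k : fieldType) (C : lincat k) (T : C -> C -> C) (I : C)
    (S : tensor_structure T I) (Fo : C -> lmodType k)
    (Fm : forall A B : C, hom A B -> Fo A -> Fo B) : Prop := IsFiberFunctor {
  ff_findim : forall A, fingen (Fo A);
  ff_lin : forall (A B : C) (f : hom A B), lin (Fm _ _ f);
  ff_id : forall A x, Fm _ _ (idm A) x = x;
  ff_comp : forall (A B D : C) (g : hom B D) (f : hom A B) x,
    Fm _ _ (comp g f) x = Fm _ _ g (Fm _ _ f x);
  ff_klin : forall (A B : C) a (f g : hom A B) x,
    Fm _ _ (a *: f + g) x = a *: Fm _ _ f x + Fm _ _ g x;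
  ff_exact : forall (A B D : C) (f : hom A B) (g : hom B D), short_exact f g ->
    [/\ injective (Fm _ _ f), forall y, Fm _ _ g y = 0 <-> exists x, Fm _ _ f x = y
      & forall z, exists y, Fm _ _ g y = z];
  ff_tensor : exists (u : k^o -> Fo I)
      (J : forall A B, tens (Fo A) (Fo B) -> Fo (T A B)),
    [/\ lin u /\ bijective u,
        forall A B, lin (@J A B) /\ bijective (@J A B),
        forall (A A' B B' : C) (f : hom A A') (g : hom B B') x y,
          Fm _ _ (tmor S f g) (J A B (ugen (x, y))) = J A' B' (ugen (Fm _ _ f x, Fm _ _ g y)),
        forall A B D x y z,
          Fm _ _ (assoc S A B D) (J (T A B) D (ugen (J A B (ugen (x, y)), z))) =
          J A (T B D) (ugen (x, J B D (ugen (y, z))))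
      & [/\ forall A B x y,
              Fm _ _ (braid S A B) (J A B (ugen (x, y))) = J B A (ugen (y, x)),
            forall A x, Fm _ _ (lunit S A) (J I A (ugen (u 1, x))) = x
          & forall A x, Fm _ _ (runit S A) (J A I (ugen (x, u 1))) = x]]
}.

Arguments is_fiber_functor {k C T I} S Fo Fm.

(** The unused argument kperf is recorded so that the k-module structure below can
    be inferred. *)
Definition colim_hom (p : nat) (k : fieldType) (charkp : p \in [pchar k])
  (kperf : forall a : k, exists b, b ^+ p = a) (X : kscheme k)
  (D E : strat_bundle charkp X) : Type := shom D E.

Section StratInfty.
Variables (p : nat) (k : fieldType).
Hypothesis charkp : p \in [pchar k].
Hypothesis kperf : forall a : k, exists b, b ^+ p = a.
Variable X : kscheme k.

Section Hom.
Variables D E : strat_bundle charkp X.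

Local Notation H := (colim_hom kperf D E).

HB.instance Definition _ := gen_eqMixin H.
HB.instance Definition _ := gen_choiceMixin H.

Fact hadd_mor (f g : H) : is_colim_mor (fun i => cadd (hfun f i) (hfun g i)).
Proof.
have [s [a [b [c [d [hf hg]]]]]] := colim_mor2 (hfunP f) (hfunP g).
exists s, a, b; apply: strat_mor_add => //.
by rewrite (bool_irrelevance a c) (bool_irrelevance b d).
Qed.
Definition hadd (f g : H) : H := SHom (hadd_mor f g).

Fact hzero_mor : is_colim_mor (fun i => czero (D i) (E i)).
Proof.
by exists _, (leq_maxl (stg D) (stg E)), (leq_maxr _ _); exact: strat_mor_zero.
Qed.
Definition hzero : H := SHom hzero_mor.

(** k acts on E i through the structure morphism of X^(i). *)
Definition tconst (a : k) (i : nat) : rO (opensT X) :=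
  kstr (twist charkp kperf i X) a.

Lemma tconst_frob a i : frob charkp (opensT X) (tconst a i.+1) = tconst a i.
Proof.
rewrite /tconst frobE -rmorphXn.
have -> : Posz i.+1 = Posz i + 1 by rewrite -addn1 PoszD.
by have := frobz1 charkp kperf i a; rewrite /= => <-.
Qed.

Fact hscale_mor a (f : H) : is_colim_mor (fun i => cscale (tconst a i) (hfun f i)).
Proof.
have [s [h [h' hf]]] := hfunP f; exists s, h, h'.
by apply: strat_mor_scale => // i; exact: tconst_frob.
Qed.
Definition hscale a (f : H) : H := SHom (hscale_mor a f).

Fact haddA : associative hadd.
Proof. by move=> f g h; apply: shom_ext => i U s; exact: addrA. Qed.
Fact haddC : commutative hadd.
Proof. by move=> f g; apply: shom_ext => i U s; exact: addrC. Qed.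
Fact hadd0 : left_id hzero hadd.
Proof. by move=> f; apply: shom_ext => i U s; exact: add0r. Qed.
Fact haddN : left_inverse hzero (hscale (-1)) hadd.
Proof.
move=> f; apply: shom_ext => i U s /=.
by rewrite /tconst !rmorphN !rmorph1 scaleN1r addNr.
Qed.
HB.instance Definition _ := GRing.isZmodule.Build H haddA haddC hadd0 haddN.

Fact hscaleA a b f : hscale a (hscale b f) = hscale (a * b) f.
Proof. by apply: shom_ext => i U s /=; rewrite scalerA /tconst !rmorphM. Qed.
Fact hscale1 : left_id 1 hscale.
Proof. by move=> f; apply: shom_ext => i U s /=; rewrite /tconst !rmorph1 scale1r. Qed.
Fact hscaleDr : right_distributive hscale +%R.
Proof. by move=> a f g; apply: shom_ext => i U s; exact: scalerDr. Qed.
Fact hscaleDl f : {morph hscale^~ f : a b / a + b}.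
Proof.
by move=> a b; apply: shom_ext => i U s /=; rewrite -scalerDl /tconst !rmorphD.
Qed.
HB.instance Definition _ :=
  GRing.Zmodule_isLmodule.Build k H hscaleA hscale1 hscaleDr hscaleDl.

End Hom.

Fact sid_mor (D : strat_bundle charkp X) : is_colim_mor (fun i => cid_mor (D i)).
Proof. by exists (stg D), (leqnn _), (leqnn _); exact: strat_mor_id. Qed.
Definition sid D : colim_hom kperf D D := SHom (sid_mor D).

Fact scomp_mor (D E C : strat_bundle charkp X) (g : colim_hom kperf E C)
  (f : colim_hom kperf D E) : is_colim_mor (fun i => ccomp (hfun g i) (hfun f i)).
Proof.
have [s [a [b [c [d [hf hg]]]]]] := colim_mor2 (hfunP f) (hfunP g).
exists s, a, d; apply: strat_mor_comp hg _.
by rewrite (bool_irrelevance c b).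
Qed.
Definition scomp D E C (g : colim_hom kperf E C) (f : colim_hom kperf D E) :
  colim_hom kperf D C := SHom (scomp_mor g f).

Fact scompA A B C D (h : colim_hom kperf C D) (g : colim_hom kperf B C)
  (f : colim_hom kperf A B) : scomp h (scomp g f) = scomp (scomp h g) f.
Proof. exact: shom_ext. Qed.
Fact scomp1m A B (f : colim_hom kperf A B) : scomp (sid B) f = f.
Proof. exact: shom_ext. Qed.
Fact scompm1 A B (f : colim_hom kperf A B) : scomp f (sid A) = f.
Proof. exact: shom_ext. Qed.
Fact scomp_bilin A B C : bilin (@scomp A B C).
Proof.
split=> [f|g] a x y; apply: shom_ext => i U s //=.
exact: cfun_lin.
Qed.

(** The colimit is taken up to equivalence of categories: its objects are those of
    all the Strat(X, t), with (t, E) isomorphic, not equal, to (t + 1, (+)E). *)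
Definition strat_infty : lincat k :=
  @LinCat k (strat_bundle charkp X) (fun D E => colim_hom kperf D E : lmodType k)
    sid scomp scompA scomp1m scompm1 scomp_bilin.

(** The tensor structure is the usual one on each of the sheaves E i. *)
Record termwise
    (S : @tensor_structure k strat_infty (@strat_tens p k charkp X) (strat_one charkp X))
    : Prop := Termwise {
  tmor_termwise : forall (A A' B B' : strat_infty) (f : hom A A') (g : hom B B') i U x y,
    hfun (tmor S f g : shom _ _) i U (ugen (x, y)) =
    ugen (hfun (f : shom _ _) i U x, hfun (g : shom _ _) i U y);
  assoc_termwise : forall (A B D : strat_infty) i U x y z,
    hfun (assoc S A B D : shom _ _) i U (ugen (ugen (x, y), z)) =
    ugen (x, ugen (y, z));
  braid_termwise : forall (A B : strat_infty) i U x y,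
    hfun (braid S A B : shom _ _) i U (ugen (x, y)) = ugen (y, x);
  lunit_termwise : forall (A : strat_infty) i (U : aff X) (a : rO U) x,
    hfun (lunit S A : shom _ _) i U (ugen (a, x)) = a *: x;
  runit_termwise : forall (A : strat_infty) i (U : aff X) (a : rO U) x,
    hfun (runit S A : shom _ _) i U (ugen (x, a)) = a *: x
}.

Section Fiber.
Variable x : rational_point X.

Record local_section (E : coh X) := LocalSection {
  lsU : aff X;
  lsx : lsU (rpt x);
  lss : E lsU
}.

Definition local_adm (E : coh X) (P : lmodType k) (g : local_section E -> P) : Prop :=
  (forall (U : aff X) (hx : U (rpt x)),
     semilin (rev hx) (fun s : E U => g (LocalSection hx s))) /\
  forall (U V : aff X) (h : (V : set X) `<=` U) (hU : U (rpt x)) (hV : V (rpt x)) s,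
    g (LocalSection hV (cres h s)) = g (LocalSection hU s).

(** E|_x is the colimit, over the affine neighbourhoods U of x, of
    k (x)_{O(U)} E(U). *)
Definition fiber (E : coh X) : lmodType k := umod (@local_adm E).

Definition fiber_map (E D : coh X) (f : cmor E D) : fiber E -> fiber D :=
  ulift (fun z => ugen (LocalSection (lsx z) (f (lsU z) (lss z))) : fiber D).

Definition omega (E : strat_infty) : lmodType k := fiber ((E : strat_bundle charkp X) 0%N).

Definition omega_mor (D E : strat_infty) (f : hom D E) : omega D -> omega E :=
  fiber_map (hfun (f : shom _ _) 0%N).

End Fiber.

End StratInfty.

(* Main.v *)
(* A t-stratified bundle E is locally free: each E(i), i >= 1, is an arbitrarily high
   Frobenius pullback.  For a module M over a ring A, let c(M) be the ideal of all a such
   that a : M -> M factors through a finite free module.  On a smooth affine open with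
   ring A, F_* A is a finitely generated projective A-module: writing A = P / I with P a
   polynomial ring, formal smoothness splits P / I^[p] -> A, and P / I^[p] is free over A
   via Frobenius.  Hence c(F^* M) is contained in the Frobenius power c(M)^[p].  For a
   stratified bundle the ideals c(E(i)), i >= 1, all have the same radical J, so c(E(1))
   lies in every Frobenius power of J; as c(E(1)) is nonzero and A is a noetherian domain,
   J = A by Krull, which makes E(1) projective, and then E(0) by faithfulness of F^*.

   The cokernel of a morphism f of stratified bundles is stratified, hence locally free, so
   over each affine open there is t with f t f = f.  Kernels therefore commute with
   Frobenius pullbacks, restrictions and fibres, and duals exist. *)

Require Import Defs.
From HB Require Import structures.
From mathcomp Require Import all_boot all_order all_algebra.
From mathcomp Require Import generic_quotient ring zify.
From mathcomp Require Import boolp classical_sets functions topology.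

Set Implicit Arguments.
Unset Strict Implicit.
Unset Printing Implicit Defensive.

Import GRing.Theory.
Local Open Scope quotient_scope.
Local Open Scope classical_set_scope.
Local Open Scope ring_scope.

(** * Ideals and noetherian rings *)

Lemma seq_uniform (T : eqType) (P : T -> nat -> Prop) (s : seq T) :
  (forall t m n, (m <= n)%N -> P t m -> P t n) ->
  (forall t, t \in s -> exists n, P t n) -> exists n, forall t, t \in s -> P t n.
Proof.
move=> mono; elim: s => [|y s ih] hs; first by exists 0%N.
have [t ts|N hN] := ih; first by apply: hs; rewrite inE ts orbT.
have [n hn] := hs y (mem_head _ _).
exists (maxn n N) => t; rewrite inE => /predU1P[->|/hN h].
  by apply: mono hn; exact: leq_maxl.
by apply: mono h; exact: leq_maxr.
Qed.

Section Ideals.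
Variable R : comPzRingType.
Implicit Types (I J L S : set R) (a b x y : R).

Record ideal I : Prop := Ideal {
  ideal0 : I 0;
  idealD : forall a b, I a -> I b -> I (a + b);
  idealM : forall a b, I b -> I (a * b)
}.

Lemma idealN I a : ideal I -> I a -> I (- a).
Proof. by move=> hI Ia; rewrite -mulN1r; apply: idealM. Qed.

Lemma idealB I a b : ideal I -> I a -> I b -> I (a - b).
Proof. by move=> hI Ia Ib; apply: idealD => //; apply: idealN. Qed.

Lemma ideal_sum I (T : Type) (s : seq T) (F : T -> R) :
  ideal I -> (forall t, I (F t)) -> I (\sum_(t <- s) F t).
Proof.
move=> hI h; elim: s => [|t s ih]; first by rewrite big_nil; exact: ideal0.
by rewrite big_cons; exact: idealD.
Qed.

Definition gen S : set R := [set x | forall I, ideal I -> S `<=` I -> I x].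

Lemma gen_ideal S : ideal (gen S).
Proof.
split=> [I hI _|a b ha hb I hI SI|a b hb I hI SI].
- exact: ideal0.
- by apply: idealD => //; [exact: ha|exact: hb].
- by apply: idealM => //; exact: hb.
Qed.

Lemma sub_gen S : S `<=` gen S.
Proof. by move=> x Sx I _; exact. Qed.

Definition lgen (s : seq R) : set R := gen [set x | x \in s].

Lemma lgenP s x : lgen s x -> exists c : nat -> R, x = \sum_(i < size s) c i * s`_i.
Proof.
move/(_ [set x | exists c : nat -> R, x = \sum_(i < size s) c i * s`_i]); apply.
- split.
  + by exists (fun=> 0); rewrite big1 // => i _; rewrite mul0r.
  + move=> _ _ [c ->] [d ->]; exists (fun i => c i + d i).
    by rewrite -big_split; apply: eq_bigr => i _; rewrite mulrDl.
  + move=> a _ [c ->]; exists (fun i => a * c i).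
    by rewrite mulr_sumr; apply: eq_bigr => i _; rewrite mulrA.
- move=> y /= ys; have iy : (index y s < size s)%N by rewrite index_mem.
  exists (fun i => (i == index y s)%:R).
  rewrite (bigD1 (Ordinal iy)) //= eqxx mul1r nth_index // big1 ?addr0 // => i.
  by rewrite -val_eqE /= => /negbTE ->; rewrite mul0r.
Qed.

Definition noeth := forall I, ideal I ->
  exists s : seq R, (forall x, x \in s -> I x) /\ I `<=` lgen s.

Lemma noeth_max (F : set (set R)) I0 : noeth -> (forall I, F I -> ideal I) -> F I0 ->
  exists2 J, F J & forall J', F J' -> J `<=` J' -> J' `<=` J.
Proof.
move=> hR Fid FI0; apply: contrapT => nomax.
have /choice[nx nxP] : forall J : {J | F J}, exists J' : {J | F J},
    sval J `<=` sval J' /\ ~ (sval J' `<=` sval J).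
  move=> [J FJ]; apply: contrapT => h; apply: nomax; exists J => // J' FJ' JJ'.
  by apply: contrapT => h'; apply: h; exists (exist _ J' FJ').
pose c n := sval (iter n nx (exist _ I0 FI0)).
have cid n : ideal (c n) by apply: Fid; exact: svalP.
have cS n : c n `<=` c n.+1 by have [] := nxP (iter n nx (exist _ I0 FI0)).
have cle m n : (m <= n)%N -> c m `<=` c n.
  move=> /subnK <-; elim: (n - m)%N => [|d ih] //.
  exact: subset_trans ih (cS _).
have [|s [sU Us]] := hR [set x | exists n, c n x].
  split; first by exists 0%N; exact: ideal0.
    move=> a b [m ha] [n hb]; exists (maxn m n); apply: idealD => //.
      by apply: cle ha; exact: leq_maxl.
    by apply: cle hb; exact: leq_maxr.
  by move=> a b [n hb]; exists n; exact: idealM.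
have [N hN] := seq_uniform (fun x m n mn => @cle m n mn x) sU.
have [_] := nxP (iter N nx (exist _ I0 FI0)); apply=> x hx.
by apply: (Us x _ (c N) (cid N) hN); exists N.+1.
Qed.

Definition fpow q I : set R := gen [set x | exists2 y, I y & x = y ^+ q].

(* Krull's intersection theorem for Frobenius powers.  An ideal [J] maximal among
   those that meet [(f)] inside [I f] contains a power of every element of [I],
   hence a Frobenius power of [I], hence [f]. *)
Lemma frobenius_krull p I f : noeth -> (1 < p)%N ->
  (forall n a b, (a + b) ^+ (p ^ n) = a ^+ (p ^ n) + b ^+ (p ^ n) :> R) ->
  ideal I -> (forall n, fpow (p ^ n) I f) -> exists2 i, I i & f = i * f.
Proof.
move=> hR p1 frobD hI fI; pose N := [set z | exists2 i, I i & z = i * f].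
have hN : ideal N.
  split; first by exists 0; [exact: ideal0|rewrite mul0r].
    by move=> _ _ [i Ii ->] [j Ij ->]; exists (i + j); [exact: idealD|rewrite mulrDl].
  by move=> a _ [i Ii ->]; exists (a * i); [exact: idealM|rewrite mulrA].
pose F := [set J | [/\ ideal J, N `<=` J & forall b, J (b * f) -> N (b * f)]].
have [||J [hJ NJ JN] Jmax] := @noeth_max F N hR; [by move=> J []|by split|].
have powJ x : I x -> exists n, J (x ^+ n).
  move=> Ix; pose C n := [set a | J (a * x ^+ n)].
  have hC n : ideal (C n).
    split; first by rewrite /C /= mul0r; exact: ideal0.
      by move=> a b; rewrite /C /= mulrDl; exact: idealD.
    by move=> a b; rewrite /C /= -mulrA; exact: idealM.
  have [||_ [n _ <-] Cmax] := @noeth_max [set C n | n in setT] (C 0%N) hR.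
  - by move=> _ [n _ <-].
  - by exists 0%N.
  have CS : C n.+1 `<=` C n.
    apply: Cmax; first by exists n.+1.
    by move=> a; rewrite /C /= exprS mulrCA; exact: idealM.
  pose L := [set z | exists2 j, J j & exists a, z = j + a * x ^+ n].
  exists n; have FL : F L.
    split.
    - split; first by exists 0; [exact: ideal0|exists 0; rewrite mul0r addr0].
        move=> _ _ [j Jj [a ->]] [j' Jj' [a' ->]]; exists (j + j'); first exact: idealD.
        by exists (a + a'); rewrite mulrDl addrACA.
      move=> b _ [j Jj [a ->]]; exists (b * j); first exact: idealM.
      by exists (b * a); rewrite mulrDr mulrA.
    - by move=> z /NJ Jz; exists z => //; exists 0; rewrite mul0r addr0.
    - move=> b [j Jj [a bE]]; apply: JN; rewrite bE; apply: idealD => //; apply: CS.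
      rewrite /C /= exprS mulrCA.
      have -> : x * (a * x ^+ n) = x * b * f - x * j by rewrite -mulrA bE mulrDr addrC addKr.
      apply: idealB => //; last exact: idealM.
      by apply: NJ; exists (x * b) => //; rewrite mulrC; exact: idealM.
  apply: (Jmax L FL) => [z Jz|]; first by exists z => //; exists 0; rewrite mul0r addr0.
  by exists 0; [exact: ideal0|exists 1; rewrite mul1r add0r].
have [s [sI Is]] := hR I hI.
have [m hm] : exists m, forall x, x \in s -> J (x ^+ m).
  apply: seq_uniform => [x m n mn h|x /sI]; last exact: powJ.
  by rewrite -(subnK mn) exprD; exact: idealM.
have Jq : I `<=` [set y | J (y ^+ (p ^ m))].
  move=> y /Is; apply.
    split=> [|a b ha hb|a b hb] /=.
    - by rewrite expr0n expn_eq0 -leqn0 leqNgt (ltnW p1); exact: ideal0.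
    - by rewrite frobD; exact: idealD.
    - by rewrite exprMn; exact: idealM.
  move=> x /hm h /=; rewrite -(subnK (ltnW (ltn_expl m p1))) exprD; exact: idealM.
have Jf : J f by apply: fI => // _ [y Iy ->]; exact: Jq.
by have := JN 1; rewrite mul1r => /(_ Jf) [i]; exists i.
Qed.

End Ideals.

Lemma noeth_surj (R A : comPzRingType) (f : {rmorphism R -> A}) :
  (forall a, exists r, f r = a) -> noeth R -> noeth A.
Proof.
move=> fs hR I hI; have [|s [sI Is]] := hR (f @^-1` I).
  split=> [|a b|a b] /=; rewrite ?rmorph0 ?rmorphD ?rmorphM.
  - exact: ideal0.
  - exact: idealD.
  - exact: idealM.
exists (map f s); split=> [_ /mapP[x xs ->]|a Ia]; first exact: sI.
have [r ra] := fs a; rewrite -ra in Ia *.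
have hL := gen_ideal [set x | x \in map f s].
have hL' : ideal (f @^-1` lgen (map f s)).
  split=> [|x y|x y] /=; rewrite ?rmorph0 ?rmorphD ?rmorphM.
  - exact: ideal0 hL.
  - exact: idealD hL _ _.
  - exact: idealM hL _ _.
by apply: (Is r Ia _ hL') => x /= xs; apply: sub_gen => /=; exact: map_f.
Qed.

Lemma noeth_field (k : fieldType) : noeth k.
Proof.
move=> I hI; have [[x Ix x0]|h] := pselect (exists2 x, I x & x != 0).
  exists [:: x]; split=> [y|y _]; first by rewrite inE => /eqP ->.
  rewrite -[y](mulfVK x0); apply: (idealM (gen_ideal _)).
  by apply: sub_gen => /=; rewrite inE.
exists [::]; split=> // y Iy; have [->|y0] := eqVneq y 0.
  exact: ideal0 (gen_ideal _).
by case: h; exists y.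
Qed.

Lemma noeth_poly (R : comNzRingType) : noeth R -> noeth {poly R}.
Proof.
move=> hR I hI; pose L n := [set a | exists2 f : {poly R}, I f & (size f <= n.+1)%N /\ f`_n = a].
have hL n : ideal (L n).
  split; first by exists 0; [exact: ideal0|rewrite size_poly0 coef0].
    move=> _ _ [f If [fn <-]] [g Ig [gn <-]]; exists (f + g); first exact: idealD.
    by rewrite coefD (leq_trans (size_polyD _ _)) // geq_max fn.
  move=> a _ [f If [fn <-]]; exists (a%:P * f); first exact: idealM.
  by rewrite coefCM mul_polyC (leq_trans (size_scale_leq _ _)).
have LS m n : (m <= n)%N -> L m `<=` L n.
  move=> mn _ [f If [fm <-]]; exists ('X^(n - m) * f); first exact: idealM.
  rewrite coefXnM ltnNge leq_subr /= subKn //; split=> //.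
  have [->|f0] := eqVneq f 0; first by rewrite mulr0 size_poly0.
  rewrite mulrC size_Mmonic ?monicXn ?f0 // size_polyXn addnS /=.
  by rewrite -(leq_add2r (n - m)) addSn subnKC in fm.
have [|s [sL Ls]] := hR [set a | exists n, L n a].
  split; first by exists 0%N; exact: ideal0 (hL _).
    move=> a b [m ha] [n hb]; exists (maxn m n); apply: (idealD (hL _)).
      by apply: LS ha; exact: leq_maxl.
    by apply: LS hb; exact: leq_maxr.
  by move=> a b [n hb]; exists n; exact: idealM (hL _) _ _ hb.
have [d hd] := seq_uniform (fun x m n mn => @LS m n mn x) sL.
have Ld n : L n `<=` L d.
  by move=> a La; apply: (Ls a _ (L d) (hL d) hd); exists n.
have /choice[G GP] : forall n, exists G : seq {poly R},
    (forall g, g \in G -> I g /\ (size g <= n.+1)%N) /\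
    L n `<=` lgen [seq g`_n | g : {poly R} <- G].
  move=> n; have [t [tL Lt]] := hR (L n) (hL n).
  move: Lt; move: {1 2}(L n) => K; elim: t tL K => [|a t ih] tL K Lt.
    by exists [::]; split=> [g|]; [rewrite in_nil|exact: Lt].
  have [x xt|//|G [GI KG]] := ih _ (lgen t).
    by apply: tL; rewrite inE xt orbT.
  have [|f If [fn fa]] := tL a; first by rewrite inE eqxx.
  exists (f :: G); split=> [g|x /Lt Kx].
    by rewrite inE => /predU1P[->|/GI].
  apply: (Kx _ (gen_ideal _)).
  move=> y /=; rewrite inE => /predU1P[->|yt]; first by apply: sub_gen; rewrite /= fa inE eqxx.
  have /KG Gy : lgen t y by exact: sub_gen.
  apply: (Gy _ (gen_ideal _)).
  by move=> z /= zG; apply: sub_gen => /=; rewrite inE zG orbT.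
pose gs := flatten [seq G n | n <- iota 0 d.+1].
have gsI g : g \in gs -> I g.
  by case/flattenP => _ /mapP[n _ ->] /(GP n).1[].
exists gs; split=> //.
have hgs : ideal (lgen gs) by exact: gen_ideal.
suff main m : forall f, I f -> (size f <= m)%N -> lgen gs f.
  by move=> f If; exact: main (leqnn _).
elim: m => [|n ih] f If fn.
  by have -> : f = 0; [apply/eqP; rewrite -size_poly_leq0|exact: ideal0 hgs].
pose n' := minn n d.
have : L n' f`_n.
  have Ln : L n f`_n by exists f.
  by rewrite /n' /minn; case: ifP => // _; exact: Ld Ln.
have [GI LG] := GP n'; move=> /LG/lgenP[c cE].
rewrite size_map in cE.
pose h := 'X^(n - n') * \sum_(i < size (G n')) (c i)%:P * (G n')`_i.
have hgen : lgen gs h.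
  apply: (idealM hgs); apply: (ideal_sum _ hgs) => i; apply: (idealM hgs); apply: sub_gen => /=.
  apply/flattenP; exists (G n'); last exact: mem_nth.
  by apply: map_f; rewrite mem_iota /= add0n ltnS geq_minr.
have hI' : I h by apply: hgen => // x; exact: gsI.
have n'n : (n' <= n)%N by exact: geq_minl.
have hs : (size h <= n.+1)%N.
  apply/leq_sizeP => j nj; rewrite coefXnM; case: ifP => // /negbT; rewrite -leqNgt => jn.
  rewrite coef_sum big1 // => i _; rewrite coefCM.
  have [_ gs'] := GI _ (mem_nth 0 (ltn_ord i)).
  rewrite (leq_sizeP _ _ gs') ?mulr0 // ltn_subRL; apply: leq_ltn_trans nj.
  by rewrite subnK.
have hn : h`_n = f`_n.
  rewrite coefXnM ltnNge leq_subr /= subKn // cE coef_sum; apply: eq_bigr => i _.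
  by rewrite coefCM (nth_map 0).
rewrite -[f](subrK h); apply: (idealD hgs) => //; apply: ih; first exact: idealB.
apply/leq_sizeP => j; rewrite leq_eqVlt coefB => /predU1P[<-|nj]; first by rewrite hn subrr.
by rewrite (leq_sizeP _ _ fn) // (leq_sizeP _ _ hs) // subrr.
Qed.

(** * Frobenius bases *)

Section Characteristic.
Variables (p : nat) (R : comPzRingType).
Hypotheses (pp : prime p) (p0 : p%:R = 0 :> R).

Lemma charp_exprD (x y : R) : (x + y) ^+ p = x ^+ p + y ^+ p.
Proof.
have defp := prednK (prime_gt0 pp).
rewrite exprDn big_ord_recr subnn -defp big_ord_recl /= defp.
rewrite subn0 mulr1 mul1r bin0 binn big1 ?addr0 // => i _.
have /dvdnP[q ->] : (p %| 'C(p, bump 0 i))%N.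
  by apply: prime_dvd_bin => //=; rewrite -{2}defp ltnS (valP i).
by rewrite -mulr_natl natrM p0 mulr0 mul0r.
Qed.

Lemma charp_exprDn n (x y : R) : (x + y) ^+ (p ^ n) = x ^+ (p ^ n) + y ^+ (p ^ n).
Proof.
elim: n => [|n ih]; first by rewrite !expr1.
by rewrite expnSr !exprM ih charp_exprD.
Qed.

Lemma charp_expr0 : 0 ^+ p = 0 :> R.
Proof. by rewrite expr0n gtn_eqF ?prime_gt0. Qed.

End Characteristic.

(* [F_* R] is a finitely generated projective [R]-module, [F] being the Frobenius. *)
Definition pbasis (p : nat) (R : comPzRingType) := exists (T : finType)
    (theta : T -> R -> R) (e : T -> R),
  [/\ forall t x y, theta t (x + y) = theta t x + theta t y,
      forall t a b, theta t (a ^+ p * b) = a * theta t b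
    & forall b, b = \sum_t theta t b ^+ p * e t].

Lemma pbasis_reduced p (R : comPzRingType) : prime p -> pbasis p R ->
  forall x : R, x ^+ p = 0 -> x = 0.
Proof.
move=> pp [T [theta [e [thD thM thE]]]] x xp.
have th0 t : theta t 0 = 0 by apply: (addrI (theta t 0)); rewrite -thD !addr0.
have xth t : x * theta t 1 = 0 by rewrite -thM xp mul0r th0.
rewrite -[x]mulr1 [X in _ * X]thE mulr_sumr big1 // => t _.
by rewrite mulrA -(prednK (prime_gt0 pp)) exprS mulrA xth !mul0r.
Qed.

Lemma pbasis_field p (k : fieldType) : p \in [pchar k] ->
  (forall a : k, exists b, b ^+ p = a) -> pbasis p k.
Proof.
move=> charkp kperf.
have /choice[r rE] : forall a : k, exists b, b ^+ p = a by [].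
have fi : injective (fun x : k => x ^+ p) by exact: (fmorph_inj (pFrobenius_aut charkp)).
have p0 := pcharf0 charkp; have pp := pcharf_prime charkp.
exists unit, (fun=> r), (fun=> 1); split=> [_ x y|_ a b|b].
- by apply: fi; rewrite /= charp_exprD // !rE.
- by apply: fi; rewrite /= exprMn !rE.
by rewrite big_const card_unit /= addr0 mulr1 rE.
Qed.

Lemma pbasis_poly p (R : comNzRingType) : prime p -> p%:R = 0 :> R ->
  pbasis p R -> pbasis p {poly R}.
Proof.
move=> pp pR [T [theta [e [thD thM thE]]]]; have p_gt0 := prime_gt0 pp.
have pP : p%:R = 0 :> {poly R} by rewrite -polyC_natr pR.
have th0 t : theta t 0 = 0 by apply: (addrI (theta t 0)); rewrite -thD !addr0.
pose Th (ta : T * 'I_p) (h : {poly R}) := \poly_(m < size h) theta ta.1 h`_(p * m + ta.2).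
have ThE ta h m : (Th ta h)`_m = theta ta.1 h`_(p * m + ta.2).
  rewrite coef_poly; case: ltnP => // hm; rewrite nth_default ?th0 //.
  by apply: leq_trans hm (leq_trans _ (leq_addr _ _)); exact: leq_pmull.
have ThD ta x y : Th ta (x + y) = Th ta x + Th ta y.
  by apply/polyP => m; rewrite coefD !ThE coefD thD.
have ThX ta h : Th ta ('X^p * h) = 'X * Th ta h.
  apply/polyP => m; rewrite coefXM !ThE coefXnM; case: m => [|m] /=.
    by rewrite muln0 add0n ltn_ord th0.
  by rewrite mulnS -addnA ltnNge leq_addr /= addKn.
have ThC ta c h : Th ta (c%:P ^+ p * h) = c%:P * Th ta h.
  by apply/polyP => m; rewrite coefCM !ThE -rmorphXn coefCM thM.
exists (T * 'I_p)%type, Th, (fun ta : T * 'I_p => (e ta.1)%:P * 'X^(ta.2)); split=> // [ta g|b].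
  elim/poly_ind: g => [|g c ih] h.
    by rewrite charp_expr0 // !mul0r; apply: (addrI (Th ta 0)); rewrite -ThD !addr0.
  rewrite charp_exprD // exprMn mulrDl ThD -mulrA ih ThX ThC.
  by rewrite mulrA mulrDl.
pose Ph (h : {poly R}) := \sum_ta Th ta h ^+ p * ((e ta.1)%:P * 'X^(ta.2)).
have PhD x y : Ph (x + y) = Ph x + Ph y.
  rewrite /Ph -big_split; apply: eq_bigr => ta _.
  by rewrite ThD charp_exprD // mulrDl.
have Ph0 : Ph 0 = 0 by apply: (addrI (Ph 0)); rewrite -PhD !addr0.
rewrite -/(Ph b) -[b in LHS]coefK -[b in RHS]coefK poly_def.
rewrite (big_morph Ph PhD Ph0); apply: eq_bigr => j _.
move: (nat_of_ord j) => n; move: (b`_n) => c {b j}.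
pose r := Ordinal (ltn_pmod n p_gt0).
have ThcX ta : Th ta (c *: 'X^n) = if ta.2 == r then (theta ta.1 c)%:P * 'X^(n %/ p) else 0.
  apply/polyP => m; rewrite ThE coefZ coefXn; case: (ta.2 =P r) => [->|h].
    rewrite coefCM coefXn {1}(divn_eq n p) -[nat_of_ord r]/(n %% p)%N eqn_add2r mulnC eqn_pmul2r //.
    by case: eqP; rewrite ?mulr1 ?mulr0.
  rewrite coef0; case: eqP => [E|_]; last by rewrite mulr0.
  by case: h; apply/val_inj; rewrite /= -E mulnC modnMDl modn_small.
rewrite /Ph -(pair_bigA _ (fun t a => Th (t, a) (c *: 'X^n) ^+ p * ((e t)%:P * 'X^a))) /=.
rewrite [LHS](_ : _ = \sum_t (theta t c ^+ p * e t) *: 'X^n); last first.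
  by rewrite {1}(thE c) scaler_suml.
apply: eq_bigr => t _; rewrite (bigD1 r) //= big1 => [|a ar]; last first.
  by rewrite ThcX /= (negbTE ar) charp_expr0 // mul0r.
rewrite ThcX /= eqxx addr0 exprMn -exprM -mul_polyC rmorphM rmorphXn /=.
by rewrite {1}(divn_eq n p) exprD; ring.
Qed.

Section PolyEval.
Variables (R : comNzRingType) (A : comPzRingType) (f : {rmorphism R -> A}) (x : A).

Definition peval (q : {poly R}) : A := \sum_(i < size q) f q`_i * x ^+ i.

Lemma pevalE n (q : {poly R}) : (size q <= n)%N -> peval q = \sum_(i < n) f q`_i * x ^+ i.
Proof.
move=> h; rewrite /peval (big_ord_widen n (fun i => f q`_i * x ^+ i)) //.
rewrite big_mkcond; apply: eq_bigr => i _; case: ltnP => // hi.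
by rewrite nth_default // rmorph0 mul0r.
Qed.

Lemma pevalD : {morph peval : u v / u + v}.
Proof.
move=> u v; pose n := maxn (size u) (size v).
rewrite (@pevalE n (u + v)) ?size_polyD // (@pevalE n u) ?leq_maxl //.
rewrite (@pevalE n v) ?leq_maxr // -big_split; apply: eq_bigr => i _.
by rewrite coefD rmorphD mulrDl.
Qed.

Lemma pevalMX u : peval (u * 'X) = peval u * x.
Proof.
rewrite (@pevalE (size u).+1) ?(leq_trans (size_polyMleq _ _)) ?size_polyX ?addn2 //.
rewrite big_ord_recl coefMX /= rmorph0 mul0r add0r mulr_suml; apply: eq_bigr => i _.
by rewrite coefMX /= exprSr mulrA.
Qed.

Lemma pevalCM c u : peval (c%:P * u) = f c * peval u.
Proof.
rewrite (@pevalE (size u)) ?mul_polyC ?size_scale_leq // mulr_sumr.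
by apply: eq_bigr => i _; rewrite coefZ rmorphM mulrA.
Qed.

Lemma peval0 : peval 0 = 0.
Proof. by rewrite /peval size_poly0 big_ord0. Qed.

Lemma pevalC c : peval c%:P = f c.
Proof.
rewrite (@pevalE 1%N) ?size_polyC ?leq_b1 //.
by rewrite big_ord_recl big_ord0 coefC /= mulr1 addr0.
Qed.

Fact peval_zmod : zmod_morphism peval.
Proof.
move=> u v; apply/eqP; rewrite eq_sym subr_eq -pevalD.
by rewrite subrK.
Qed.

Fact peval_monoid : monoid_morphism peval.
Proof.
split=> [|u v]; first by rewrite -polyC1 pevalC rmorph1.
elim/poly_ind: u => [|u c ih]; first by rewrite mul0r peval0 mul0r.
rewrite mulrDl pevalD mulrAC pevalMX ih pevalCM pevalD pevalMX pevalC.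
by ring.
Qed.
HB.instance Definition _ := GRing.isZmodMorphism.Build {poly R} A peval peval_zmod.
HB.instance Definition _ := GRing.isMonoidMorphism.Build {poly R} A peval peval_monoid.

Lemma pevalX : peval 'X = x.
Proof. by rewrite -['X]mul1r pevalMX -polyC1 pevalC rmorph1 mul1r. Qed.

End PolyEval.

Lemma poly_cover p (k : fieldType) (A : comPzRingType) (phi : {rmorphism k -> A})
    (s : seq A) : p \in [pchar k] -> (forall a : k, exists b, b ^+ p = a) ->
  exists (R : comNzRingType) (iota : {rmorphism k -> R}) (pr : {rmorphism R -> A}),
    [/\ forall a, pr (iota a) = phi a, noeth R, pbasis p R & p%:R = 0 :> R] /\
    forall a, a \in s -> exists r, pr r = a.
Proof.
move=> charkp kperf; have pp := pcharf_prime charkp.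
elim: s => [|x s [R [iota [pr [[prE Rn Rp pR] hs]]]]].
  exists k, idfun, phi; split; last by [].
  split=> //; [exact: noeth_field|exact: pbasis_field|exact: pcharf0].
exists {poly R}, (polyC \o iota : {rmorphism k -> {poly R}}).
exists (peval pr x : {rmorphism {poly R} -> A}); split=> [|a].
  split=> [a|||] /=; [by rewrite pevalC prE|exact: noeth_poly|exact: pbasis_poly|].
  by rewrite -polyC_natr pR.
rewrite inE => /predU1P[->|/hs[r <-]]; first by exists 'X; exact: pevalX.
by exists r%:P; exact: pevalC.
Qed.

(** * Smooth algebras *)

Definition zsub (V : zmodType) (S : set V) := S 0 /\ forall x y, S x -> S y -> S (x - y).

Section ZQuotient.
Variables (V : zmodType) (S : set V).
Hypothesis hS : zsub S.

Definition zq_rel : rel V := fun x y => `[< S (x - y) >].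

Lemma zsubN x : S x -> S (- x).
Proof. by move=> Sx; rewrite -[- x]add0r; apply: hS.2 => //; exact: hS.1. Qed.

Lemma zsubD x y : S x -> S y -> S (x + y).
Proof. by move=> Sx Sy; rewrite -[y]opprK; apply: hS.2 => //; exact: zsubN. Qed.

Lemma zq_equiv : equiv_class_of zq_rel.
Proof.
split=> [x|x y|y x z] .
- by apply/asboolP; rewrite subrr; exact: hS.1.
- by apply/asboolP/asboolP => /zsubN; rewrite opprB.
- by move=> /asboolP h /asboolP /(zsubD h); rewrite addrA subrK => ?; apply/asboolP.
Qed.

Canonical zq_equiv_rel := EquivRelPack zq_equiv.
Definition zquot : Type := {eq_quot zq_equiv_rel}.
HB.instance Definition _ := Choice.on zquot.

Definition zpi (x : V) : zquot := \pi_({eq_quot zq_equiv_rel})%qT x.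
Definition zrep (q : zquot) : V := repr (q : {eq_quot zq_equiv_rel}).

Lemma zrepK q : zpi (zrep q) = q. Proof. exact: reprK. Qed.

Lemma zpiP x y : zpi x = zpi y <-> S (x - y).
Proof.
split=> [/eqquotP/asboolP //|h].
by apply/eqquotP/asboolP.
Qed.

Lemma zpi_zrep x : S (zrep (zpi x) - x). Proof. by apply/zpiP; rewrite zrepK. Qed.

Definition zqadd (a b : zquot) : zquot := zpi (zrep a + zrep b).
Definition zqopp (a : zquot) : zquot := zpi (- zrep a).

Lemma zqaddE x y : zqadd (zpi x) (zpi y) = zpi (x + y).
Proof. by apply/zpiP; rewrite opprD addrACA; apply: zsubD; exact: zpi_zrep. Qed.

Fact zqaddA : associative zqadd.
Proof. by move=> a b c; rewrite -[a]zrepK -[b]zrepK -[c]zrepK !zqaddE addrA. Qed.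
Fact zqaddC : commutative zqadd.
Proof. by move=> a b; rewrite /zqadd addrC. Qed.
Fact zqadd0 : left_id (zpi 0) zqadd.
Proof. by move=> a; rewrite -[a]zrepK zqaddE add0r. Qed.
Fact zqaddN : left_inverse (zpi 0) zqopp zqadd.
Proof. by move=> a; rewrite -{2}[a]zrepK zqaddE addNr. Qed.
HB.instance Definition _ := GRing.isZmodule.Build zquot zqaddA zqaddC zqadd0 zqaddN.

Lemma zpiD x y : zpi (x + y) = zpi x + zpi y. Proof. by rewrite -zqaddE. Qed.

Lemma zpi_eq0 x : zpi x = 0 <-> S x.
Proof. by rewrite -[x in S x]subr0; exact: zpiP. Qed.

End ZQuotient.

Definition submod (R : comPzRingType) (M : lmodType R) (S : set M) :=
  S 0 /\ forall (a : R) x y, S x -> S y -> S (a *: x + y).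

Lemma submod_zsub (R : comPzRingType) (M : lmodType R) (S : set M) : submod S -> zsub S.
Proof.
move=> [S0 SL]; split=> // x y Sx Sy.
by rewrite addrC -scaleN1r; exact: SL.
Qed.

Section QuotientModule.
Variables (R : comPzRingType) (M : lmodType R) (S : set M).
Hypothesis hS : submod S.

Definition mquot : Type := zquot (submod_zsub hS).
HB.instance Definition _ := GRing.Zmodule.on mquot.

Definition mpi (x : M) : mquot := zpi (submod_zsub hS) x.
Definition mqscale (a : R) (q : mquot) : mquot := mpi (a *: zrep q).

Lemma mqscaleE a x : mqscale a (mpi x) = mpi (a *: x).
Proof.
apply/zpiP; rewrite -scalerBr -[_ *: _]addr0; apply: hS.2; last exact: hS.1.
exact: zpi_zrep.
Qed.

Lemma mpi_surj (q : mquot) : exists x, mpi x = q.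
Proof. by exists (zrep q); exact: zrepK. Qed.

Lemma mpiD x y : mpi (x + y) = mpi x + mpi y. Proof. exact: zpiD. Qed.

Fact mqscaleA a b q : mqscale a (mqscale b q) = mqscale (a * b) q.
Proof. by have [x <-] := mpi_surj q; rewrite !mqscaleE scalerA. Qed.
Fact mqscale1 : left_id 1 mqscale.
Proof. by move=> q; have [x <-] := mpi_surj q; rewrite mqscaleE scale1r. Qed.
Fact mqscaleDr : right_distributive mqscale +%R.
Proof.
move=> a q r; have [x <-] := mpi_surj q; have [y <-] := mpi_surj r.
by rewrite -mpiD !mqscaleE -mpiD scalerDr.
Qed.
Fact mqscaleDl q : {morph mqscale^~ q : a b / a + b}.
Proof.
by move=> a b; have [x <-] := mpi_surj q; rewrite !mqscaleE -mpiD scalerDl.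
Qed.
HB.instance Definition _ :=
  GRing.Zmodule_isLmodule.Build R mquot mqscaleA mqscale1 mqscaleDr mqscaleDl.

Lemma mpi_lin : lin mpi.
Proof. by move=> a x y; rewrite mpiD -mqscaleE. Qed.

Lemma mpi_eq0 x : mpi x = 0 <-> S x. Proof. exact: zpi_eq0. Qed.

End QuotientModule.

Lemma ideal_zsub (R : comPzRingType) (I : set R) : ideal I -> zsub I.
Proof. by move=> hI; split=> [|x y]; [exact: ideal0|exact: idealB]. Qed.

Section QuotientRing.
Variables (R : comPzRingType) (I : set R).
Hypothesis hI : ideal I.

Definition rquot : Type := zquot (ideal_zsub hI).
HB.instance Definition _ := GRing.Zmodule.on rquot.

Definition rpi (x : R) : rquot := zpi (ideal_zsub hI) x.
Definition rqmul (q r : rquot) : rquot := rpi (zrep q * zrep r).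

Lemma rpiD x y : rpi (x + y) = rpi x + rpi y. Proof. exact: zpiD. Qed.

Lemma rqmulE x y : rqmul (rpi x) (rpi y) = rpi (x * y).
Proof.
apply/zpiP; have hx := zpi_zrep (ideal_zsub hI) x; have hy := zpi_zrep (ideal_zsub hI) y.
rewrite /rpi; set x' := zrep _ in hx *; set y' := zrep _ in hy *.
have -> : x' * y' - x * y = y' * (x' - x) + x * (y' - y) by ring.
by apply: idealD => //; exact: idealM.
Qed.

Lemma rpi_surj (q : rquot) : exists x, rpi x = q.
Proof. by exists (zrep q); exact: zrepK. Qed.

Fact rqmulA : associative rqmul.
Proof.
move=> a b c; have [x <-] := rpi_surj a; have [y <-] := rpi_surj b.
by have [z <-] := rpi_surj c; rewrite !rqmulE mulrA.
Qed.
Fact rqmulC : commutative rqmul.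
Proof. by move=> a b; rewrite /rqmul mulrC. Qed.
Fact rqmul1 : left_id (rpi 1) rqmul.
Proof. by move=> a; have [x <-] := rpi_surj a; rewrite rqmulE mul1r. Qed.
Fact rqmulDl : left_distributive rqmul +%R.
Proof.
move=> a b c; have [x <-] := rpi_surj a; have [y <-] := rpi_surj b.
by have [z <-] := rpi_surj c; rewrite -rpiD !rqmulE -rpiD mulrDl.
Qed.
HB.instance Definition _ :=
  GRing.Zmodule_isComPzRing.Build rquot rqmulA rqmulC rqmul1 rqmulDl.

Lemma rpi_eq x y : rpi x = rpi y <-> I (x - y). Proof. exact: zpiP. Qed.

Lemma rpiM x y : rpi (x * y) = rpi x * rpi y. Proof. by rewrite -rqmulE. Qed.

Fact rpi_zmod : zmod_morphism rpi.
Proof. by move=> x y; apply/eqP; rewrite eq_sym subr_eq -rpiD subrK. Qed.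
Fact rpi_monoid : monoid_morphism rpi.
Proof. by split=> [|x y]; rewrite ?rpiM. Qed.
HB.instance Definition _ := GRing.isZmodMorphism.Build R rquot rpi rpi_zmod.
HB.instance Definition _ := GRing.isMonoidMorphism.Build R rquot rpi rpi_monoid.

End QuotientRing.

Definition add_gen (R : comPzRingType) (x : R) (L : set R) : set R :=
  [set z | exists2 l, L l & exists a, z = l + a * x].

Lemma add_gen_ideal (R : comPzRingType) (x : R) (L : set R) : ideal L -> ideal (add_gen x L).
Proof.
move=> hL; split; first by exists 0; [exact: ideal0|exists 0; rewrite mul0r addr0].
  move=> _ _ [l Ll [a ->]] [m Lm [b ->]]; exists (l + m); first exact: idealD.
  by exists (a + b); rewrite mulrDl addrACA.
move=> b _ [l Ll [a ->]]; exists (b * l); first exact: idealM.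
by exists (b * a); rewrite mulrDr mulrA.
Qed.

Lemma sub_add_gen (R : comPzRingType) (x : R) (L : set R) : L `<=` add_gen x L.
Proof. by move=> l Ll; exists l => //; exists 0; rewrite mul0r addr0. Qed.

Lemma mem_add_gen (R : comPzRingType) (x : R) (L : set R) : ideal L -> add_gen x L x.
Proof. by move=> hL; exists 0; [exact: ideal0|exists 1; rewrite mul1r add0r]. Qed.

Section SmoothLift.
Variables (K R A : comPzRingType) (iota : {rmorphism K -> R}) (pr : {rmorphism R -> A}).
Variable phi : K -> A.
Hypothesis prE : forall c, pr (iota c) = phi c.
Hypothesis prS : forall a, exists r, pr r = a.
Hypothesis sm : formally_smooth phi.

Let I : set R := [set r | pr r = 0].

Lemma ker_ideal : ideal I.
Proof.
split=> [|a b|a b]; rewrite /I /= ?rmorph0 ?rmorphD ?rmorphM //.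
- by move=> -> ->; rewrite addr0.
- by move=> ->; rewrite mulr0.
Qed.

(* [g] is a section of [R / I = A] that is a ring morphism modulo [L]. *)
Definition section_mod (L : set R) (g : A -> R) :=
  [/\ forall a b, L (g (a + b) - (g a + g b)), forall a b, L (g (a * b) - g a * g b),
      L (g 1 - 1), forall a, pr (g a) = a & forall c, L (g (phi c) - iota c)].

Lemma section_mod_sub L L' g : L `<=` L' -> section_mod L g -> section_mod L' g.
Proof. by move=> h [g1 g2 g3 g4 g5]; split=> *; try apply: h; auto. Qed.

Lemma section_mod_lift1 L x : ideal L -> L `<=` I -> I x -> L (x ^+ 2) ->
  (exists g, section_mod (add_gen x L) g) -> exists g, section_mod L g.
Proof.
move=> hL LI Ix x2 [g [gD gM g1 gK gphi]].
have hL' := add_gen_ideal x hL.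
pose B : comPzRingType := rquot hL; pose C : comPzRingType := rquot hL'.
have qwd r s : rpi hL r = rpi hL s -> rpi hL' r = rpi hL' s.
  by move/rpi_eq => h; apply/rpi_eq/sub_add_gen.
pose qf (b : B) : C := rpi hL' (zrep b).
have qE r : qf (rpi hL r) = rpi hL' r by apply: qwd; exact: zrepK.
have qz : zmod_morphism qf.
  move=> b c; have [r <-] := rpi_surj b; have [s <-] := rpi_surj c.
  by rewrite -rmorphB !qE rmorphB.
have qm : monoid_morphism qf.
  split=> [|b c]; first by rewrite -(rmorph1 (rpi hL)) qE rmorph1.
  have [r <-] := rpi_surj b; have [s <-] := rpi_surj c.
  by rewrite -rmorphM !qE rmorphM.
pose qi := GRing.isZmodMorphism.Build B C qf qz.
pose qj := GRing.isMonoidMorphism.Build B C qf qm.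
pose q : {rmorphism B -> C} := HB.pack qf qi qj.
pose f0 (a : A) : C := rpi hL' (g a).
have fD a b : f0 (a + b) = f0 a + f0 b.
  by rewrite /f0 -rmorphD; apply/rpi_eq.
have fz : zmod_morphism f0.
  by move=> a b; apply/eqP; rewrite eq_sym subr_eq -fD subrK.
have fm : monoid_morphism f0.
  split=> [|a b]; first by rewrite /f0 -(rmorph1 (rpi hL')); apply/rpi_eq.
  by rewrite /f0 -rmorphM; apply/rpi_eq.
pose fi := GRing.isZmodMorphism.Build A C f0 fz.
pose fj := GRing.isMonoidMorphism.Build A C f0 fm.
pose f : {rmorphism A -> C} := HB.pack f0 fi fj.
have [||c|h [hq hb]] := sm (beta := rpi hL \o iota : {rmorphism K -> B}) (q := q) _ _ (f := f).
- by move=> c; have [r <-] := rpi_surj c; exists (rpi hL r); exact: qE.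
- move=> b c; have [r <-] := rpi_surj b; have [s <-] := rpi_surj c.
  have kq t : q (rpi hL t) = 0 -> add_gen x L t.
    by rewrite [q _]qE -(rmorph0 (rpi hL')) => /rpi_eq; rewrite subr0.
  move=> /kq[l Ll [a ->]] /kq[m Lm [a' ->]]; rewrite -rmorphM -(rmorph0 (rpi hL)).
  apply/rpi_eq; rewrite subr0.
  have -> : (l + a * x) * (m + a' * x) = (m + a' * x) * l + a * x * m + a * a' * x ^+ 2 by ring.
  by apply: idealD => //; [apply: idealD => //|]; exact: idealM.
- by rewrite [q _]qE; apply/rpi_eq; exact: gphi.
exists (fun a => zrep (h a)).
have hE a : rpi hL (zrep (h a)) = h a by exact: zrepK.
split=> [a b|a b|||c].
- by apply/(rpi_eq hL); rewrite rpiD !hE rmorphD.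
- by apply/(rpi_eq hL); rewrite rpiM !hE rmorphM.
- by apply/(rpi_eq hL); rewrite hE !rmorph1.
- move=> a; have /rpi_eq : rpi hL' (zrep (h a)) = rpi hL' (g a).
    exact: hq a.
  case=> l Ll [c E]; have := congr1 pr E.
  rewrite rmorphB gK rmorphD rmorphM (Ix : pr x = 0) mulr0 addr0 (LI _ Ll : pr l = 0).
  by move/eqP; rewrite subr_eq0 => /eqP.
- by apply/(rpi_eq hL); rewrite hE [LHS]hb.
Qed.

Lemma section_mod_lift n L x : ideal L -> L `<=` I -> I x -> L (x ^+ n) ->
  (exists g, section_mod (add_gen x L) g) -> exists g, section_mod L g.
Proof.
move=> + + Ix; elim: n L => [|n ih] L hL LI xn hg.
  have [g hg'] := hg; exists g; apply: section_mod_sub hg' => z _.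
  by rewrite -[z]mulr1; exact: idealM.
have hL' := add_gen_ideal (x ^+ n) hL.
case: n ih xn hL' => [|n] ih xn hL'.
  have [g hg'] := hg; exists g; apply: section_mod_sub hg' => _ [l Ll [a ->]].
  by apply: idealD => //; exact: idealM.
apply: (@section_mod_lift1 L (x ^+ n.+1)) => //.
- by rewrite /I /= exprS rmorphM (Ix : pr x = 0) mul0r.
- by rewrite -exprM muln2 -addnn addSnnS exprD; exact: idealM.
apply: ih => //.
- move=> _ [l /LI Il [a ->]]; apply: (idealD ker_ideal) => //.
  by rewrite exprSr mulrA; exact: idealM ker_ideal _ _ Ix.
- exact: mem_add_gen.
have [g hg'] := hg; exists g; apply: section_mod_sub hg' => _ [l Ll [a ->]].
by exists l; [exact: sub_add_gen|exists a].
Qed.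

Lemma section_mod_lifts n (s : seq R) L : ideal L -> L `<=` I -> I `<=` lgen s ->
  (forall x, x \in s -> I x /\ L (x ^+ n)) -> exists g, section_mod L g.
Proof.
move=> hL LI Is hs.
pose T := foldr (@add_gen R) L.
have hT t : (forall x, x \in t -> I x) -> ideal (T t) /\ T t `<=` I.
  elim: t => [|x t ih] ht //=; have [y yt|h1 h2] := ih.
    by apply: ht; rewrite inE yt orbT.
  split; first exact: add_gen_ideal.
  move=> _ [l /h2 Il [a ->]]; apply: (idealD ker_ideal) => //.
  by apply: (idealM ker_ideal); apply: ht; rewrite inE eqxx.
have LT t : L `<=` T t.
  by elim: t => [|x t ih] //=; exact: subset_trans ih (@sub_add_gen _ _ _).
have sT x t : (forall x, x \in t -> I x) -> x \in t -> T t x.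
  elim: t => [|y t ih] //= ht; have [|h1 h2] := hT t.
    by move=> z zt; apply: ht; rewrite inE zt orbT.
  rewrite inE => /predU1P[->|xt]; first exact: mem_add_gen.
  by apply: sub_add_gen; apply: ih => // z zt; apply: ht; rewrite inE zt orbT.
have sI x : x \in s -> I x by case/hs.
have [g0 g0E] := choice prS.
have IT : I `<=` T s.
  by move=> z /Is h; apply: (h (T s) (hT s sI).1) => x; exact: sT.
have : exists g, section_mod (T s) g.
  exists g0; apply: (section_mod_sub IT); split=> //.
  - by move=> a b; rewrite /I /= rmorphB rmorphD !g0E subrr.
  - by move=> a b; rewrite /I /= rmorphB rmorphM !g0E subrr.
  - by rewrite /I /= rmorphB rmorph1 !g0E subrr.
  - by move=> c; rewrite /I /= rmorphB prE !g0E subrr.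
elim: s sI hs {Is IT} => [|x s ih] // sI hs hg.
have sI' y : y \in s -> I y by move=> ys; apply: sI; rewrite inE ys orbT.
apply: ih => // [y ys|]; first by apply: hs; rewrite inE ys orbT.
have [h1 h2] := hT s sI'; have [Ix Lx] := hs x (mem_head _ _).
by apply: section_mod_lift hg => //; apply: LT; exact: Lx.
Qed.

Lemma smooth_pbasis p : prime p -> p%:R = 0 :> R -> noeth R -> pbasis p R -> pbasis p A.
Proof.
move=> pp pR hR [T [theta [e [thD thM thE]]]].
have hL : ideal (fpow p I) by exact: gen_ideal.
have LI : fpow p I `<=` I.
  move=> z h; apply: (h I ker_ideal) => _ [y Iy ->].
  rewrite -(prednK (prime_gt0 pp)) exprSr; exact: idealM ker_ideal _ _ Iy.
have [s [sI Is]] := hR I ker_ideal.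
have [|g [gD gM g1 gK gphi]] := @section_mod_lifts p s _ hL LI Is.
  by move=> x /sI Ix; split=> //; apply: (@sub_gen _ [set x0 | exists2 y, I y & x0 = y ^+ p]); exists x.
have th0 t : theta t 0 = 0 by apply: (addrI (theta t 0)); rewrite -thD !addr0.
have thN t x : theta t (- x) = - theta t x.
  by apply: (addrI (theta t x)); rewrite -thD !subrr th0.
have thI t x : fpow p I x -> I (theta t x).
  have h : ideal [set x | forall a t, I (theta t (a * x))].
    split=> [a u|x1 y h1 h2 a u|a y hy b u] /=.
    - by rewrite mulr0 th0; exact: ideal0 ker_ideal.
    - by rewrite mulrDr thD; exact: idealD ker_ideal _ _ (h1 _ _) (h2 _ _).
    - by rewrite mulrA.
  move=> /(_ _ h) h'; rewrite -[x]mul1r; apply: h' => _ [y Iy ->] a u /=.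
  by rewrite mulrC thM mulrC; exact: idealM ker_ideal _ _ Iy.
have prth t x y : fpow p I (x - y) -> pr (theta t x) = pr (theta t y).
  move=> /(thI t); rewrite thD thN /I /= rmorphB => /eqP.
  by rewrite subr_eq0 => /eqP.
exists T, (fun t a => pr (theta t (g a))), (fun t => pr (e t)); split=> [t a b|t a b|b].
- by rewrite (prth t _ _ (gD a b)) thD rmorphD.
- rewrite -[in RHS](gK a) -rmorphM -thM; apply: prth.
  have gX n : fpow p I (g (a ^+ n) - g a ^+ n).
    elim: n => [|n ih]; first by [].
    rewrite !exprS -(subrK (g a * g (a ^+ n)) (g (a * _))) -addrA -mulrBr.
    by apply: (idealD hL (gM _ _)); exact: (idealM hL).
  rewrite -(subrK (g (a ^+ p) * g b) (g (_ * _))) -addrA -mulrBl.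
  by apply: (idealD hL (gM _ _)); rewrite mulrC; exact: (idealM hL).
- rewrite -[LHS]gK [X in pr X]thE rmorph_sum; apply: eq_bigr => t _.
  by rewrite rmorphM rmorphXn.
Qed.

End SmoothLift.

Lemma finite_type_surj (k R A : comPzRingType) (phi : k -> A) (iota : k -> R)
    (pr : {rmorphism R -> A}) (s : seq A) :
  (forall S : set A, subring S -> (forall r, S (phi r)) ->
    (forall a, a \in s -> S a) -> S = setT) ->
  (forall c, pr (iota c) = phi c) -> (forall a, a \in s -> exists r, pr r = a) ->
  forall a, exists r, pr r = a.
Proof.
move=> ft prE hs a; have := ft [set a | exists r, pr r = a].
have hsub : subring [set a | exists r, pr r = a].
  split=> [|_ _ [r <-] [t <-]|_ _ [r <-] [t <-]].
  - by exists 1; rewrite rmorph1.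
  - by exists (r - t); rewrite rmorphB.
  - by exists (r * t); rewrite rmorphM.
move=> /(_ hsub) /(_ (fun c => ex_intro _ (iota c) (prE c))) /(_ hs) E.
by have : [set: A] a by []; rewrite -E.
Qed.

Lemma smooth_noeth_pbasis p (k : fieldType) (A : comPzRingType) (phi : {rmorphism k -> A}) :
  p \in [pchar k] -> (forall a : k, exists b, b ^+ p = a) ->
  finite_type phi -> formally_smooth phi -> noeth A /\ pbasis p A.
Proof.
move=> charkp kperf [s hs] sm; have pp := pcharf_prime charkp.
have [R [iota [pr [[prE Rn Rp pR] sR]]]] := poly_cover phi s charkp kperf.
have prS := finite_type_surj hs prE sR.
split; first exact: noeth_surj prS Rn.
exact: (smooth_pbasis prE prS sm).
Qed.

(** * Projectivity by Frobenius descent *)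

Section HomModule.
Variables (S : comPzRingType) (N : lmodType S) (M : zmodType) (C : set (N -> M)).

Record hom_closed : Prop := HomClosed {
  hclosed0 : C (fun=> 0);
  hclosedD : forall u v, C u -> C v -> C (fun x => u x + v x);
  hclosedN : forall u, C u -> C (fun x => - u x);
  hclosedZ : forall (s : S) u, C u -> C (fun x => u (s *: x));
  hclosed_add : forall u, C u -> {morph u : x y / x + y}
}.

Record homc := HomC { hc_fun :> N -> M; hcP : C hc_fun }.

Hypothesis hC : hom_closed.

(* Additive maps in [C], on which [S] acts by precomposition. *)
Definition homm (h : hom_closed) : Type := homc.

Local Notation H := (homm hC).

Lemma homm_ext (u v : H) : (forall x, (u : homc) x = (v : homc) x) -> u = v.
Proof.
case: u v => [u uP] [v vP] /= /funext e; move: e uP vP => -> uP vP.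
by congr HomC; exact: Prop_irrelevance.
Qed.

HB.instance Definition _ := gen_eqMixin H.
HB.instance Definition _ := gen_choiceMixin H.

Definition homm_add (u v : H) : H := HomC (hclosedD hC (hcP u) (hcP v)).
Definition homm_zero : H := HomC (hclosed0 hC).
Definition homm_opp (u : H) : H := HomC (hclosedN hC (hcP u)).
Definition homm_scale (s : S) (u : H) : H := HomC (hclosedZ hC s (hcP u)).

Fact homm_addA : associative homm_add.
Proof. by move=> u v w; apply: homm_ext => x; exact: addrA. Qed.
Fact homm_addC : commutative homm_add.
Proof. by move=> u v; apply: homm_ext => x; exact: addrC. Qed.
Fact homm_add0 : left_id homm_zero homm_add.
Proof. by move=> u; apply: homm_ext => x; exact: add0r. Qed.
Fact homm_addN : left_inverse homm_zero homm_opp homm_add.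
Proof. by move=> u; apply: homm_ext => x; exact: addNr. Qed.
HB.instance Definition _ := GRing.isZmodule.Build H homm_addA homm_addC homm_add0 homm_addN.

Fact homm_scaleA a b u : homm_scale a (homm_scale b u) = homm_scale (a * b) u.
Proof. by apply: homm_ext => x /=; rewrite scalerA mulrC. Qed.
Fact homm_scale1 : left_id 1 homm_scale.
Proof. by move=> u; apply: homm_ext => x /=; rewrite scale1r. Qed.
Fact homm_scaleDr : right_distributive homm_scale +%R.
Proof. by move=> a u v; apply: homm_ext. Qed.
Fact homm_scaleDl u : {morph homm_scale^~ u : a b / a + b}.
Proof.
move=> a b; apply: homm_ext => x /=; rewrite scalerDl.
exact: (hclosed_add hC (hcP u)).
Qed.
HB.instance Definition _ :=
  GRing.Zmodule_isLmodule.Build S H homm_scaleA homm_scale1 homm_scaleDr homm_scaleDl.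

Lemma hommZ s (u : H) x : (s *: u : H) x = u (s *: x). Proof. by []. Qed.
Lemma hommD (u v : H) x : (u + v : H) x = u x + v x. Proof. by []. Qed.
Lemma homm_sum (T : Type) (s : seq T) (F : T -> H) x :
  (\sum_(t <- s) F t : H) x = \sum_(t <- s) F t x.
Proof.
elim: s => [|t s ih]; first by rewrite !big_nil.
by rewrite !big_cons -ih.
Qed.
End HomModule.

Lemma lin_sum (R : comPzRingType) (M N : lmodType R) (f : M -> N) (T : Type)
    (s : seq T) (F : T -> M) : lin f -> f (\sum_(t <- s) F t) = \sum_(t <- s) f (F t).
Proof. by move=> lf; exact: (big_morph f (linD lf) (lin0 lf)). Qed.

Lemma semilin_sum (R S : comPzRingType) (phi : {rmorphism R -> S}) (M : lmodType R)
    (N : lmodType S) (g : M -> N) (T : Type) (s : seq T) (F : T -> M) :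
  semilin phi g -> g (\sum_(t <- s) F t) = \sum_(t <- s) g (F t).
Proof. by move=> lg; exact: (big_morph g (semilinD lg) (semilin0 lg)). Qed.

Lemma linN (R : comPzRingType) (M N : lmodType R) (f : M -> N) : lin f ->
  forall x, f (- x) = - f x.
Proof. by move=> lf x; rewrite -scaleN1r (linZ lf) scaleN1r. Qed.

Lemma linB (R : comPzRingType) (M N : lmodType R) (f : M -> N) : lin f ->
  forall x y, f (x - y) = f x - f y.
Proof. by move=> lf x y; rewrite (linD lf) (linN lf). Qed.

Lemma lin_expand (R : comPzRingType) (M N : lmodType R) (T : finType)
    (f : T -> M -> R^o) (v : T -> N) :
  (forall t, lin (f t)) -> lin (fun x => \sum_t (f t x : R) *: v t).
Proof.
move=> lf a x y; rewrite scaler_sumr -big_split; apply: eq_bigr => t _.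
by rewrite lf scalerDl scalerA.
Qed.

(* The [a] such that [a : M -> M] factors through a finite free module; [1] is one of
   them exactly when [M] is finitely generated and projective. *)
Definition ffree (R : comPzRingType) (M : lmodType R) : set R :=
  [set a | exists (T : finType) (f : T -> M -> R^o) (v : T -> M),
    (forall t, lin (f t)) /\ forall x, a *: x = \sum_t (f t x : R) *: v t].

Lemma ffree_ideal (R : comPzRingType) (M : lmodType R) : ideal (ffree M).
Proof.
split=> [|a b [T [f [v [lf fE]]]] [U [g [w [lg gE]]]]|a b [T [f [v [lf fE]]]]].
- exists void, (fun t _ => 0), (fun=> 0); split; first by case.
  by move=> x; rewrite scale0r big1 //; case.
- exists (T + U)%type, (fun tu => match tu with inl t => f t | inr u => g u end).
  exists (fun tu => match tu with inl t => v t | inr u => w u end).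
  by split=> [[]|x] //; rewrite scalerDl fE gE big_sumType.
- exists T, (fun t x => a * f t x), v; split=> [t c x y|x].
    rewrite lf mulrDr; congr (_ + _); exact: mulrCA.
  by rewrite -scalerA fE scaler_sumr; apply: eq_bigr => t _; rewrite scalerA.
Qed.

Lemma ffree_retract (R : comPzRingType) (M N : lmodType R) (f : M -> N) (g : N -> M) :
  lin f -> lin g -> cancel g f -> ffree M `<=` ffree N.
Proof.
move=> lf lg gK a [T [h [v [lh hE]]]]; exists T, (fun t x => h t (g x)), (fun t => f (v t)).
split=> [t|x]; first exact: lin_comp (lh t) lg.
rewrite -{1}(gK x) -(linZ lf) hE (lin_sum _ _ lf).
by apply: eq_bigr => t _; rewrite (linZ lf).
Qed.

Lemma ffree_bchg (R S : comPzRingType) (phi : {rmorphism R -> S}) (M : lmodType R)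
    (N : lmodType S) (g : M -> N) :
  semilin phi g -> bijective (ulift g : bchg phi M -> N) ->
  forall a, ffree M a -> ffree N (phi a).
Proof.
move=> hg gb a [T [f [v [lf fE]]]].
have /choice[f' f'P] : forall t, exists f' : N -> S^o,
    lin f' /\ forall x, f' (g x) = phi (f t x).
  move=> t; have [|f' lf' f'E] := bchg_univ hg gb (P := S^o) (h := fun x => phi (f t x)).
    by move=> b x y; rewrite lf rmorphD rmorphM.
  by exists f'.
exists T, f', (fun t => g (v t)); split=> [t|y]; first exact: (f'P t).1.
apply: (bchg_uniq hg gb (h := fun y => phi a *: y)
  (h' := fun y => \sum_t (f' t y : S) *: g (v t))) => [b x z|b x z|x] /=.
- by rewrite scalerDr !scalerA mulrC.
- exact: (lin_expand (fun t => g (v t)) (fun t => (f'P t).1)).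
rewrite -(semilinZ hg) fE (semilin_sum _ _ hg).
by apply: eq_bigr => t _; rewrite (f'P t).2 (semilinZ hg).
Qed.

Section FrobeniusDescent.
Variables (p : nat) (R : comPzRingType) (F : {rmorphism R -> R}).
Hypotheses (pp : prime p) (FE : forall a, F a = a ^+ p).
Hypothesis p0 : p%:R = 0 :> R.

Let bchg_ulift_bij (M : lmodType R) : bijective (ulift (ugen : M -> bchg F M) : bchg F M -> bchg F M).
Proof.
have lg := @bchg_gen _ _ F M.
by apply: bchg_bij => // [P h lh|P h h' lh lh' E y];
  [exists (ulift h : bchg F M -> P); [exact: ulift_lin|move=> x; exact: ulift_gen]
  |exact: umod_lin_ext].
Qed.

Lemma ffree_frob (M : lmodType R) a : ffree M a -> ffree (bchg F M) (a ^+ p).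
Proof. by rewrite -FE; apply: ffree_bchg (@bchg_gen _ _ F M) (bchg_ulift_bij M) _. Qed.

(* If [a] factors through a free module on [F^* M], then applying [theta_t (x) M] to the
   factorization shows that each [theta_t a] factors through a free module on [M]. *)
Lemma ffree_frob_inv (M : lmodType R) : pbasis p R ->
  ffree (bchg F M) `<=` fpow p (ffree M).
Proof.
move=> [T [theta [e [thD thM thE]]]] a [U [f [w [lf fE]]]].
pose C : set (R^o -> M) := [set u : R^o -> M | {morph u : x y / x + y} /\
  forall c b, u (c ^+ p * b) = c *: u b].
have hC : hom_closed C.
  split=> [|u v [uD uZ] [vD vZ]|u [uD uZ]|s u [uD uZ]|u []//].
  - by split=> [x y|c b]; rewrite ?addr0 ?scaler0.
  - by split=> [x y|c b]; rewrite ?uD ?vD ?uZ ?vZ ?scalerDr // addrACA.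
  - by split=> [x y|c b]; rewrite ?uD ?uZ ?scalerN // opprD.
  - split=> [x y|c b]; first by rewrite scalerDr uD.
    have -> : s *: (c ^+ p * b : R^o) = c ^+ p * (s *: (b : R^o)) by exact: mulrCA.
    exact: uZ.
have CP t m : C (fun b => theta t b *: m).
  by split=> [x y|c b]; rewrite ?thD ?thM ?scalerDl ?scalerA.
pose P : lmodType R := homm hC.
have regZ (c d : R) : c *: (d : R^o) = c * d by [].
pose U0 t (m : M) : P := HomC (CP t m).
have U0l t : semilin F (U0 t).
  move=> c x y; apply: homm_ext => b.
  by rewrite hommD hommZ /= FE regZ thM scalerDr !scalerA mulrC.
pose Ut t : bchg F M -> P := ulift (U0 t).
have Ul t : lin (Ut t) by exact/ulift_lin/U0l.
have UtE t m : Ut t (ugen m) = U0 t m by rewrite /Ut ulift_gen //; exact: U0l.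
have tha t : ffree M (theta t a).
  exists (U * T)%type, (fun ul m => theta ul.2 (f ul.1 (ugen m))).
  exists (fun ul => (Ut t (w ul.1) : homc C) (e ul.2)); split=> [[u l] c x y /=|m].
    by rewrite bchg_gen lf FE thD thM.
  have := congr1 (fun z => (Ut t z : homc C) 1) (fE (ugen m)).
  rewrite (linZ (Ul t)) (lin_sum _ _ (Ul t)) UtE.
  rewrite hommZ /= regZ mulr1 => ->.
  rewrite homm_sum -(pair_bigA _ (fun u l => theta l (f u (ugen m)) *:
    (Ut t (w u) : homc C) (e l))) /=.
  apply: eq_bigr => u _; rewrite (linZ (Ul t)) hommZ regZ mulr1.
  have [uD uZ] := hcP (Ut t (w u)).
  have u0 : (Ut t (w u) : homc C) 0 = 0.
    by apply: (addrI ((Ut t (w u) : homc C) 0)); rewrite -uD !addr0.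
  by rewrite {1}(thE (f u (ugen m))) (big_morph _ uD u0); apply: eq_bigr => l _; rewrite uZ.
rewrite (thE a); apply: (ideal_sum _ (gen_ideal _)) => t.
rewrite mulrC; apply: (idealM (gen_ideal _)); apply: sub_gen.
by exists (theta t a).
Qed.

Lemma ffree1_frob_inv (M : lmodType R) : pbasis p R -> ffree (bchg F M) 1 -> ffree M 1.
Proof.
move=> pR /(ffree_frob_inv pR) /(_ _ (ffree_ideal M)); apply=> _ [y My ->].
rewrite -(prednK (prime_gt0 pp)) exprSr; exact: idealM (ffree_ideal M) _ _ My.
Qed.

Lemma ffree_neq0 (M : lmodType R) : (forall a b : R, a * b = 0 -> a = 0 \/ b = 0) ->
  1 <> 0 :> R -> fingen M -> exists2 a, a <> 0 & ffree M a.
Proof.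
move=> dom n10 [I [v vE]].
pose span (t : seq M) := [set x | exists c : nat -> R, x = \sum_(i < size t) c i *: t`_i].
pose indep (t : seq M) := forall c : nat -> R,
  \sum_(i < size t) c i *: t`_i = 0 -> forall i, (i < size t)%N -> c i = 0.
have spanL t a x y : span t x -> span t y -> span t (a *: x + y).
  move=> [c ->] [d ->]; exists (fun i => a * c i + d i).
  rewrite scaler_sumr -big_split; apply: eq_bigr => i _.
  by rewrite scalerDl scalerA.
have span0 t : span t 0.
  by exists (fun=> 0); rewrite big1 // => i _; rewrite scale0r.
have spanZ t a x : span t x -> span t (a *: x).
  by move=> tx; rewrite -[_ *: _]addr0; exact: spanL.
have [t [a [a0 it ht]]] : exists t a, [/\ a <> 0, indep t &
    forall x, x \in [seq v i | i <- enum I] -> span t (a *: x)].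
  elim: [seq _ | i <- _] => [|x s [t [a [a0 it ht]]]].
    by exists [::], 1; split=> // c _ i.
  have [ix|/existsNP[c /not_implyP[]]] := pselect (indep (x :: t)).
    exists (x :: t), a; split=> // y; rewrite inE => /predU1P[->|ys].
      exists (fun i => if i is 0 then a else 0); rewrite big_ord_recl /= big1 ?addr0 // => i _.
      by rewrite scale0r.
    have [c ->] := ht y ys; exists (fun i => if i is j.+1 then c j else 0).
    by rewrite big_ord_recl /= scale0r add0r.
  rewrite big_ord_recl /= => cE nc.
  have c0 : c 0%N <> 0.
    move=> c0; apply: nc => -[_|i hi]; first by [].
    by apply: (it (fun i => c i.+1)) => //; rewrite -[RHS]cE c0 scale0r add0r.
  exists t, (a * c 0%N); split=> // [/dom[]//|y].
  rewrite inE => /predU1P[->|/ht h]; last by rewrite mulrC -scalerA; exact: spanZ.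
  rewrite -scalerA; apply: spanZ; exists (fun i => - c i.+1).
  apply: (addIr (\sum_(i < size t) c i.+1 *: t`_i)); rewrite cE -big_split big1 // => i _.
  by rewrite /= -scalerDl addNr scale0r.
have {}ht x : span t (a *: x).
  have [c ->] := vE x; rewrite scaler_sumr.
  elim: (index_enum I) => [|i s ih]; first by rewrite big_nil.
  rewrite big_cons scalerA mulrC -scalerA; apply: spanL => //; apply: ht.
  by apply: map_f; rewrite mem_enum.
have [f fE] := choice ht.
exists a => //; exists 'I_(size t), (fun (i : 'I_(size t)) x => f x i), (fun i : 'I_(size t) => t`_i).
split=> // i b x y.
have : \sum_(i < size t) (f (b *: x + y) i - (b * f x i + f y i)) *: t`_i = 0.
  rewrite (eq_bigr (fun i : 'I_(size t) => f (b *: x + y) i *: t`_i -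
    (b *: (f x i *: t`_i) + f y i *: t`_i))) => [|j _].
    rewrite sumrB big_split -scaler_sumr -!fE.
    by rewrite scalerDr !scalerA mulrC subrr.
  by rewrite scalerBl scalerDl scalerA.
move/(it (fun i => f (b *: x + y) i - (b * f x i + f y i)))/(_ i (ltn_ord i)).
by move/eqP; rewrite subr_eq0 => /eqP.
Qed.

(* If [M 0] is not projective, the ideals [ffree (M n)] are nonzero and proper with the
   same radical [J], and [ffree (M 0)] lies in every Frobenius power of [J]; this is
   impossible in a noetherian domain. *)
Lemma ffree1_descent (M : nat -> lmodType R) :
  (forall a b : R, a * b = 0 -> a = 0 \/ b = 0) -> noeth R -> pbasis p R -> fingen (M 0%N) ->
  (forall n, exists f : M n -> bchg F (M n.+1), exists g, [/\ lin f, lin g,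
     cancel f g & cancel g f]) -> ffree (M 0%N) 1.
Proof.
move=> dom hR pR fgM iso.
have [e|n10] := pselect (1 = 0 :> R); first by rewrite e; exact: ideal0 (ffree_ideal _).
have [a a0 Ma] := ffree_neq0 dom n10 fgM.
pose J : set R := [set b | exists n, ffree (M 0%N) (b ^+ (p ^ n))].
have powM m n b : (m <= n)%N -> ffree (M 0%N) (b ^+ (p ^ m)) -> ffree (M 0%N) (b ^+ (p ^ n)).
  move=> mn; rewrite -(subnK mn) expnD mulnC exprM.
  have h0 : (0 < p ^ (n - m))%N by rewrite expn_gt0 prime_gt0.
  move: (b ^+ _) => c h; rewrite -(prednK h0).
  by rewrite exprSr; exact: idealM (ffree_ideal _) _ _ h.
have hJ : ideal J.
  split=> [|b c [m hb] [n hc]|b c [n hc]].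
  - by exists 1%N; rewrite expn1 charp_expr0 //; exact: ideal0 (ffree_ideal _).
  - exists (maxn m n); rewrite charp_exprDn //; apply: (idealD (ffree_ideal _)).
      by apply: powM hb; exact: leq_maxl.
    by apply: powM hc; exact: leq_maxr.
  - by exists n; rewrite exprMn; exact: idealM (ffree_ideal _) _ _ hc.
have up k b : ffree (M k.+1) b -> ffree (M k) (b ^+ p).
  move=> /ffree_frob h; have [f [g [lf lg fK gK]]] := iso k.
  exact: (ffree_retract lg lf fK).
have MJ n : ffree (M n) `<=` J.
  move=> b hb; exists n; elim: n b hb => [|n ih] b hb; first by rewrite expr1.
  by rewrite expnS exprM; apply: ih; exact: up.
have down k : ffree (M k) `<=` fpow p (ffree (M k.+1)).
  have [f [g [lf lg fK gK]]] := iso k.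
  by apply: subset_trans (ffree_frob_inv pR); exact: (ffree_retract lf lg gK).
have downn n : forall k, ffree (M k) `<=` fpow (p ^ n) (ffree (M (k + n)%N)).
  elim: n => [|n ih] k b hb; first by apply: sub_gen; exists b; rewrite ?addn0 ?expn0 ?expr1.
  have hI : ideal [set x | fpow (p ^ n.+1) (ffree (M (k + n.+1)%N)) (x ^+ p)].
    have hg := gen_ideal [set x | exists2 y, ffree (M (k + n.+1)%N) y & x = y ^+ (p ^ n.+1)].
    split=> [|x y hx hy|x y hy] /=.
    - by rewrite charp_expr0 //; exact: ideal0 hg.
    - by rewrite charp_exprD //; exact: idealD hg _ _ hx hy.
    - by rewrite exprMn; exact: idealM hg _ _ hy.
  apply: (down k b hb _ (gen_ideal _)) => _ [x /ih hx ->].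
  apply: (hx _ hI) => _ [y hy ->] /=; apply: sub_gen; exists y.
    by rewrite -addSnnS.
  by rewrite expnSr exprM.
have [n|i [n hi] ai] := frobenius_krull (f := a) hR (prime_gt1 pp) (charp_exprDn pp p0) hJ.
  apply: (downn n 0%N a Ma _ (gen_ideal _)) => _ [y hy ->].
  by apply: sub_gen; exists y => //; exact: MJ hy.
have i1 : i = 1.
  have : (i - 1) * a = 0 by rewrite mulrBl mul1r -ai subrr.
  by case/dom => // /eqP; rewrite subr_eq0 => /eqP.
by move: hi; rewrite i1 expr1n.
Qed.

End FrobeniusDescent.

(** * Localization of modules *)

Section ModuleLocalization.
Variables (A B : comPzRingType) (f : A) (phi : {rmorphism A -> B}).
Hypothesis hloc : is_localization f phi.
Variable M : lmodType A.

(* Fractions [x / f^m]. *)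
Definition mloc_rel : rel {classic (M * nat)%type} :=
  fun a b => `[< exists k, f ^+ (k + b.2) *: a.1 = f ^+ (k + a.2) *: b.1 >].

Lemma mloc_equiv : equiv_class_of mloc_rel.
Proof.
split=> [[x m]|[x m] [y n]|[y n] [x m] [z q]]; rewrite /mloc_rel /=.
- by apply/asboolP; exists 0%N.
- by apply/asboolP/asboolP => -[k h]; exists k.
- move=> /asboolP[k hk] /asboolP[l hl]; apply/asboolP; exists (k + l + n)%N.
  have : f ^+ (l + q) *: (f ^+ (k + n) *: x) = f ^+ (k + m) *: (f ^+ (l + n) *: z).
    by rewrite hk -hl !scalerA mulrC.
  rewrite !scalerA -!exprD.
  have -> : (l + q + (k + n) = k + l + n + q)%N by lia.
  by have -> : (k + m + (l + n) = k + l + n + m)%N by lia.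
Qed.

Canonical mloc_equiv_rel := EquivRelPack mloc_equiv.
Definition mloc : Type := {eq_quot mloc_equiv_rel}.
HB.instance Definition _ := Choice.on mloc.

Definition lfrac (x : M) (m : nat) : mloc := \pi_({eq_quot mloc_equiv_rel})%qT (x, m).

Lemma lfracP x m y n : lfrac x m = lfrac y n <->
  exists k, f ^+ (k + n) *: x = f ^+ (k + m) *: y.
Proof.
split=> [/eqquotP/asboolP //|h].
by apply/eqquotP/asboolP.
Qed.

Lemma lfrac_surj (q : mloc) : exists x m, q = lfrac x m.
Proof.
case e : (repr (q : {eq_quot mloc_equiv_rel})) => [x m].
by exists x, m; rewrite /lfrac -e reprK.
Qed.

Lemma lfrac_expand x m k : lfrac x m = lfrac (f ^+ k *: x) (m + k).
Proof.
apply/lfracP; exists 0%N.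
by rewrite scalerA -exprD.
Qed.

Lemma lfrac2 (q r : mloc) : exists x y m, q = lfrac x m /\ r = lfrac y m.
Proof.
have [x [m ->]] := lfrac_surj q; have [y [n ->]] := lfrac_surj r.
exists (f ^+ n *: x), (f ^+ m *: y), (m + n)%N.
by split; rewrite ?[RHS]addnC; [exact: lfrac_expand|rewrite addnC; exact: lfrac_expand].
Qed.

Lemma lfrac3 (q r s : mloc) : exists x y z m,
  [/\ q = lfrac x m, r = lfrac y m & s = lfrac z m].
Proof.
have [x [y [m [-> ->]]]] := lfrac2 q r; have [z [n ->]] := lfrac_surj s.
exists (f ^+ n *: x), (f ^+ n *: y), (f ^+ m *: z), (m + n)%N.
by split; [exact: lfrac_expand|exact: lfrac_expand|rewrite addnC; exact: lfrac_expand].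
Qed.

Fact mloc_add_ex (q r : mloc) : exists xym : M * M * nat,
  q = lfrac xym.1.1 xym.2 /\ r = lfrac xym.1.2 xym.2.
Proof. by have [x [y [m h]]] := lfrac2 q r; exists (x, y, m). Qed.

Definition mloc_add (q r : mloc) : mloc :=
  let xym := sval (cid (mloc_add_ex q r)) in lfrac (xym.1.1 + xym.1.2) xym.2.

Lemma mloc_addE x y m : mloc_add (lfrac x m) (lfrac y m) = lfrac (x + y) m.
Proof.
rewrite /mloc_add; case: (cid _) => -[[x' y'] n] /= [].
move=> /lfracP[k hk] /lfracP[l hl]; apply/lfracP; exists (k + l)%N.
rewrite !scalerDr; congr (_ + _).
- have -> : (k + l + m = l + (k + m))%N by lia.
  have -> : (k + l + n = l + (k + n))%N by lia.
  by rewrite exprD -scalerA -hk scalerA -exprD.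
- by rewrite -!addnA exprD -scalerA -hl scalerA -exprD.
Qed.

Fact mloc_addA : associative mloc_add.
Proof. by move=> q r s; have [x [y [z [m [-> -> ->]]]]] := lfrac3 q r s; rewrite !mloc_addE addrA. Qed.
Fact mloc_addC : commutative mloc_add.
Proof. by move=> q r; have [x [y [m [-> ->]]]] := lfrac2 q r; rewrite !mloc_addE addrC. Qed.
Lemma lfrac0 m : lfrac 0 m = lfrac 0 0.
Proof. by apply/lfracP; exists 0%N; rewrite !scaler0. Qed.
Fact mloc_add0 : left_id (lfrac 0 0) mloc_add.
Proof.
by move=> q; have [x [m ->]] := lfrac_surj q; rewrite -(lfrac0 m) mloc_addE add0r.
Qed.

Fact mloc_scale_ex (b : B) : exists an : A * nat, b * phi f ^+ an.2 = phi an.1.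
Proof. by have [_ h _] := hloc; have [a [n e]] := h b; exists (a, n). Qed.

Fact mloc_rep_ex (q : mloc) : exists xm : M * nat, q = lfrac xm.1 xm.2.
Proof. by have [x [m ->]] := lfrac_surj q; exists (x, m). Qed.

Definition mloc_scale (b : B) (q : mloc) : mloc :=
  let an := sval (cid (mloc_scale_ex b)) in let xm := sval (cid (mloc_rep_ex q)) in
  lfrac (an.1 *: xm.1) (an.2 + xm.2).

Lemma mloc_scaleE b a n x m : b * phi f ^+ n = phi a ->
  mloc_scale b (lfrac x m) = lfrac (a *: x) (n + m).
Proof.
move=> ba; rewrite /mloc_scale; case: (cid _) => -[a' n'] /= ba'.
case: (cid _) => -[x' m'] /= /lfracP[k hk].
have [_ _ hker] := hloc.
have [|l hl] := hker (f ^+ n * a' - f ^+ n' * a).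
  by rewrite rmorphB !rmorphM !rmorphXn -ba -ba' mulrCA (mulrCA _ b) (mulrC (phi f ^+ n)) subrr.
have {}hl : f ^+ l * f ^+ n * a' = f ^+ l * f ^+ n' * a.
  by apply/eqP; rewrite -subr_eq0 -!mulrA -mulrBr hl.
apply/lfracP; exists (l + k)%N.
rewrite !scalerA !exprD.
have -> : f ^+ l * f ^+ k * (f ^+ n * f ^+ m) * a' = f ^+ l * f ^+ n * a' * (f ^+ k * f ^+ m) by ring.
have -> : f ^+ l * f ^+ k * (f ^+ n' * f ^+ m') * a = f ^+ l * f ^+ n' * a * (f ^+ k * f ^+ m') by ring.
by rewrite hl -!scalerA !(scalerA (f ^+ k)) -!exprD hk.
Qed.

Definition mloc_opp (q : mloc) : mloc := mloc_scale (-1) q.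

Fact mloc_addN : left_inverse (lfrac 0 0) mloc_opp mloc_add.
Proof.
move=> q; have [x [m ->]] := lfrac_surj q; rewrite /mloc_opp (@mloc_scaleE _ (-1) 0).
  by rewrite scaleN1r add0n mloc_addE addNr lfrac0.
by rewrite rmorphN !rmorph1 mulr1.
Qed.
HB.instance Definition _ := GRing.isZmodule.Build mloc mloc_addA mloc_addC mloc_add0 mloc_addN.

Fact mloc_scaleA b c q : mloc_scale b (mloc_scale c q) = mloc_scale (b * c) q.
Proof.
have [x [m ->]] := lfrac_surj q; have [[a n] /= ea] := mloc_scale_ex b.
have [[a' n'] /= ea'] := mloc_scale_ex c.
rewrite (mloc_scaleE _ _ ea') (mloc_scaleE _ _ ea) (@mloc_scaleE (b * c) (a * a') (n + n')%N).
  by rewrite scalerA addnA.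
by rewrite exprD rmorphM -ea -ea'; ring.
Qed.
Fact mloc_scale1 : left_id 1 mloc_scale.
Proof.
move=> q; have [x [m ->]] := lfrac_surj q; rewrite (@mloc_scaleE 1 1 0) ?scale1r //.
by rewrite !rmorph1 mulr1.
Qed.
Fact mloc_scaleDr : right_distributive mloc_scale +%R.
Proof.
move=> b q r; have [[a n] /= ea] := mloc_scale_ex b.
have [x [y [m [-> ->]]]] := lfrac2 q r.
rewrite [_ + _]mloc_addE !(mloc_scaleE _ _ ea) [RHS]mloc_addE.
by rewrite scalerDr.
Qed.
Fact mloc_scaleDl q : {morph mloc_scale^~ q : a b / a + b}.
Proof.
move=> b c; have [x [m ->]] := lfrac_surj q; have [[a n] /= ea] := mloc_scale_ex b.
have [[a' n'] /= ea'] := mloc_scale_ex c.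
have e : b * phi f ^+ (n + n') = phi (a * f ^+ n').
  by rewrite exprD rmorphM rmorphXn -ea mulrA.
have e' : c * phi f ^+ (n + n') = phi (a' * f ^+ n).
  by rewrite addnC exprD rmorphM rmorphXn -ea' mulrA.
have e'' : (b + c) * phi f ^+ (n + n') = phi (a * f ^+ n' + a' * f ^+ n).
  by rewrite mulrDl rmorphD e e'.
by rewrite (mloc_scaleE _ _ e) (mloc_scaleE _ _ e') (mloc_scaleE _ _ e'') [RHS]mloc_addE scalerDl.
Qed.
HB.instance Definition _ :=
  GRing.Zmodule_isLmodule.Build B mloc mloc_scaleA mloc_scale1 mloc_scaleDr mloc_scaleDl.

Lemma lfrac_semilin : semilin phi (fun x : M => lfrac x 0 : mloc).
Proof.
move=> a x y; rewrite [phi a *: _](@mloc_scaleE (phi a) a 0); last by rewrite mulr1.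
by rewrite [RHS]mloc_addE.
Qed.

Variables (N : lmodType B) (g : M -> N).
Hypotheses (hg : semilin phi g) (gb : bijective (ulift g : bchg phi M -> N)).

Lemma localization_ker x : g x = 0 -> exists n, f ^+ n *: x = 0.
Proof.
move=> gx; have [h lh hE] := bchg_univ hg gb lfrac_semilin.
have : lfrac x 0 = lfrac 0 0 by rewrite -[LHS]hE gx (lin0 lh).
by move/lfracP => [k]; rewrite scaler0 addn0; exists k.
Qed.

Lemma localization_surj y : exists n x, phi f ^+ n *: y = g x.
Proof.
pose C := [set y : N | exists n x, phi f ^+ n *: y = g x].
have hC : submod C.
  split=> [|b u v [m [x ex]] [n [z ez]]].
    by exists 0%N, 0; rewrite scaler0 (semilin0 hg).
  have [[a l] /= ea] := mloc_scale_ex b.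
  exists (l + m + n)%N, ((f ^+ n * a) *: x + f ^+ (l + m) *: z).
  rewrite hg (semilinZ hg) -ex -ez scalerDr !scalerA rmorphM !rmorphXn -ea -exprD.
  by congr (_ *: _ + _); rewrite !exprD; ring.
have : mpi hC y = 0.
  apply: (bchg_uniq hg gb (h := mpi hC) (h' := fun=> 0)).
  - exact: mpi_lin.
  - by move=> a u v; rewrite scaler0 addr0.
  - by move=> x; apply/mpi_eq0; exists 0%N, x; rewrite scale1r.
by move/mpi_eq0.
Qed.

Lemma exp_uniform (T : finType) (P : T -> nat -> Prop) :
  (forall t m n, (m <= n)%N -> P t m -> P t n) -> (forall t, exists n, P t n) ->
  exists n, forall t, P t n.
Proof.
move=> mono h; have [n hn] := seq_uniform (s := enum T) mono (fun t _ => h t).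
by exists n => t; apply: hn; rewrite mem_enum.
Qed.

Hypothesis dom : forall a b : A, a * b = 0 -> a = 0 \/ b = 0.

Lemma ffree_localization : fingen M -> ffree N 1 -> exists n, ffree M (f ^+ n).
Proof.
move=> [I [v vE]] [T [psi [w [lpsi psiE]]]].
have [[n fn]|fnil] := pselect (exists n, f ^+ n = 0).
  by exists n; rewrite fn; exact: ideal0 (ffree_ideal _).
have [[fi fiE] hsur hker] := hloc.
have phi0 a : phi a = 0 -> a = 0.
  by move/hker => [n] /dom[] // fn; case: fnil; exists n.
have phiI : injective phi.
  by move=> a b ab; apply/eqP; rewrite -subr_eq0; apply/eqP/phi0; rewrite rmorphB ab subrr.
have [K /choice[w' w'E]] : exists K, forall t, exists x, phi f ^+ K *: w t = g x.
  apply: exp_uniform => [t m n mn [x ex]|t]; last exact: localization_surj.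
  by exists (f ^+ (n - m) *: x); rewrite (semilinZ hg) -ex scalerA rmorphXn -exprD subnK.
have [L hL] : exists L, forall ti : T * I, exists a, psi ti.1 (g (v ti.2)) * phi f ^+ L = phi a.
  apply: exp_uniform => [t m n mn [a ea]|t].
    by exists (a * f ^+ (n - m)); rewrite rmorphM rmorphXn -ea -mulrA -exprD subnKC.
  by have [a [n e]] := hsur (psi t.1 (g (v t.2))); exists n, a.
have /choice[lam lamE] : forall tx : T * M, exists a, psi tx.1 (g tx.2) * phi f ^+ L = phi a.
  move=> [t x] /=; have [c ->] := vE x.
  rewrite (semilin_sum _ _ hg) (lin_sum _ _ (lpsi t)) mulr_suml.
  elim: (index_enum I) => [|i s [a ea]]; first by exists 0; rewrite big_nil rmorph0.
  have [b eb] := hL (t, i); exists (c i * b + a).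
  by rewrite big_cons ea rmorphD rmorphM -eb (semilinZ hg) (linZ (lpsi t)) mulrA.
have lam_lin t : lin (fun x => lam (t, x) : A^o).
  move=> a x y; apply: phiI; rewrite -lamE /= hg (lpsi t) rmorphD rmorphM -!lamE /=.
  by rewrite mulrDl -mulrA.
pose D x := f ^+ (K + L) *: x - \sum_t lam (t, x) *: w' t.
have lD : lin D.
  move=> a x y; rewrite /D (lin_expand w' lam_lin a x y) scalerDr !scalerA mulrC -scalerA.
  by rewrite scalerBr opprD addrACA.
have gD x : g (D x) = 0.
  rewrite /D (semilinD hg) (semilinZ hg) -scaleN1r (semilinZ hg) rmorphN rmorph1 scaleN1r.
  rewrite (semilin_sum _ _ hg) rmorphXn exprD.
  rewrite -[g x in X in X - _]scale1r psiE scaler_sumr -sumrB big1 // => t _.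
  rewrite (semilinZ hg) -w'E -(lamE (t, x)) !scalerA -scalerBl /=.
  rewrite (_ : _ - _ = 0) ?scale0r //.
  by move: (psi t (g x) : B) => c; ring.
have [Q hQ] : exists Q, forall i, f ^+ Q *: D (v i) = 0.
  apply: exp_uniform => [i m n mn e|i]; last exact: localization_ker.
  by rewrite -(subnK mn) exprD -scalerA e scaler0.
have fD x : f ^+ Q *: D x = 0.
  have [c ->] := vE x; rewrite (lin_sum _ _ lD) scaler_sumr big1 // => i _.
  by rewrite (linZ lD) scalerA mulrC -scalerA hQ scaler0.
exists (Q + (K + L))%N, T, (fun t x => f ^+ Q * lam (t, x)), w'; split=> [t a x y|x].
  by rewrite lam_lin mulrDr; congr (_ + _); exact: mulrCA.
have := fD x; rewrite /D scalerBr => /eqP; rewrite subr_eq0 => /eqP.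
rewrite scalerA -exprD => ->; rewrite scaler_sumr.
by apply: eq_bigr => t _; rewrite scalerA.
Qed.

End ModuleLocalization.

(** * Affine opens of smooth schemes *)

Local Notation cresL E h := (@cres_lin _ E _ _ h).
Local Notation cfunL f U := (@cfun_lin _ _ _ f U).

Lemma exists_prime (R : comPzRingType) (I : set R) : ideal I -> ~ I 1 ->
  exists2 P, prime_ideal P & I `<=` P.
Proof.
move=> hI I1; pose T := {J : set R | [/\ ideal J, I `<=` J & ~ J 1]}.
pose t0 : T := exist _ I (And3 hI (@subset_refl _ I) I1).
pose le (s t : T) := `[< sval s `<=` sval t >].
have [t|r s t /asboolP h /asboolP h'|A Atot|[P [hP IP P1]] Pmax] := @ZL_preorder T t0 le.
- exact/asboolP.
- by apply/asboolP; exact: subset_trans h h'.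
- have [[s As]|A0] := pselect (exists s, A s); last by exists t0 => s As; case: A0; exists s.
  pose U : set R := [set a | exists2 t : T, A t & sval t a].
  have hU : [/\ ideal U, I `<=` U & ~ U 1].
    have [s1 s2 _] := svalP s.
    split=> [|a Ia|[t _]]; [|by exists s => //; exact: s2|by case: (svalP t)].
    split=> [|a b [t At ta] [u Au ub]|a b [t At tb]]; first by exists s => //; exact: ideal0.
      have [t1 _ _] := svalP t; have [u1 _ _] := svalP u.
      by have [/asboolP h|/asboolP h] := Atot t u At Au; [exists u|exists t] => //;
        apply: idealD => //; exact: h.
    by have [t1 _ _] := svalP t; exists t => //; exact: idealM.
  by exists (exist _ U hU) => t At; apply/asboolP => a ta; exists t.
have addP a : ~ P a -> add_gen a P 1.
  move=> Pa; apply: contrapT => h.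
  have hL : [/\ ideal (add_gen a P), I `<=` add_gen a P & ~ add_gen a P 1].
    by split=> //; [exact: add_gen_ideal|exact: subset_trans IP (@sub_add_gen _ _ _)].
  have /asboolP hle := Pmax (exist _ (add_gen a P) hL) (asboolT (@sub_add_gen _ a P)).
  by apply/Pa/hle; exact: mem_add_gen.
exists P => //; split=> //; [exact: ideal0|exact: idealD hP|exact: idealM hP|].
move=> a b ab; apply: contrapT => /not_orP[/addP[m Pm [c e]] /addP[n Pn [d e']]].
apply: (P1); rewrite -[1]mulr1 {1}e e'.
have -> : (m + c * a) * (n + d * b) = (n + d * b) * m + c * a * n + c * d * (a * b) by ring.
by apply: (idealD hP); [apply: (idealD hP)|]; exact: (idealM hP).
Qed.

Section RingedSpaces.
Variable X : ringed_space.
Implicit Types U V W : opens X.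

Lemma inv_at_in U (f : rO U) x : inv_at f x -> U x.
Proof. by move=> [V [h [Vx _]]]; exact: h. Qed.

Definition interO U V : opens X := Opens (openI (osetP U) (osetP V)).

Lemma interO_l U V : interO U V `<=` U. Proof. by move=> x []. Qed.
Lemma interO_r U V : interO U V `<=` V. Proof. by move=> x []. Qed.

Lemma inv_at_open U (f : rO U) : open [set x | inv_at f x].
Proof.
have -> : [set x | inv_at f x] =
    \bigcup_(V in [set V : opens X | exists h : V `<=` U, exists g, rres h f * g = 1]) (V : set X).
  apply/seteqP; split=> x /=; first by move=> [V [h [Vx hg]]]; exists V => //; exists h.
  by move=> [V [h hg] Vx]; exists V, h.
by apply: bigcup_open => V _; exact: osetP.
Qed.

Definition principal U (f : rO U) : opens X := Opens (inv_at_open f).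

Lemma principal_sub U (f : rO U) : principal f `<=` U.
Proof. by move=> x; exact: inv_at_in. Qed.

Lemma principalE U (f : rO U) : (principal f : set X) = U `&` [set y | inv_at f y].
Proof. by apply/seteqP; split=> x /=; [move=> h; split=> //; exact: inv_at_in h|case]. Qed.

Lemma inv_at_res U V (h : V `<=` U) (f : rO U) x : V x ->
  inv_at (rres h f) x <-> inv_at f x.
Proof.
move=> Vx; split=> -[W [hW [Wx [g hg]]]].
  exists W, (subset_trans hW h); split=> //; exists g.
  by rewrite -(rres_comp h hW).
exists (interO W V), (@interO_r W V); split=> //; exists (rres (@interO_l W V) g).
rewrite (rres_comp _ _ (subset_trans (@interO_r W V) h)).
rewrite -(rres_comp hW (@interO_l W V)) -rmorphM hg rmorph1 //.
Qed.

Lemma inv_atM U (f g : rO U) x : inv_at (f * g) x <-> inv_at f x /\ inv_at g x.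
Proof.
split=> [[W [hW [Wx [u hu]]]]|[[W [hW [Wx [u hu]]]] [W' [hW' [Wx' [u' hu']]]]]].
  by split; exists W, hW; split=> //; [exists (rres hW g * u)|exists (rres hW f * u)];
    rewrite -hu rmorphM; ring.
have h := subset_trans (@interO_l W W') hW.
exists (interO W W'), h; split=> //.
exists (rres (@interO_l W W') u * rres (@interO_r W W') u').
rewrite rmorphM mulrACA -(rres_comp hW (@interO_l W W') h).
rewrite -[rres h g](rres_comp hW' (@interO_r W W') h) -!rmorphM hu hu'.
by rewrite !rmorph1 mulr1.
Qed.

Lemma inv_at_unit U (f g : rO U) x : U x -> f * g = 1 -> inv_at f x.
Proof. by move=> Ux fg; exists U, (@subset_refl _ _); split=> //; exists g; rewrite rres_id. Qed.

Lemma inv_at1 U x : U x -> inv_at (1 : rO U) x.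
Proof. by move=> Ux; apply: (@inv_at_unit _ _ 1) => //; rewrite mulr1. Qed.

Lemma inv_atX U (f : rO U) n x : inv_at f x -> inv_at (f ^+ n) x.
Proof.
move=> fx; elim: n => [|n ih]; first exact: inv_at1 (inv_at_in fx).
by rewrite exprS; apply/inv_atM.
Qed.

Lemma rres_irr U V (h h' : V `<=` U) f : rres h f = rres h' f.
Proof. by rewrite (Prop_irrelevance h h'). Qed.

Lemma principal_affine U V (f : rO U) : is_affine U -> V `<=` U ->
  (V : set X) = U `&` [set y | inv_at f y] -> is_affine V.
Proof.
move=> aU hV VE; have [h1 h2 h3] := aU.
have [[fi fiE] fsur fker] := h3 f V hV VE.
have finv n : rres hV f ^+ n * fi ^+ n = 1 by rewrite -exprMn fiE expr1n.
have resV a x : V x -> inv_at (rres hV a) x <-> inv_at a x by exact: inv_at_res.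
split.
- move=> I [I0 ID IM I1 Ip].
  have Iu n a : I (a * rres hV f ^+ n) -> I a.
    by move=> h; rewrite -[a]mulr1 -(finv n) mulrA mulrC; exact: IM.
  have [|x [[Ux xE] xu]] := h1 [set a | I (rres hV a)].
    split; rewrite /= ?rmorph0 ?rmorph1 // => a b; rewrite ?rmorphD ?rmorphM //.
    - exact: ID.
    - exact: IM.
    - exact: Ip.
  have fx : inv_at f x.
    apply: contrapT => h; have : [set f | ~ inv_at f x] f by [].
    by rewrite -xE /= => If; apply: I1; apply: (Iu 1%N); rewrite mul1r.
  have Vx : V x by rewrite -[V x]/((V : set X) x) VE.
  have IE (y : X) : V y -> (forall a, I (rres hV a) <-> ~ inv_at a y) ->
      forall s, I s <-> ~ inv_at s y.
    move=> Vy aE s; have [a [n sE]] := fsur s.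
    have fy : inv_at f y by have : (V : set X) y by []; rewrite VE => -[].
    have sy : inv_at s y <-> inv_at a y.
      rewrite -(resV _ _ Vy) -sE; split=> [h|/inv_atM[]//].
      by apply/inv_atM; split=> //; apply: inv_atX; apply/resV.
    rewrite sy -aE -sE; split=> [Is|]; last exact: Iu.
    by rewrite mulrC; exact: IM.
  exists x; split.
    split=> //; apply/seteqP.
    have h s : I s <-> ~ inv_at s x.
      apply: IE => // a; have := congr1 (fun S : set _ => S a) xE.
      by move=> /= ->.
    by split=> s /h.
  move=> y [Vy yE]; apply: xu; split; first exact: (hV y Vy).
  apply/seteqP; split=> a /=; rewrite yE /= resV //.
- move=> V' x V'V V'x; have [g [gx gV]] := h2 V' x (subset_trans V'V hV) V'x.
  exists (rres hV g); split; first by apply/resV => //; exact: V'V.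
  by move=> y [Vy /= /resV gy]; apply: gV; split; [exact: (hV)|exact: gy].
- move=> g W hW WE; have [a [n gE]] := fsur g.
  have Vf y : V y -> inv_at f y by move=> Vy; have : (V : set X) y by []; rewrite VE => -[].
  have WE' : (W : set X) = U `&` [set y | inv_at (f * a) y].
    have ga y : V y -> inv_at g y <-> inv_at a y.
      move=> Vy; rewrite -(resV _ _ Vy) -gE; split=> [h|/inv_atM[]//].
      by apply/inv_atM; split=> //; apply: inv_atX; apply/resV => //; exact: Vf.
    rewrite WE; apply/seteqP; split=> y /= [Vy hy].
      by split; [exact: (hV)|apply/inv_atM; split; [exact: Vf|exact/ga]].
    move/inv_atM: hy => [fy ay]; have Vy' : V y by rewrite -[V y]/((V : set X) y) VE.
    by split=> //; exact/ga.
  have hWU := subset_trans hW hV.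
  have rE b : rres hWU b = rres hW (rres hV b) by rewrite (rres_comp _ _ hWU).
  have [[u uE] usur uker] := h3 (f * a) W hWU WE'.
  split.
  + exists (rres hW (rres hV f) ^+ n.+1 * u).
    by rewrite -[RHS]uE rE !rmorphM -gE rmorphM rmorphXn; rewrite exprS; ring.
  + move=> s; have [b [m sE]] := usur s.
    exists (rres hV b * fi ^+ (m + n * m)), m.
    rewrite rmorphM -rE -sE rE !rmorphM -gE rmorphM rmorphXn exprMn.
    set F := rres hW (rres hV f); have -> : rres hW (fi ^+ (m + n * m)) = rres hW fi ^+ (m + n * m) by rewrite rmorphXn.
    have FF : F ^+ (m + n * m) * rres hW fi ^+ (m + n * m) = 1.
      by rewrite -exprMn -rmorphM fiE rmorph1 expr1n.
    rewrite -[LHS]mulr1 -FF exprMn exprD -exprM; ring.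
  + move=> s s0; have [b [m sE]] := fsur s.
    have [|l hl] := uker b; first by rewrite rE -sE rmorphM s0 mul0r.
    exists l; have := congr1 (rres hV) hl.
    rewrite rmorph0 rmorphM rmorphXn rmorphM -gE -sE => e.
    have := congr1 (fun z => z * (fi ^+ (l + n * l + m))) e; rewrite mul0r => <-.
    rewrite -[LHS]mulr1 -(finv (l + n * l + m)%N) !exprMn !exprD -!exprM; ring.
Qed.

Lemma empty_ring U : (forall x, ~ U x) -> forall f g : rO U, f = g.
Proof.
move=> U0 f g; apply: (@rsep X void U (fun=> U) (fun=> @subset_refl _ _)); last by case.
by move=> x /U0.
Qed.

Lemma nowhere_inv_nilpotent U (f : rO U) : is_affine U -> (forall x, ~ inv_at f x) ->
  exists n, f ^+ n = 0.
Proof.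
move=> [_ _ h3] f0; have [_ _ hk] := h3 f (principal f) (@principal_sub _ f) (principalE f).
have [|n] := hk 1; first by apply: empty_ring => x; exact: f0.
by rewrite mulr1; exists n.
Qed.

Lemma rres_local U (f : rO U) :
  (forall x, U x -> exists W, W x /\ exists h : W `<=` U, rres h f = 0) -> f = 0.
Proof.
move=> hf; have /choice[W WP] : forall x : {x | U x}, exists W,
    W (sval x) /\ exists h : W `<=` U, rres h f = 0 by move=> [x Ux]; exact: hf.
have hW x : W x `<=` U by have [_ []] := WP x.
apply: (@rsep X _ U W hW) => [x Ux|x]; first by exists (exist _ x Ux) => //; exact: (WP _).1.
by have [_ [h e]] := WP x; rewrite rmorph0 (rres_irr (hW x) h).
Qed.

End RingedSpaces.

Section SmoothSchemes.
Variables (p : nat) (k : fieldType).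
Hypothesis charkp : p \in [pchar k].
Hypothesis kperf : forall a : k, exists b, b ^+ p = a.
Variable X : kscheme k.
Hypotheses (Xsm : smooth X) (Xirr : geom_irreducible X).

Let pp : prime p := pcharf_prime charkp.

Lemma irreducible_of_geom : irreducible_space X.
Proof.
have @pr : smor X X.
  apply: (@SMor X X id _ (fun U V h => rres h)).
  - by move=> x.
  - by move=> U U' V V' h h' hU hV f; rewrite !(rres_comp _ _ (subset_trans hV h)).
  - move=> U V h f y Vy [W [hW [Wy [g hg]]]].
    by exists W, (subset_trans hW h); split=> //; exists g; rewrite -(rres_comp h hW).
apply: (Xirr (phi := idfun) (pr := pr)); split=> [U V h a|Z g hg].
  exact: rres_comp.
exists g; split.
- exact: hg.
- split=> // U V W hU hV hW f /=.
  by rewrite -(scom_res hW hV hU (@subset_refl _ W)) rres_id.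
- move=> h' _ [h1 h2]; split=> [z|U V hU hV f]; first exact: h1.
  by rewrite (h2 U U V (@subset_refl _ _) hV hU f) /= rres_id.
Qed.

Lemma smooth_cover x : exists U : aff X, [/\ U x, noeth (rO U) & pbasis p (rO U)].
Proof.
have [U [aU Ux ft sm]] := Xsm x; exists (Aff aU).
have [] := @smooth_noeth_pbasis p k (rO U)
  (rres (@subsetT _ (U : set X) : U `<=` opensT X) \o kstr X : {rmorphism k -> rO U}) charkp kperf.
- exact: ft.
- exact: sm.
by split.
Qed.

Lemma affine_nbhs (U : aff X) (V : opens X) x : U x -> V x ->
  exists (f : rO U) (W : aff X) (h : (W : set X) `<=` U),
    [/\ W x, (W : set X) `<=` V & (W : set X) = (U : set X) `&` [set y | inv_at f y]].
Proof.
move=> Ux Vx; have [_ h2 _] := affP U.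
have [//|f [fx fV]] := h2 (interO U V) x (@interO_l _ U V).
exists f; pose W : aff X := Aff (principal_affine (affP U) (@principal_sub _ _ f) (principalE f)).
exists W, (@principal_sub _ _ f); split=> //; last exact: principalE.
by move=> y fy; have [] := fV y (conj (inv_at_in fy) fy).
Qed.

Lemma section_reduced (V : opens X) (f : rO V) n : f ^+ n = 0 -> f = 0.
Proof.
have red (g : rO V) : g ^+ p = 0 -> g = 0.
  move=> g0; apply: rres_local => x Vx; have [U [Ux _ Up]] := smooth_cover x.
  have [d [W [h [Wx WV WE]]]] := affine_nbhs Ux Vx.
  exists W; split=> //; exists WV.
  have [_ _ h3] := affP U; have [[di diE] dsur dker] := h3 d W h WE.
  have dinv n' : rres h d ^+ n' * di ^+ n' = 1 by rewrite -exprMn diE expr1n.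
  have [a [m sE]] := dsur (rres WV g).
  have [|N hN] := dker (a ^+ p).
    by rewrite rmorphXn -sE exprMn -(rmorphXn (rres WV)) g0 rmorph0 mul0r.
  have da : d ^+ N * a = 0.
    apply: (pbasis_reduced pp Up); rewrite exprMn -exprM.
    rewrite -[X in (N * X)%N](prednK (prime_gt0 pp)) mulnS addnC exprD.
    by rewrite -mulrA hN mulr0.
  have e : rres h d ^+ N * (rres WV g * rres h d ^+ m) = 0.
    by rewrite sE -rmorphXn -rmorphM da rmorph0.
  rewrite -[LHS]mulr1 -(dinv (m + N)%N) -[RHS](mul0r (di ^+ (m + N))) -e exprD.
  by ring.
have redn m (g : rO V) : g ^+ (p ^ m) = 0 -> g = 0.
  by elim: m => [|m ih]; rewrite ?expr1 // expnSr exprM => /red.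
move=> fn; apply: (redn n); rewrite -(subnK (ltnW (ltn_expl n (prime_gt1 pp)))).
by rewrite exprD fn mulr0.
Qed.

Lemma affine_domain (V : aff X) (f g : rO V) : f * g = 0 -> f = 0 \/ g = 0.
Proof.
move=> fg; have nil (h : rO V) : (forall x, ~ inv_at h x) -> h = 0.
  by move=> /(nowhere_inv_nilpotent (affP V))[n]; exact: section_reduced.
have [/nil|/existsNP[x fx]] := pselect (forall x, ~ inv_at f x); first by left.
have [/nil|/existsNP[y gy]] := pselect (forall x, ~ inv_at g x); first by right.
have [_ hirr] := irreducible_of_geom.
have [||z [fz gz]] := hirr (principal f) (principal g).
- by exists x; exact: contrapT.
- by exists y; exact: contrapT.
have : inv_at (f * g) z by apply/inv_atM.
rewrite fg => z0; have [h _] := @scheme_local X z V (inv_at_in z0).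
by case: h.
Qed.

Lemma coh_ffree1_local (E : coh X) :
  (forall x, exists U : aff X, U x /\ ffree (E U) 1) -> forall V : aff X, ffree (E V) 1.
Proof.
move=> hE V; apply: contrapT => /(exists_prime (ffree_ideal _))[P Pp PE].
have [h1 _ h3] := affP V; have [x [[Vx xE] _]] := h1 P Pp.
have [U [Ux EU]] := hE x; have [f [W [h [Wx WU WE]]]] := affine_nbhs Vx Ux.
have EW : ffree (E W) 1.
  by rewrite -(rmorph1 (rres WU)); apply: ffree_bchg EU; [exact: cres_lin|exact: cqc].
have [n fn] := ffree_localization (h3 f W h WE) (cresL E h) (cqc E h)
  (@affine_domain V) (cfg E V) EW.
have Pf : P f.
  have := PE _ fn; have [P0 PD PM P1 Pprime] := Pp.
  by elim: n {fn} => [|n ih]; [rewrite expr0 => /P1|rewrite exprS => /Pprime[//|/ih]].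
rewrite xE in Pf; apply: Pf; have : (W : set X) x by [].
by rewrite WE => -[].
Qed.

Lemma fpulln_ffree1 n (E : coh X) (U : aff X) : pbasis p (rO U) ->
  ffree (fpulln charkp n E U) 1 <-> ffree (E U) 1.
Proof.
move=> Up; elim: n => [|n ih] //=; rewrite -ih; split.
- exact: (@ffree1_frob_inv p _ (frob charkp U) pp (fun=> erefl)).
- by move/(@ffree_frob p _ (frob charkp U) (fun=> erefl)); rewrite expr1n.
Qed.

Lemma strat_ffree1 t (E : nat -> coh X) (sigma : @stratification p k charkp X t E) i (V : aff X) :
  ffree (E i V) 1.
Proof.
apply: coh_ffree1_local => x; have [U [Ux Un Up]] := smooth_cover x.
exists U; split=> //.
have ES j : ffree (E j.+1 U) 1.
  apply: (@ffree1_descent p _ (frob charkp U) pp (fun=> erefl) (charO charkp U)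
    (fun n => E (n + j).+1 U)) => //; [exact: affine_domain|exact: cfg|].
  move=> n; exists (sig sigma (n + j) U), (cinv (sig_iso sigma (n + j)) U).
  split; [exact: (cfunL (sig sigma (n + j)) U)|exact: (cfunL (cinv (sig_iso sigma (n + j))) U)|exact: cinvVK|exact: (cinvK (sig_iso sigma (n + j)))].
case: i => [|i] //; apply/(fpulln_ffree1 t _ Up).
have := ES 0%N; move/(fpulln_ffree1 t.+1 _ Up).
apply: (@ffree_retract _ _ _ (cinv (sig0_iso sigma) U) (sig0 sigma U)).
- exact: (cfunL (cinv (sig0_iso sigma)) U).
- exact: (cfunL (sig0 sigma) U).
- exact: cinvVK.
Qed.

End SmoothSchemes.

(** * Kernels, cokernels and direct sums of coherent sheaves *)

Section SubModule.
Variables (R : comPzRingType) (M : lmodType R) (S : set M).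

Record subm := MSub { mval : M; mvalP : S mval }.
Hypothesis hS : submod S.
Definition msub (h : submod S) : Type := subm.

Local Notation H := (msub hS).

Lemma mval_inj (x y : H) : mval x = mval y -> x = y.
Proof.
case: x y => [x xP] [y yP] /= e; move: e xP yP => -> xP yP.
by congr MSub; exact: Prop_irrelevance.
Qed.

HB.instance Definition _ := gen_eqMixin H.
HB.instance Definition _ := gen_choiceMixin H.

Fact msubD x y : S x -> S y -> S (x + y).
Proof. by move=> Sx Sy; rewrite -[x]scale1r; exact: hS.2. Qed.
Fact msubZ a x : S x -> S (a *: x).
Proof. by move=> Sx; rewrite -[_ *: _]addr0; apply: hS.2 => //; exact: hS.1. Qed.

Definition madd (x y : H) : H := MSub (msubD (mvalP x) (mvalP y)).
Definition mscale a (x : H) : H := MSub (msubZ a (mvalP x)).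
Definition mzero : H := MSub hS.1.

Fact maddA : associative madd.
Proof. by move=> x y z; apply: mval_inj; exact: addrA. Qed.
Fact maddC : commutative madd.
Proof. by move=> x y; apply: mval_inj; exact: addrC. Qed.
Fact madd0 : left_id mzero madd.
Proof. by move=> x; apply: mval_inj; exact: add0r. Qed.
Fact maddN : left_inverse mzero (mscale (-1)) madd.
Proof. by move=> x; apply: mval_inj; rewrite /= scaleN1r addNr. Qed.
HB.instance Definition _ := GRing.isZmodule.Build H maddA maddC madd0 maddN.
Fact mscaleA a b x : mscale a (mscale b x) = mscale (a * b) x.
Proof. by apply: mval_inj; exact: scalerA. Qed.
Fact mscale1 : left_id 1 mscale.
Proof. by move=> x; apply: mval_inj; exact: scale1r. Qed.
Fact mscaleDr : right_distributive mscale +%R.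
Proof. by move=> a x y; apply: mval_inj; exact: scalerDr. Qed.
Fact mscaleDl x : {morph mscale^~ x : a b / a + b}.
Proof. by move=> a b; apply: mval_inj; exact: scalerDl. Qed.
HB.instance Definition _ :=
  GRing.Zmodule_isLmodule.Build R H mscaleA mscale1 mscaleDr mscaleDl.

End SubModule.

Lemma semilinB (R S : comPzRingType) (phi : {rmorphism R -> S}) (M : lmodType R)
    (N : lmodType S) (g : M -> N) : semilin phi g -> {morph g : x y / x - y}.
Proof.
move=> hg x y; rewrite (semilinD hg); congr (_ + _).
by rewrite -scaleN1r (semilinZ hg) rmorphN rmorph1 scaleN1r.
Qed.

Lemma inj_surj_bij (A B : Type) (f : A -> B) : injective f ->
  (forall y, exists x, f x = y) -> bijective f.
Proof.
move=> fi /choice[g gK]; exists g => // x.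
by apply: fi; rewrite gK.
Qed.

Section CoherentLimits.
Variable X : scheme.
Implicit Types C D E K Q : coh X.

Definition cepi E Q (q : cmor E Q) := forall U y, exists x, q U x = y.

Definition rexact D E Q (f : cmor D E) (q : cmor E Q) :=
  cepi q /\ forall U y, q U y = 0 <-> exists x, f U x = y.

(* [j] is a kernel of [f] and, over each affine open, the image of [f] is a direct
   summand. *)
Definition splitker K D E (j : cmor K D) (f : cmor D E) :=
  (forall U y, f U (j U y) = 0) /\
  forall U, exists (e : D U -> K U) (t : E U -> D U),
    [/\ lin e, lin t, forall y, e (j U y) = y & forall x, x = j U (e x) + t (f U x)].

Definition cinjective K D (j : cmor K D) := forall U, injective (j U).

Lemma cmor_ext_inj C K D (j : cmor K D) (g h : cmor C K) :
  cinjective j -> ccomp j g = ccomp j h -> g = h.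
Proof.
move=> ji e; apply: cmor_ext => U s; apply: ji.
exact: (congr1 (fun f : cmor C D => f U s) e).
Qed.

Lemma cmor_ext_epi C E Q (q : cmor E Q) (g h : cmor Q C) :
  cepi q -> ccomp g q = ccomp h q -> g = h.
Proof.
move=> qe e; apply: cmor_ext => U s; have [x <-] := qe U s.
exact: (congr1 (fun f : cmor E C => f U x) e).
Qed.

Lemma clift C K D (j : cmor K D) (g : cmor C D) : cinjective j ->
  (forall U s, exists y, j U y = g U s) -> exists h : cmor C K, ccomp j h = g.
Proof.
move=> ji /= hj; have /(_ _)/choice hj' : forall U, forall s, exists y, j U y = g U s by [].
pose h U := sval (cid2 (ex_intro2 _ (fun=> True) (projT1 (hj' U)) (projT2 (hj' U)) I)).
have hE U s : j U (h U s) = g U s by rewrite /h; case: cid2.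
have hl U : lin (h U).
  by move=> a x y; apply: ji; rewrite (cfun_lin j) !hE (cfun_lin g).
have hr (U V : aff X) (hUV : (V : set X) `<=` U) s : h V (cres hUV s) = cres hUV (h U s).
  by apply: ji; rewrite hE !cfun_res hE.
exists (CMor hl hr); exact: cmor_ext.
Qed.

Lemma cdesc C E Q (q : cmor E Q) (g : cmor E C) : cepi q ->
  (forall U x, q U x = 0 -> g U x = 0) -> exists h : cmor Q C, ccomp h q = g.
Proof.
move=> qe qg; have /(_ _)/choice qe' : forall U, forall y, exists x, q U x = y by exact: qe.
pose r U := projT1 (qe' U); have rK U y : q U (r U y) = y by exact: (projT2 (qe' U)).
have qgE U x y : q U x = q U y -> g U x = g U y.
  move=> e; apply/eqP; rewrite -subr_eq0 -(linB (cfunL g U)).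
  by apply/eqP/qg; rewrite (linB (cfunL q U)) e subrr.
pose h U y := g U (r U y).
have hE U x : h U (q U x) = g U x by apply: qgE; rewrite rK.
have hl U : lin (h U).
  move=> a x y; rewrite /h -(cfun_lin g); apply: qgE.
  by rewrite (cfun_lin q) !rK.
have hr (U V : aff X) (hUV : (V : set X) `<=` U) s : h V (cres hUV s) = cres hUV (h U s).
  by rewrite /h -cfun_res; apply: qgE; rewrite rK cfun_res rK.
by exists (CMor hl hr); apply: cmor_ext => U x; exact: hE.
Qed.

Lemma splitker_inj K D E (j : cmor K D) (f : cmor D E) : splitker j f -> cinjective j.
Proof.
move=> [_ h] U; have [e [t [_ _ eK _]]] := h U.
exact: can_inj eK.
Qed.

Lemma splitker_im K D E (j : cmor K D) (f : cmor D E) : splitker j f ->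
  forall U x, f U x = 0 -> exists y, j U y = x.
Proof.
move=> [_ h] U x fx; have [e [t [_ lt _ eE]]] := h U; exists (e x).
by rewrite [RHS]eE fx (lin0 lt) addr0.
Qed.

Lemma iso_lift K D E K' D' E' (j : cmor K D) (f : cmor D E) (j' : cmor K' D')
    (f' : cmor D' E') (alpha : cmor D D') (beta : cmor E E') :
  splitker j f -> splitker j' f' -> ciso alpha -> ciso beta ->
  ccomp f' alpha = ccomp beta f ->
  exists2 kappa : cmor K K', ciso kappa & ccomp j' kappa = ccomp alpha j.
Proof.
move=> jf jf' ia ib fa.
have faE U x : f' U (alpha U x) = beta U (f U x).
  exact: (congr1 (fun g : cmor D E' => g U x) fa).
have ji := splitker_inj jf; have ji' := splitker_inj jf'.
have [|kappa kE] := clift (j := j') (g := ccomp alpha j) ji'.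
  move=> U y; apply: (splitker_im jf') => /=.
  by rewrite faE jf.1 (lin0 (cfunL beta U)).
exists kappa => //.
have kEU U y : j' U (kappa U y) = alpha U (j U y).
  exact: (congr1 (fun g : cmor K D' => g U y) kE).
move=> U; apply: inj_surj_bij => [x y e|z].
  by apply: ji; apply: (bij_inj (ia U)); rewrite -!kEU e.
have [x ax] : exists x, alpha U x = j' U z.
  by exists (cinv ia U (j' U z)); exact: cinvK.
have [|y yx] := splitker_im jf (x := x).
  by apply: (bij_inj (ib U)); rewrite -faE ax jf'.1 (lin0 (cfunL beta U)).
by exists y; apply: ji'; rewrite kEU yx.
Qed.

Lemma iso_desc D E Q D' E' Q' (f : cmor D E) (q : cmor E Q) (f' : cmor D' E')
    (q' : cmor E' Q') (beta : cmor D D') (alpha : cmor E E') :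
  rexact f q -> rexact f' q' -> ciso beta -> ciso alpha ->
  ccomp alpha f = ccomp f' beta ->
  exists2 gamma : cmor Q Q', ciso gamma & ccomp q' alpha = ccomp gamma q.
Proof.
move=> [qe qf] [qe' qf'] ib ia af.
have afE U x : alpha U (f U x) = f' U (beta U x).
  exact: (congr1 (fun g : cmor D E' => g U x) af).
have [|gamma gE] := cdesc (q := q) (g := ccomp q' alpha) qe.
  by move=> U _ /qf[x <-] /=; apply/qf'; exists (beta U x).
exists gamma => //.
have gEU U x : gamma U (q U x) = q' U (alpha U x).
  exact: (congr1 (fun g : cmor E Q' => g U x) gE).
have g0 U z : gamma U z = 0 -> z = 0.
  have [x <-] := qe U z; rewrite gEU => /qf'[y ey]; apply/qf.
  exists (cinv ib U y); apply: (bij_inj (ia U)).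
  by rewrite afE cinvK.
move=> U; apply: inj_surj_bij => [x y e|z].
  apply/eqP; rewrite -subr_eq0; apply/eqP/g0.
  by rewrite (linB (cfunL gamma U)) e subrr.
have [y <-] := qe' U z; exists (q U (cinv ia U y)).
by rewrite gEU cinvK.
Qed.

Section Cokernel.
Variables (D E : coh X) (f : cmor D E).

Lemma image_submod U : submod [set y | exists x, f U x = y].
Proof.
split=> [|a _ _ [x <-] [y <-]]; first by exists 0; exact: lin0 (cfunL f U).
by exists (a *: x + y); rewrite (cfun_lin f).
Qed.

Definition cksec (U : aff X) : lmodType (rO U) := mquot (@image_submod U).

Definition ckpi (U : aff X) : E U -> cksec U := mpi (@image_submod U).

Lemma ckpi_lin U : lin (@ckpi U). Proof. exact: mpi_lin. Qed.

Definition ckres (U V : aff X) (h : (V : set X) `<=` U) (q : cksec U) : cksec V :=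
  ckpi (cres h (zrep q)).

Lemma ckpi_eq (U : aff X) x y : ckpi x = ckpi y <-> exists z, f U z = x - y.
Proof. exact: zpiP. Qed.

Lemma ckres_pi (U V : aff X) (h : (V : set X) `<=` U) x :
  ckres h (ckpi x) = ckpi (cres h x).
Proof.
have [z zE] := zpi_zrep (submod_zsub (@image_submod U)) x.
apply/ckpi_eq; exists (cres h z); rewrite cfun_res zE.
exact: semilinB (cresL E h) _ _.
Qed.

Lemma ckres_lin (U V : aff X) (h : (V : set X) `<=` U) : semilin (rres h) (ckres h).
Proof.
move=> a q r; have [x <-] := mpi_surj q; have [y <-] := mpi_surj r.
by rewrite -(@ckpi_lin U) !ckres_pi (cresL E h) (@ckpi_lin V).
Qed.

Lemma ckres_id (U : aff X) (h : (U : set X) `<=` U) s : ckres h s = s.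
Proof. by have [x <-] := mpi_surj s; rewrite ckres_pi cres_id. Qed.

Lemma ckres_comp (U V W : aff X) (h : (V : set X) `<=` U)
  (h' : (W : set X) `<=` V) (h'' : (W : set X) `<=` U) s :
  ckres h' (ckres h s) = ckres h'' s.
Proof. by have [x <-] := mpi_surj s; rewrite (ckres_pi h) !ckres_pi (cres_comp h h' h''). Qed.

Lemma ckqc (U V : aff X) (h : (V : set X) `<=` U) :
  bijective (ulift (ckres h) : bchg (rres h) (cksec U) -> cksec V).
Proof.
have Eu := bchg_univ (cresL E h) (cqc E h).
have Eq := bchg_uniq (cresL E h) (cqc E h).
have Dq := bchg_uniq (cresL D h) (cqc D h).
apply: bchg_bij (ckres_lin h) _ _ => [P g lg|P g g' lg lg' gE y].
- have [|g1 lg1 g1E] := Eu P (fun x => g (ckpi x)).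
    by move=> a x y; rewrite (@ckpi_lin U) lg.
  have g1f : forall x, g1 (f V x) = 0.
    apply: (Dq P (fun x => g1 (f V x)) (fun=> 0)) => [a x y|a x y|x].
    - by rewrite (cfun_lin f) lg1.
    - by rewrite scaler0 addr0.
    rewrite cfun_res g1E; have -> : ckpi (f U x) = 0 by apply/mpi_eq0; exists x.
    exact: semilin0 lg.
  have g1E' x : g1 (zrep (ckpi x)) = g1 x.
    apply/eqP; rewrite -subr_eq0 -(linB lg1).
    by have [z <-] := zpi_zrep (submod_zsub (@image_submod V)) x; rewrite g1f.
  exists (fun q : cksec V => g1 (zrep q)) => [a q r|q].
    have [x <-] := mpi_surj q; have [y <-] := mpi_surj r.
    by rewrite -(@ckpi_lin V) !g1E' lg1.
  by have [x <-] := mpi_surj q; rewrite ckres_pi g1E' g1E.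
- have [x <-] := mpi_surj y.
  apply: (Eq P (fun x => g (ckpi x)) (fun x => g' (ckpi x))) => [a u v|a u v|u].
  + by rewrite (@ckpi_lin V) lg.
  + by rewrite (@ckpi_lin V) lg'.
  by rewrite -ckres_pi gE.
Qed.

Lemma ckfg (U : aff X) : fingen (cksec U).
Proof.
have [I [v vE]] := cfg E U; exists I, (fun i => ckpi (v i)) => y.
have [x <-] : exists x, ckpi x = y by exact: mpi_surj.
have [c cE] := vE x; exists c; rewrite {1}cE (lin_sum _ _ (@ckpi_lin U)); apply: eq_bigr => i _.
exact: (linZ (@ckpi_lin U)).
Qed.

Definition ccoker : coh X := Coh ckres_lin ckres_id ckres_comp ckqc ckfg.

Definition ccoker_pi : cmor E ccoker :=
  @CMor _ E ccoker ckpi ckpi_lin (fun U V h s => esym (ckres_pi h s)).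

Lemma ccoker_rexact : rexact f ccoker_pi.
Proof. by split=> [U y|U y]; [exact: mpi_surj|exact: mpi_eq0]. Qed.

End Cokernel.

Section Kernel.
Variables (D E : coh X) (f : cmor D E).
Hypothesis freg : forall U, exists t : E U -> D U, lin t /\ forall x, f U (t (f U x)) = f U x.

Lemma ker_submod U : submod [set x | f U x = 0].
Proof.
split=> [|a x y]; rewrite /= ?(lin0 (cfunL f U)) // (cfun_lin f) => -> ->.
by rewrite scaler0 addr0.
Qed.

Definition kesec (U : aff X) : lmodType (rO U) := msub (@ker_submod U).

Definition keval (U : aff X) (y : kesec U) : D U := mval y.

Lemma keval_inj U : injective (@keval U). Proof. by move=> x y; exact: mval_inj. Qed.

Lemma keval_lin U : lin (@keval U). Proof. by []. Qed.

Lemma kevalP U (y : kesec U) : f U (keval y) = 0. Proof. exact: mvalP y. Qed.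

Lemma keres_subproof (U V : aff X) (h : (V : set X) `<=` U) (y : kesec U) :
  f V (cres h (keval y)) = 0.
Proof. by rewrite cfun_res kevalP (semilin0 (cresL E h)). Qed.

Definition keres (U V : aff X) (h : (V : set X) `<=` U) (y : kesec U) : kesec V :=
  MSub (keres_subproof h y).

Lemma keres_lin (U V : aff X) (h : (V : set X) `<=` U) : semilin (rres h) (keres h).
Proof. by move=> a x y; apply: keval_inj; exact: cres_lin. Qed.

Lemma keres_id (U : aff X) (h : (U : set X) `<=` U) s : keres h s = s.
Proof. by apply: keval_inj; exact: cres_id. Qed.

Lemma keres_comp (U V W : aff X) (h : (V : set X) `<=` U)
  (h' : (W : set X) `<=` V) (h'' : (W : set X) `<=` U) s :
  keres h' (keres h s) = keres h'' s.
Proof. by apply: keval_inj; exact: cres_comp. Qed.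

Lemma kesplit U : exists (e : D U -> kesec U) (t : E U -> D U),
  [/\ lin e, lin t, forall y, e (keval y) = y & forall x, x = keval (e x) + t (f U x)].
Proof.
have [t [lt tE]] := freg U.
have eP x : f U (x - t (f U x)) = 0 by rewrite (linB (cfunL f U)) tE subrr.
exists (fun x => (@MSub _ _ [set z | f U z = 0] _ (eP x) : kesec U)), t; split=> // [a x y|y|x].
- by apply: mval_inj; rewrite /= (cfun_lin f) lt scalerBr opprD addrACA.
- by apply: mval_inj; rewrite /= kevalP (lin0 lt) subr0.
- by rewrite /= subrK.
Qed.

Lemma keqc (U V : aff X) (h : (V : set X) `<=` U) :
  bijective (ulift (keres h) : bchg (rres h) (kesec U) -> kesec V).
Proof.
have Du := bchg_univ (cresL D h) (cqc D h).
have Dq := bchg_uniq (cresL D h) (cqc D h).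
have Eu := bchg_univ (cresL E h) (cqc E h).
have [e [t [le lt eK eE]]] := kesplit U.
have [|e' le' e'E] := Du _ (fun x => keres h (e x)).
  by move=> a x y; rewrite le keres_lin.
have [|t' lt' t'E] := Eu _ (fun x => cres h (t x)).
  by move=> a x y; rewrite lt (cresL D h).
have e't' : forall x, x = keval (e' x) + t' (f V x).
  apply: (Dq _ id (fun x => keval (e' x) + t' (f V x))) => // [a x y|x].
    by rewrite le' (cfun_lin f) lt' (@keval_lin V) scalerDr addrACA.
  rewrite e'E cfun_res t'E /= {1}(eE x).
  exact: semilinD (cresL D h) _ _.
have e'K y : e' (keval y) = y.
  by apply: keval_inj; rewrite [RHS]e't' kevalP (lin0 lt') addr0.
apply: bchg_bij (keres_lin h) _ _ => [P g lg|P g g' lg lg' gE y].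
- have [|g1 lg1 g1E] := Du P (fun x => g (e x)); first by move=> a x y; rewrite le lg.
  exists (fun y => g1 (keval y)) => [a x y|y]; first exact: lg1.
  by rewrite g1E eK.
- rewrite -(e'K y).
  apply: (Dq P (fun x => g (e' x)) (fun x => g' (e' x))) => [a u v|a u v|u].
  + by rewrite le' lg.
  + by rewrite le' lg'.
  by rewrite e'E gE.
Qed.

Lemma kefg (U : aff X) : fingen (kesec U).
Proof.
have [e [t [le lt eK eE]]] := kesplit U.
have [I [v vE]] := cfg D U; exists I, (fun i => e (v i)) => y.
have [c cE] := vE (keval y); exists c; rewrite -{1}(eK y) cE (lin_sum _ _ le).
by apply: eq_bigr => i _; rewrite (linZ le).
Qed.

Definition cker : coh X := Coh keres_lin keres_id keres_comp keqc kefg.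

Definition cker_val : cmor cker D :=
  @CMor _ cker D keval keval_lin (fun U V h s => erefl).

Lemma cker_splitker : splitker cker_val f.
Proof. by split=> [U y|U]; [exact: kevalP|exact: kesplit]. Qed.

End Kernel.

Section DirectSum.
Variables D E : coh X.

Definition susec (U : aff X) : lmodType (rO U) := (D U * E U)%type : lmodType (rO U).

Definition sures (U V : aff X) (h : (V : set X) `<=` U) (s : susec U) : susec V :=
  (cres h s.1, cres h s.2).

Lemma sures_lin (U V : aff X) (h : (V : set X) `<=` U) : semilin (rres h) (sures h).
Proof.
by move=> a x y; congr pair; exact: cres_lin.
Qed.

Lemma sures_id (U : aff X) (h : (U : set X) `<=` U) s : sures h s = s.
Proof. by case: s => x y; rewrite /sures !cres_id. Qed.

Lemma sures_comp (U V W : aff X) (h : (V : set X) `<=` U)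
  (h' : (W : set X) `<=` V) (h'' : (W : set X) `<=` U) s :
  sures h' (sures h s) = sures h'' s.
Proof. by rewrite /sures /= !(cres_comp h h' h''). Qed.

Lemma suqc (U V : aff X) (h : (V : set X) `<=` U) :
  bijective (ulift (sures h) : bchg (rres h) (susec U) -> susec V).
Proof.
have Du := bchg_univ (cresL D h) (cqc D h).
have Dq := bchg_uniq (cresL D h) (cqc D h).
have Eu := bchg_univ (cresL E h) (cqc E h).
have Eq := bchg_uniq (cresL E h) (cqc E h).
have pairD (W : aff X) (x : D W) (y : E W) : ((x, y) : susec W) = (x, 0) + (0, y).
  by congr pair; rewrite ?addr0 ?add0r.
have l1 W a (x y : D W) : ((a *: x + y, 0) : susec W) = a *: ((x, 0) : susec W) + (y, 0).
  by congr pair; rewrite /= scaler0 addr0.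
have l2 W a (x y : E W) : ((0, a *: x + y) : susec W) = a *: ((0, x) : susec W) + (0, y).
  by congr pair; rewrite /= scaler0 addr0.
apply: bchg_bij (sures_lin h) _ _ => [P g lg|P g g' lg lg' gE [x y]].
- have [|g1 lg1 g1E] := Du P (fun x => g (x, 0)); first by move=> a x y; rewrite l1 lg.
  have [|g2 lg2 g2E] := Eu P (fun x => g (0, x)); first by move=> a x y; rewrite l2 lg.
  exists (fun s : susec V => g1 s.1 + g2 s.2) => [a x y|[x y]] /=.
    by rewrite lg1 lg2 scalerDr addrACA.
  by rewrite g1E g2E -(semilinD lg) -pairD.
- rewrite pairD (linD lg) (linD lg'); congr (_ + _).
  + apply: (Dq P (fun x => g (x, 0)) (fun x => g' (x, 0))) => [a u v|a u v|u].
    * by rewrite l1 lg.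
    * by rewrite l1 lg'.
    have := gE (u, 0); rewrite /sures /= (semilin0 (cresL E h)); exact.
  + apply: (Eq P (fun x => g (0, x)) (fun x => g' (0, x))) => [a u v|a u v|u].
    * by rewrite l2 lg.
    * by rewrite l2 lg'.
    have := gE (0, u); rewrite /sures /= (semilin0 (cresL D h)); exact.
Qed.

Lemma sufg (U : aff X) : fingen (susec U).
Proof.
have [I [v vE]] := cfg D U; have [J [w wE]] := cfg E U.
exists (I + J)%type, (fun ij => match ij with inl i => (v i, 0) | inr j => (0, w j) end).
move=> [x y]; have [c cE] := vE x; have [d dE] := wE y.
exists (fun ij => match ij with inl i => c i | inr j => d j end).
have sum1 (s : seq I) : \sum_(i <- s) c i *: ((v i, 0) : susec U) = (\sum_(i <- s) c i *: v i, 0).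
  elim: s => [|i s ih]; first by rewrite !big_nil.
  by rewrite !big_cons ih; congr pair; rewrite /= scaler0 addr0.
have sum2 (s : seq J) : \sum_(i <- s) d i *: ((0, w i) : susec U) = (0, \sum_(i <- s) d i *: w i).
  elim: s => [|i s ih]; first by rewrite !big_nil.
  by rewrite !big_cons ih; congr pair; rewrite /= scaler0 addr0.
rewrite big_sumType /= sum1 sum2 -cE -dE.
by congr pair; rewrite /= ?addr0 ?add0r.
Qed.

Definition csum : coh X := Coh sures_lin sures_id sures_comp suqc sufg.

Definition cp1 : cmor csum D :=
  @CMor _ csum D (fun U => fst) (fun U a x y => erefl) (fun U V h s => erefl).
Definition cp2 : cmor csum E :=
  @CMor _ csum E (fun U => snd) (fun U a x y => erefl) (fun U V h s => erefl).

Definition ci1 : cmor D csum.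
Proof.
apply: (@CMor _ D csum (fun U x => (x, 0))) => [U a x y|U V h s] /=.
- by congr pair; rewrite /= scaler0 addr0.
- by congr pair; rewrite /= (semilin0 (cresL E h)).
Defined.

Definition ci2 : cmor E csum.
Proof.
apply: (@CMor _ E csum (fun U x => (0, x))) => [U a x y|U V h s] /=.
- by congr pair; rewrite /= scaler0 addr0.
- by congr pair; rewrite /= (semilin0 (cresL D h)).
Defined.

End DirectSum.

Definition cbip D E P (i : cmor D P) (j : cmor E P) (p : cmor P D) (q : cmor P E) :=
  [/\ ccomp p i = cid_mor D, ccomp q j = cid_mor E, ccomp p j = czero E D,
      ccomp q i = czero D E & cadd (ccomp i p) (ccomp j q) = cid_mor P].

Lemma csum_cbip D E : cbip (ci1 D E) (ci2 D E) (cp1 D E) (cp2 D E).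
Proof.
split; apply: cmor_ext => // U [x y].
by congr pair; rewrite /= ?addr0 ?add0r.
Qed.

Lemma cbip_iso D E P D' E' P' (i : cmor D P) (j : cmor E P) (p : cmor P D) (q : cmor P E)
    (i' : cmor D' P') (j' : cmor E' P') (p' : cmor P' D') (q' : cmor P' E')
    (alpha : cmor D D') (beta : cmor E E') :
  cbip i j p q -> cbip i' j' p' q' -> ciso alpha -> ciso beta ->
  exists gamma : cmor P P', [/\ ciso gamma, ccomp i' alpha = ccomp gamma i,
    ccomp j' beta = ccomp gamma j, ccomp p' gamma = ccomp alpha p
    & ccomp q' gamma = ccomp beta q].
Proof.
have el C F (f g : cmor C F) : f = g -> forall U x, f U x = g U x by move=> ->.
move=> [/el pi /el qj /el pj /el qi /el ij] [/el pi' /el qj' /el pj' /el qi' /el ij'] ia ib.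
pose gamma := cadd (ccomp i' (ccomp alpha p)) (ccomp j' (ccomp beta q)).
have gE U x : gamma U x = i' U (alpha U (p U x)) + j' U (beta U (q U x)) by [].
have pg U x : p' U (gamma U x) = alpha U (p U x).
  rewrite gE (linD (cfunL p' U)).
  by rewrite [p' U _](pi' U) [p' U _](pj' U); exact: addr0.
have qg U x : q' U (gamma U x) = beta U (q U x).
  rewrite gE (linD (cfunL q' U)).
  by rewrite [q' U _](qi' U) [X in _ + X](qj' U); exact: add0r.
have l0 C F (g : cmor C F) U : g U 0 = 0 by exact: lin0 (cfunL g U).
exists gamma; split.
- move=> U; exists (fun y => i U (cinv ia U (p' U y)) + j U (cinv ib U (q' U y))) => x.
    by rewrite pg qg !cinvVK; exact: ij.
  rewrite gE !(linD (cfunL p U)) !(linD (cfunL q U)).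
  rewrite [p U _](pi U) [p U _](pj U) [q U _](qi U) [X in j' U (beta U (_ + X))](qj U).
  by rewrite [_ + 0]addr0 [0 + _]add0r !cinvK; exact: ij'.
- apply: cmor_ext => U x; rewrite [RHS]gE [p U _](pi U) [q U _](qi U).
  by rewrite [beta U 0]l0 l0; symmetry; exact: addr0.
- apply: cmor_ext => U x; rewrite [RHS]gE [p U _](pj U) [q U _](qj U).
  by rewrite [alpha U 0]l0 l0; symmetry; exact: add0r.
- by apply: cmor_ext => U x; exact: pg.
- by apply: cmor_ext => U x; exact: qg.
Qed.

End CoherentLimits.

Section PullbackExact.
Variables (p : nat) (k : fieldType).
Hypothesis charkp : p \in [pchar k].
Variable X : kscheme k.
Implicit Types C D E K Q : coh X.

Local Notation F := (frob charkp).
Local Notation pmap := (@Defs.pmap p k charkp X _ _).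
Local Notation pmapn n := (@pmapn p k charkp X n _ _).

Definition bmap (U : aff X) (M N : lmodType (rO U)) (g : M -> N) :
  bchg (F U) M -> bchg (F U) N := ulift (fun s => ugen (g s) : bchg (F U) N).

Section BMap.
Variables (U : aff X) (M N : lmodType (rO U)) (g : M -> N).
Hypothesis lg : lin g.

Let adm : semilin (F U) (fun s => ugen (g s) : bchg (F U) N).
Proof. by move=> a x y; rewrite lg bchg_gen. Qed.

Lemma bmap_lin : lin (bmap g). Proof. exact: ulift_lin. Qed.
Lemma bmap_gen x : bmap g (ugen x) = ugen (g x). Proof. exact: ulift_gen. Qed.
End BMap.

Lemma pmap_splitker K D E (j : cmor K D) (f : cmor D E) :
  splitker j f -> splitker (pmap j) (pmap f).
Proof.
move=> [fj h]; split=> [U y|U].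
  apply: (umod_lin_ext (f := fun y => pmap f U (pmap j U y)) (g := fun=> 0)) => [a u v|a u v|s].
  - by rewrite (cfun_lin (pmap j)) (cfun_lin (pmap f)).
  - by rewrite scaler0 addr0.
  - by rewrite /= !pmap_gen fj (semilin0 (@bchg_gen _ _ (F U) (E U))).
have [e [t [le lt eK eE]]] := h U.
exists (bmap e), (bmap t); split; [exact: bmap_lin|exact: bmap_lin| |].
- apply: (umod_lin_ext (f := fun y => bmap e (pmap j U y)) (g := id)) => [a u v|//|s].
    by rewrite (cfun_lin (pmap j)) (bmap_lin le).
  by rewrite /= pmap_gen bmap_gen // eK.
- apply: (umod_lin_ext (f := id) (g := fun x => pmap j U (bmap e x) + bmap t (pmap f U x)))
    => [//|a u v|s].
    rewrite (bmap_lin le) (cfun_lin (pmap f)) (cfun_lin (pmap j)) (bmap_lin lt).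
    by rewrite scalerDr addrACA.
  rewrite /= bmap_gen // !pmap_gen bmap_gen // -(semilinD (@bchg_gen _ _ (F U) (D U))).
  by rewrite -eE.
Qed.

Lemma pmap_rexact D E Q (f : cmor D E) (q : cmor E Q) :
  rexact f q -> rexact (pmap f) (pmap q).
Proof.
move=> [qe qf]; split=> [U y|U y].
  rewrite [y]umod_decomp; elim: (repr _) => [|[a z] s [x xE]].
    by exists 0; rewrite /fsum big_nil (lin0 (cfunL (pmap q) U)).
  have [w wz] := qe U z; exists (a *: ugen w + x).
  by rewrite (cfun_lin (pmap q)) xE /= pmap_gen wz /fsum big_cons.
split=> [|[x <-]]; last first.
  apply: (umod_lin_ext (f := fun y => pmap q U (pmap f U y)) (g := fun=> 0)) => [a u v|a u v|s].
  - by rewrite (cfun_lin (pmap f)) (cfun_lin (pmap q)).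
  - by rewrite scaler0 addr0.
  - rewrite /= !pmap_gen; have -> : q U (f U s) = 0 by apply/qf; exists s.
    exact: semilin0 (@bchg_gen _ _ (F U) (Q U)).
move=> qy; have hS := image_submod (pmap f) U.
have /choice[r rK] := qe U.
pose g (z : Q U) := mpi hS (ugen (r z)).
have gq x : g (q U x) = mpi hS (ugen x).
  have /qf[z zE] : q U (r (q U x) - x) = 0.
    by rewrite (linB (cfunL q U)) rK subrr.
  rewrite /g; have -> : r (q U x) = x + f U z by rewrite zE addrC subrK.
  rewrite (semilinD (@bchg_gen _ _ (F U) (E U))) mpiD.
  have -> : mpi hS (ugen (f U z)) = 0.
    by apply/mpi_eq0; exists (ugen z); exact: pmap_gen.
  by rewrite addr0.
have lg : semilin (F U) g.
  move=> a x z; have [x' <-] := qe U x; have [z' <-] := qe U z.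
  by rewrite -(cfun_lin q) !gq bchg_gen (mpi_lin hS).
have : mpi hS y = 0.
  have -> : mpi hS y = ulift g (pmap q U y).
    apply: (umod_lin_ext (g := fun y => ulift g (pmap q U y))) => [|a u v|s].
    - exact: mpi_lin.
    - by rewrite (cfun_lin (pmap q)) (ulift_lin lg).
    - by rewrite /= pmap_gen ulift_gen // gq.
  by rewrite qy (lin0 (ulift_lin lg)).
by move/mpi_eq0.
Qed.

Lemma pmap_cbip D E P (i : cmor D P) (j : cmor E P) (r : cmor P D) (q : cmor P E) :
  cbip i j r q -> cbip (pmap i) (pmap j) (pmap r) (pmap q).
Proof.
move=> [h1 h2 h3 h4 h5]; split; rewrite -!pmap_comp ?h1 ?h2 ?h3 ?h4 ?pmap_id ?pmap_zero //.
by rewrite -pmap_add h5 pmap_id.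
Qed.

Lemma pmapn_splitker n K D E (j : cmor K D) (f : cmor D E) :
  splitker j f -> splitker (pmapn n j) (pmapn n f).
Proof. by move=> h; elim: n => //= n; exact: pmap_splitker. Qed.

Lemma pmapn_rexact n D E Q (f : cmor D E) (q : cmor E Q) :
  rexact f q -> rexact (pmapn n f) (pmapn n q).
Proof. by move=> h; elim: n => //= n; exact: pmap_rexact. Qed.

Lemma pmapn_cbip n D E P (i : cmor D P) (j : cmor E P) (r : cmor P D) (q : cmor P E) :
  cbip i j r q -> cbip (pmapn n i) (pmapn n j) (pmapn n r) (pmapn n q).
Proof. by move=> h; elim: n => //= n; exact: pmap_cbip. Qed.

End PullbackExact.

(** * The abelian category of stratified bundles *)

Lemma regular_of_projective (R : comPzRingType) (D E Q : lmodType R) (f : D -> E) (q : E -> Q) :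
  lin f -> lin q -> (forall y, exists x, q x = y) ->
  (forall y, q y = 0 -> exists x, f x = y) -> (forall x, q (f x) = 0) ->
  ffree E 1 -> ffree Q 1 -> exists t : E -> D, lin t /\ forall x, f (t (f x)) = f x.
Proof.
move=> lf lq qe qf qf0 [T [phi [v [lphi phiE]]]] [T' [psi [w [lpsi psiE]]]].
have [w' w'E] := choice (fun i => qe (w i)).
pose r (z : Q) := \sum_i (psi i z : R) *: w' i.
have lr : lin r := lin_expand w' lpsi.
have qr z : q (r z) = z.
  rewrite (lin_sum _ _ lq) -[RHS]scale1r psiE; apply: eq_bigr => i _.
  by rewrite (linZ lq) w'E.
have /choice[d dE] : forall i, exists d, f d = v i - r (q (v i)).
  by move=> i; apply: qf; rewrite (linB lq) qr subrr.
exists (fun x => \sum_i (phi i x : R) *: d i); split; first exact: lin_expand.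
have ftE y : f (\sum_i (phi i y : R) *: d i) = y - r (q y).
  rewrite (lin_sum _ _ lf) -[y in RHS]scale1r phiE.
  rewrite (lin_sum _ _ lq) (lin_sum _ _ lr) -sumrB; apply: eq_bigr => i _.
  by rewrite (linZ lf) dE (linZ lq) (linZ lr) scalerBr.
by move=> x; rewrite ftE qf0 (lin0 lr) subr0.
Qed.

Section StratLimits.
Variables (p : nat) (k : fieldType).
Hypothesis charkp : p \in [pchar k].
Variable X : kscheme k.

Local Notation pmap := (@Defs.pmap p k charkp X _ _).
Local Notation pmapn n := (@pmapn p k charkp X n _ _).
Local Notation SB := (strat_bundle charkp X).

Lemma to_stage_id t E (sigma : @stratification p k charkp X t E) (h : (t <= t)%N) :
  to_stage h sigma = sigma.
Proof.
rewrite /to_stage; move: (subnK h); move: (t - t)%N (subnn t) => n -> e.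
by rewrite (eq_irrelevance e erefl).
Qed.

Section AtStage.
Variables (t : nat) (D E : nat -> coh X).
Variables (tau : @stratification p k charkp X t D) (sigma : @stratification p k charkp X t E).
Variable f : forall i, cmor (D i) (E i).
Hypothesis hf : is_strat_mor tau sigma f.

Lemma strat_coker (Q : nat -> coh X) (q : forall i, cmor (E i) (Q i)) :
  (forall i, rexact (f i) (q i)) ->
  exists kappa : @stratification p k charkp X t Q, is_strat_mor sigma kappa q.
Proof.
move=> hq; have [f0 fS] := hf.
have [s0 i0 e0] := iso_desc (pmapn_rexact charkp t (hq 0%N)) (pmapn_rexact charkp t.+1 (hq 1%N))
  (sig0_iso tau) (sig0_iso sigma) (esym f0).
have H i : exists g : cmor (Q i.+1) (fpull charkp (Q i.+2)),
    ciso g /\ ccomp (pmap (q i.+2)) (sig sigma i) = ccomp g (q i.+1).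
  have [g gi gE] := iso_desc (hq i.+1) (pmap_rexact charkp (hq i.+2))
    (sig_iso tau i) (sig_iso sigma i) (esym (fS i)).
  by exists g.
exists (@Stratification p k charkp X t Q s0 (fun i => sval (cid (H i))) i0
  (fun i => (svalP (cid (H i))).1)).
by split=> [|i] //=; exact: (svalP (cid (H i))).2.
Qed.

Lemma strat_ker (K : nat -> coh X) (j : forall i, cmor (K i) (D i)) :
  (forall i, splitker (j i) (f i)) ->
  exists kappa : @stratification p k charkp X t K, is_strat_mor kappa tau j.
Proof.
move=> hj; have [f0 fS] := hf.
have [s0 i0 e0] := iso_lift (pmapn_splitker charkp t (hj 0%N)) (pmapn_splitker charkp t.+1 (hj 1%N))
  (sig0_iso tau) (sig0_iso sigma) f0.
have H i : exists g : cmor (K i.+1) (fpull charkp (K i.+2)),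
    ciso g /\ ccomp (pmap (j i.+2)) g = ccomp (sig tau i) (j i.+1).
  have [g gi gE] := iso_lift (hj i.+1) (pmap_splitker charkp (hj i.+2))
    (sig_iso tau i) (sig_iso sigma i) (fS i).
  by exists g.
exists (@Stratification p k charkp X t K s0 (fun i => sval (cid (H i))) i0
  (fun i => (svalP (cid (H i))).1)).
by split=> [|i] //=; exact: (svalP (cid (H i))).2.
Qed.

End AtStage.

Lemma strat_sum t (D E : nat -> coh X) (tau : @stratification p k charkp X t D)
    (sigma : @stratification p k charkp X t E) :
  exists kappa : @stratification p k charkp X t (fun i => csum (D i) (E i)),
  [/\ is_strat_mor tau kappa (fun i => ci1 (D i) (E i)),
      is_strat_mor sigma kappa (fun i => ci2 (D i) (E i)),
      is_strat_mor kappa tau (fun i => cp1 (D i) (E i))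
    & is_strat_mor kappa sigma (fun i => cp2 (D i) (E i))].
Proof.
have B i := csum_cbip (D i) (E i).
have [s0 [i0 a0 b0 c0 d0]] := cbip_iso (pmapn_cbip charkp t (B 0%N))
  (pmapn_cbip charkp t.+1 (B 1%N)) (sig0_iso tau) (sig0_iso sigma).
have H i := cbip_iso (B i.+1) (pmap_cbip charkp (B i.+2)) (sig_iso tau i) (sig_iso sigma i).
pose g i := sval (cid (H i)); have gP i := svalP (cid (H i)).
have gi i : ciso (g i) by case: (gP i).
exists (@Stratification p k charkp X t (fun i => csum (D i) (E i)) s0 g i0 gi).
by split; split=> //= i; case: (gP i).
Qed.

Lemma colim_lift (K D C : SB) (j : shom K D) (g : shom C D)
    (h : forall i, cmor (C i) (K i)) :
  (forall n i, cinjective (pmapn n (j i))) -> (forall i, ccomp (j i) (h i) = g i) ->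
  is_colim_mor h.
Proof.
move=> ji jh; have [s [a [b [c [d [[j0 jS] [g0 gS]]]]]]] := colim_mor2 (hfunP j) (hfunP g).
exists s, c, a; rewrite (bool_irrelevance b d) in j0 jS; split=> [|i].
- apply: (cmor_ext_inj (ji s.+1 1%N)).
  rewrite !ccompA -pmapn_comp jh g0 j0 -ccompA -pmapn_comp jh.
  by [].
- apply: (cmor_ext_inj (ji 1%N i.+2)).
  by rewrite !ccompA -[pmapn 1 (j _)]/(pmap (j _)) -pmap_comp jh gS jS -ccompA jh.
Qed.

Lemma colim_desc (E Q C : SB) (q : shom E Q) (g : shom E C)
    (h : forall i, cmor (Q i) (C i)) :
  (forall n i, cepi (pmapn n (q i))) -> (forall i, ccomp (h i) (q i) = g i) ->
  is_colim_mor h.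
Proof.
move=> qe hq; have [s [a [b [c [d [[q0 qS] [g0 gS]]]]]]] := colim_mor2 (hfunP q) (hfunP g).
exists s, b, d; rewrite (bool_irrelevance c a) in g0 gS; split=> [|i].
- apply: (cmor_ext_epi (qe s 0%N)).
  by rewrite -!ccompA -q0 -pmapn_comp hq -g0 ccompA -pmapn_comp hq.
- apply: (cmor_ext_epi (qe 0%N i.+1)).
  by rewrite /= -!ccompA hq -qS ccompA -pmap_comp hq -gS.
Qed.

End StratLimits.

Section AbelianCategory.
Variables (p : nat) (k : fieldType).
Hypothesis charkp : p \in [pchar k].
Hypothesis kperf : forall a : k, exists b, b ^+ p = a.
Variable X : kscheme k.
Hypotheses (Xsm : smooth X) (Xirr : geom_irreducible X).

Local Notation pmapn n := (@pmapn p k charkp X n _ _).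
Local Notation SB := (strat_bundle charkp X).
Local Notation cat := (strat_infty charkp kperf X).
Local Notation Hom := (@Defs.hom k cat).
Local Notation ffree1 := (strat_ffree1 kperf Xsm Xirr).

Lemma exists_coker (A B : SB) (f : shom A B) :
  exists (Q : SB) (q : shom B Q), forall i, rexact (f i) (q i).
Proof.
have [s [a [b hf]]] := hfunP f.
have [kappa hk] := strat_coker hf (fun i => ccoker_rexact (f i)).
have qP : @is_colim_mor p k charkp X B (StratBundle kappa) (fun i => ccoker_pi (f i)).
  by exists s, b, (leqnn s); rewrite to_stage_id.
by exists (StratBundle kappa), (SHom qP) => i; exact: ccoker_rexact.
Qed.

Lemma shom_regular (A B : SB) (f : shom A B) i U :
  exists t : B i U -> A i U, lin t /\ forall x, f i U (t (f i U x)) = f i U x.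
Proof.
have [Q [q hq]] := exists_coker f; have [qe qf] := hq i.
apply: (regular_of_projective (q := q i U)).
- exact: cfun_lin.
- exact: cfun_lin.
- exact: qe.
- by move=> y /qf.
- by move=> x; apply/qf; exists x.
- exact: (ffree1 (sstr B)).
- exact: (ffree1 (sstr Q)).
Qed.

Lemma exists_ker (A B : SB) (f : shom A B) :
  exists (K : SB) (j : shom K A), forall i, splitker (j i) (f i).
Proof.
have [s [a [b hf]]] := hfunP f.
have [kappa hk] := strat_ker hf (fun i => cker_splitker (shom_regular f i)).
have jP : @is_colim_mor p k charkp X (StratBundle kappa) A (fun i => cker_val (shom_regular f i)).
  by exists s, (leqnn s), a; rewrite to_stage_id.
by exists (StratBundle kappa), (SHom jP) => i; exact: cker_splitker.
Qed.

Lemma hom_eq0 (A B : SB) (f : colim_hom kperf A B) :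
  f = 0 <-> forall i U x, (f : shom A B) i U x = 0.
Proof. by split=> [->//|h]; apply: shom_ext => i U s; rewrite h. Qed.

Lemma exists_lift (K A C : SB) (j : shom K A) (g : shom C A) :
  (forall n i, cinjective (pmapn n (j i))) ->
  (forall i U s, exists y, j i U y = g i U s) ->
  exists! h : Hom C K, @Defs.comp k cat _ _ _ (j : Defs.hom (K : cat) A) h = g.
Proof.
move=> ji jg; have H i := clift (ji 0%N i) (jg i).
pose h i := sval (cid (H i)); have hE i : ccomp (j i) (h i) = g i by exact: svalP (cid (H i)).
exists (SHom (colim_lift ji hE)); split.
  by apply: shom_ext => i U s; rewrite -hE.
move=> h' h'E; apply: shom_ext => i U s; apply: (ji 0%N i); rewrite /=.
have -> : j i U (h i U s) = g i U s by rewrite -hE.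
by rewrite -h'E.
Qed.

Lemma exists_desc (B Q C : SB) (q : shom B Q) (g : shom B C) :
  (forall n i, cepi (pmapn n (q i))) ->
  (forall i U x, q i U x = 0 -> g i U x = 0) ->
  exists! h : Hom Q C, @Defs.comp k cat _ _ _ h (q : Defs.hom (B : cat) Q) = g.
Proof.
move=> qe qg; have H i := cdesc (qe 0%N i) (qg i).
pose h i := sval (cid (H i)); have hE i : ccomp (h i) (q i) = g i by exact: svalP (cid (H i)).
exists (SHom (colim_desc qe hE)); split.
  by apply: shom_ext => i U s; rewrite -hE.
move=> h' h'E; apply: shom_ext => i U s; have [x <-] := qe 0%N i U s; rewrite /=.
have -> : h i U (q i U x) = g i U x by rewrite -hE.
by rewrite -h'E.
Qed.

Lemma splitker_is_kernel (K A B : SB) (j : shom K A) (f : shom A B) :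
  (forall i, splitker (j i) (f i)) ->
  @is_kernel k cat A B K (f : colim_hom kperf A B) (j : colim_hom kperf K A).
Proof.
move=> hj; split; first by apply/hom_eq0 => i U x; exact: (hj i).1.
move=> C g /hom_eq0 fg; apply: exists_lift => [n i|i U s].
  exact: splitker_inj (pmapn_splitker charkp n (hj i)).
exact: splitker_im (hj i) _ _ (fg i U s).
Qed.

Lemma rexact_is_cokernel (A B Q : SB) (f : shom A B) (q : shom B Q) :
  (forall i, rexact (f i) (q i)) ->
  @is_cokernel k cat A B Q (f : colim_hom kperf A B) (q : colim_hom kperf B Q).
Proof.
move=> hq; split.
  by apply/hom_eq0 => i U x; apply/(hq i).2; exists x.
move=> C g /hom_eq0 gf; apply: exists_desc => [n i|i U x].
  exact: (pmapn_rexact charkp n (hq i)).1.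
by move/(hq i).2 => [y <-]; exact: gf.
Qed.

Lemma monic_ker0 (A B K : SB) (f : Hom A B) (j : shom K A) : Defs.monic f ->
  (forall i, splitker (j i) ((f : shom A B) i)) -> forall i, j i = czero _ _.
Proof.
move=> fm hj; have : (j : Defs.hom (K : cat) A) = 0.
  apply: fm; rewrite (splitker_is_kernel hj).1.
  by symmetry; apply/hom_eq0 => i U x /=; exact: lin0 (cfunL _ U).
by move/hom_eq0 => j0 i; apply: cmor_ext => U x; exact: j0.
Qed.

Lemma monic_inj (A B : SB) (f : Hom A B) : Defs.monic f ->
  forall n i, cinjective (pmapn n ((f : shom A B) i)).
Proof.
move=> fm n i U x y e; have [K [j hj]] := exists_ker (f : shom A B).
have := splitker_im (pmapn_splitker charkp n (hj i)) (U := U) (x := x - y).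
rewrite (linB (cfunL (pmapn n ((f : shom A B) i)) U)) e subrr.
case=> // z; rewrite (monic_ker0 fm hj) pmapn_zero => /eqP.
by rewrite eq_sym subr_eq0 => /eqP.
Qed.

Lemma epic_coker (A B Q : SB) (f : Hom A B) (q : shom B Q) : Defs.epic f ->
  (forall i, rexact ((f : shom A B) i) (q i)) ->
  forall i U y, exists x, (f : shom A B) i U x = y.
Proof.
move=> fe hq i U y; apply/(hq i).2.
have : (q : Defs.hom (B : cat) Q) = 0.
  apply: fe; rewrite (rexact_is_cokernel hq).1.
  by symmetry; apply/hom_eq0.
by move/hom_eq0; exact.
Qed.

Lemma abelian_strat : abelian cat.
Proof.
split.
- have [Q [q hq]] := exists_coker (sid kperf (strat_one charkp X)).
  exists Q => A; have Q0 i U (y : Q i U) : y = 0.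
    have [x <-] := (hq i).1 U y; apply/(hq i).2; by exists x.
  split=> f; apply/hom_eq0 => i U x; last exact: Q0.
  by rewrite (Q0 _ _ x); exact: lin0 (cfunL _ U).
- move=> A B; pose s := maxn (stg A) (stg B).
  have [kappa [h1 h2 h3 h4]] := strat_sum (to_stage (leq_maxl _ _ : (stg A <= s)%N) (sstr A))
    (to_stage (leq_maxr _ _ : (stg B <= s)%N) (sstr B)).
  pose P := StratBundle kappa.
  have i1 : @is_colim_mor p k charkp X A P (fun i => ci1 (A i) (B i)).
    by exists s, (leq_maxl _ _), (leqnn s); rewrite to_stage_id.
  have i2 : @is_colim_mor p k charkp X B P (fun i => ci2 (A i) (B i)).
    by exists s, (leq_maxr _ _), (leqnn s); rewrite to_stage_id.
  have p1 : @is_colim_mor p k charkp X P A (fun i => cp1 (A i) (B i)).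
    by exists s, (leqnn s), (leq_maxl _ _); rewrite to_stage_id.
  have p2 : @is_colim_mor p k charkp X P B (fun i => cp2 (A i) (B i)).
    by exists s, (leqnn s), (leq_maxr _ _); rewrite to_stage_id.
  exists P, (SHom i1), (SHom i2), (SHom p1), (SHom p2).
  split; apply: shom_ext => i U x //.
  by have [_ _ _ _ e] := csum_cbip (A i) (B i); exact: (congr1 (fun g : cmor _ _ => g U x) e).
- move=> A B f; have [K [j hj]] := exists_ker (f : shom A B).
  by exists K, j; exact: splitker_is_kernel.
- move=> A B f; have [Q [q hq]] := exists_coker (f : shom A B).
  by exists Q, q; exact: rexact_is_cokernel.
- move=> A B f fm; have [Q [q hq]] := exists_coker (f : shom A B).
  exists Q, q; split; first exact: (rexact_is_cokernel hq).1.
  move=> C g /hom_eq0 qg; apply: exists_lift; first exact: monic_inj.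
  by move=> i U s; apply/(hq i).2; exact: qg.
- move=> A B f fe; have [K [j hj]] := exists_ker (f : shom A B).
  have [Q [q hq]] := exists_coker (f : shom A B).
  exists K, j; apply: rexact_is_cokernel => i; split; first exact: epic_coker fe hq i.
  move=> U y; split=> [|[x <-]]; first exact: splitker_im (hj i) _ _.
  exact: (hj i).1.
Qed.

End AbelianCategory.

(** * Tensor products of coherent sheaves *)

Section TensorLemmas.
Variable R : comPzRingType.
Implicit Types M N P Q : lmodType R.

Definition tlift M N P (b : M -> N -> P) : tens M N -> P := ulift (fun c => b c.1 c.2).

Lemma tlift_lin M N P (b : M -> N -> P) : bilin b -> lin (tlift b).
Proof. by move=> hb; apply: ulift_lin. Qed.

Lemma tlift_gen M N P (b : M -> N -> P) x y : bilin b -> tlift b (ugen (x, y)) = b x y.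
Proof. by move=> hb; rewrite /tlift ulift_gen. Qed.

Lemma tens_ext M N P (f g : tens M N -> P) : lin f -> lin g ->
  (forall x y, f (ugen (x, y)) = g (ugen (x, y))) -> forall t, f t = g t.
Proof. by move=> lf lg h; apply: umod_lin_ext => // -[x y]. Qed.

Lemma tgenDl M N (y : N) : lin (fun x => ugen (x, y) : tens M N).
Proof. exact: (tens_gen M N).1. Qed.

Lemma tgenDr M N (x : M) : lin (fun y => ugen (x, y) : tens M N).
Proof. exact: (tens_gen M N).2. Qed.

End TensorLemmas.

Section CoherentTensor.
Variable X : scheme.
Implicit Types A B C D E : coh X.

Lemma ccE C D E (g : cmor D E) (f : cmor C D) U x : ccomp g f U x = g U (f U x).
Proof. by []. Qed.

Lemma ctens_ext D E C (f g : cmor (ctens D E) C) :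
  (forall U x y, f U (ugen (x, y)) = g U (ugen (x, y))) -> f = g.
Proof.
move=> h; apply: cmor_ext => U.
exact: (tens_ext (cfunL f U) (cfunL g U) (h U)).
Qed.

Section Lift.
Variables (D E C : coh X) (b : forall U : aff X, D U -> E U -> C U).
Hypothesis hb : forall U, bilin (@b U).
Hypothesis hr : forall (U V : aff X) (h : (V : set X) `<=` U) x y,
  b (cres h x) (cres h y) = cres h (b x y).

Definition ctl_fun U : ctens D E U -> C U := tlift (@b U).

Lemma ctl_lin U : lin (@ctl_fun U). Proof. exact: tlift_lin. Qed.

Lemma ctl_res (U V : aff X) (h : (V : set X) `<=` U) (s : ctens D E U) :
  ctl_fun (cres h s) = cres h (ctl_fun s).
Proof.
apply: (umod_semilin_ext (phi := rres h) (f := @ctl_fun V \o cres h)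
          (g := cres h \o @ctl_fun U)) => [a x y|a x y|[x y]] /=.
- by rewrite (@tres_lin _ D E _ _ h) ctl_lin.
- by rewrite ctl_lin (cresL C h).
- by rewrite tres_gen /ctl_fun !tlift_gen.
Qed.

Definition ctl : cmor (ctens D E) C := CMor ctl_lin ctl_res.

Lemma ctlE U x y : ctl U (ugen (x, y)) = b x y.
Proof. exact: tlift_gen. Qed.
End Lift.

Lemma tmapE D D' E E' (f : cmor D D') (g : cmor E E') U x y :
  tmap f g U (ugen (x, y)) = ugen (f U x, g U y).
Proof. exact: tmap_gen. Qed.

Lemma tmap_comp D D' D'' E E' E'' (f' : cmor D' D'') (f : cmor D D') (g' : cmor E' E'')
  (g : cmor E E') : tmap (ccomp f' f) (ccomp g' g) = ccomp (tmap f' g') (tmap f g).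
Proof. by apply: ctens_ext => U x y; rewrite ccE !tmapE. Qed.

Lemma tmap_id D E : tmap (cid_mor D) (cid_mor E) = cid_mor (ctens D E).
Proof. by apply: ctens_ext => U x y; rewrite tmapE. Qed.

Section Associator.
Variables A B D : coh X.

Let assoc_b (U : aff X) (t : ctens A B U) (z : D U) : ctens A (ctens B D) U :=
  tlift (fun x y => ugen (x, ugen (y, z)) : ctens A (ctens B D) U) t.

Let assoc_in U (z : D U) : bilin (fun x y => ugen (x, ugen (y, z)) : ctens A (ctens B D) U).
Proof.
by split=> [y|x] a u v; rewrite ?(@tgenDl _ (B U)) ?(@tgenDl _ (A U)) ?(@tgenDr _ (A U)).
Qed.

Let assoc_bl U : bilin (@assoc_b U).
Proof.
split=> [z|t] a u v; first exact: (tlift_lin (assoc_in z)).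
apply: (tens_ext (f := fun t => assoc_b t (a *: u + v))
  (g := fun t => a *: assoc_b t u + assoc_b t v)) => [c x y|c x y|x y].
- exact: (tlift_lin (assoc_in _)).
- rewrite /assoc_b !(tlift_lin (assoc_in _)) !scalerDr !scalerA mulrC.
  by rewrite addrACA.
- by rewrite /assoc_b !tlift_gen // (@tgenDr _ (B U)) (@tgenDr _ (A U)).
Qed.

Let assoc_r (U V : aff X) (h : (V : set X) `<=` U) t z :
  assoc_b (cres h t) (cres h z) = cres h (assoc_b t z).
Proof.
move: t; apply: (umod_semilin_ext (phi := rres h) (P := ctens A (ctens B D) V)
  (f := fun t : ctens A B U => assoc_b (cres h t) (cres h z))
  (g := fun t : ctens A B U => cres h (assoc_b t z))) => [a x y|a x y|[x y]].
- by rewrite (cresL (ctens A B) h) (assoc_bl V).1.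
- by rewrite (assoc_bl U).1 (cresL (ctens A (ctens B D)) h).
- by rewrite /= tres_gen /assoc_b !tlift_gen // tres_gen /= tres_gen.
Qed.

Definition cassoc : cmor (ctens (ctens A B) D) (ctens A (ctens B D)) := ctl assoc_bl assoc_r.

Lemma cassocE U x y z : cassoc U (ugen (ugen (x, y), z)) = ugen (x, ugen (y, z)).
Proof. by rewrite ctlE /assoc_b tlift_gen. Qed.

End Associator.

Lemma ctens3l_ext A B D C (f g : cmor (ctens (ctens A B) D) C) :
  (forall U x y z, f U (ugen (ugen (x, y), z)) = g U (ugen (ugen (x, y), z))) -> f = g.
Proof.
move=> h; apply: ctens_ext => U t z.
apply: (tens_ext (f := fun t => f U (ugen (t, z))) (g := fun t => g U (ugen (t, z)))) => // a x y.
- by rewrite (@tgenDl _ (ctens A B U)) (cfun_lin f).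
- by rewrite (@tgenDl _ (ctens A B U)) (cfun_lin g).
Qed.

Lemma ctens3r_ext A B D C (f g : cmor (ctens A (ctens B D)) C) :
  (forall U x y z, f U (ugen (x, ugen (y, z))) = g U (ugen (x, ugen (y, z)))) -> f = g.
Proof.
move=> h; apply: ctens_ext => U x t.
apply: (tens_ext (f := fun t => f U (ugen (x, t))) (g := fun t => g U (ugen (x, t)))) => // a y z.
- by rewrite (@tgenDr _ (A U)) (cfun_lin f).
- by rewrite (@tgenDr _ (A U)) (cfun_lin g).
Qed.

Lemma cassoc_nat A A' B B' D D' (f : cmor A A') (g : cmor B B') (h : cmor D D') :
  ccomp (tmap f (tmap g h)) (cassoc A B D) = ccomp (cassoc A' B' D') (tmap (tmap f g) h).
Proof. by apply: ctens3l_ext => U x y z; rewrite !ccE cassocE !tmapE cassocE. Qed.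

Definition cbraid_b (D E : coh X) (U : aff X) (x : D U) (y : E U) : ctens E D U := ugen (y, x).

Lemma cbraid_bl D E U : bilin (@cbraid_b D E U).
Proof. by split=> [y|x] a u v; rewrite /cbraid_b ?(@tgenDr _ (E U)) ?(@tgenDl _ (E U)). Qed.

Lemma cbraid_r D E (U V : aff X) (h : (V : set X) `<=` U) (x : D U) (y : E U) :
  cbraid_b (cres h x) (cres h y) = cres h (cbraid_b x y).
Proof. by rewrite /cbraid_b /= tres_gen. Qed.

Definition cbraid D E : cmor (ctens D E) (ctens E D) := ctl (@cbraid_bl D E) (@cbraid_r D E).

Lemma cbraidE D E U x y : cbraid D E U (ugen (x, y)) = ugen (y, x).
Proof. exact: ctlE. Qed.

Lemma cbraidK D E : ccomp (cbraid E D) (cbraid D E) = cid_mor _.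
Proof. by apply: ctens_ext => U x y; rewrite ccE !cbraidE. Qed.

Lemma cbraid_nat A A' B B' (f : cmor A A') (g : cmor B B') :
  ccomp (tmap g f) (cbraid A B) = ccomp (cbraid A' B') (tmap f g).
Proof. by apply: ctens_ext => U x y; rewrite !ccE cbraidE !tmapE cbraidE. Qed.

Definition cassocV A B D : cmor (ctens A (ctens B D)) (ctens (ctens A B) D) :=
  locked (ccomp (cbraid D (ctens A B)) (ccomp (tmap (cid_mor D) (cbraid B A))
    (ccomp (cassoc D B A) (ccomp (tmap (cbraid B D) (cid_mor A)) (cbraid A (ctens B D)))))).

Lemma cassocVE A B D U x y z :
  cassocV A B D U (ugen (x, ugen (y, z))) = ugen (ugen (x, y), z).
Proof. by rewrite /cassocV -lock !ccE cbraidE tmapE cbraidE cassocE tmapE !cbraidE. Qed.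

Lemma cassocK A B D : ccomp (cassocV A B D) (cassoc A B D) = cid_mor _.
Proof. by apply: ctens3l_ext => U x y z; rewrite ccE cassocE cassocVE. Qed.

Lemma cassocVK A B D : ccomp (cassoc A B D) (cassocV A B D) = cid_mor _.
Proof. by apply: ctens3r_ext => U x y z; rewrite ccE cassocVE cassocE. Qed.

Definition clunit_b (E : coh X) (U : aff X) (a : cO X U) (x : E U) : E U := (a : rO U) *: x.

Lemma clunit_bl E U : bilin (@clunit_b E U).
Proof.
split=> [y|x] a u v; rewrite /clunit_b.
- by rewrite scalerDl scalerA.
- by rewrite scalerDr !scalerA mulrC.
Qed.

Lemma clunit_r E (U V : aff X) (h : (V : set X) `<=` U) a (x : E U) :
  clunit_b (cres h a) (cres h x) = cres h (clunit_b a x).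
Proof. by rewrite /clunit_b (semilinZ (cresL E h)). Qed.

Definition clunit E : cmor (ctens (cO X) E) E := ctl (@clunit_bl E) (@clunit_r E).

Lemma clunitE E (U : aff X) (a : rO U) (x : E U) :
  clunit E U (ugen (a : cO X U, x)) = a *: x.
Proof. exact: ctlE. Qed.

Definition clunitV (E : coh X) : cmor E (ctens (cO X) E).
Proof.
apply: (@CMor _ E (ctens (cO X) E) (fun U x => ugen (1 : cO X U, x))) => [U|U V h s].
- exact: tgenDr.
- by rewrite /= tres_gen /= /ores rmorph1.
Defined.

Lemma clunitK E : ccomp (clunitV E) (clunit E) = cid_mor _.
Proof.
apply: ctens_ext => U a x; rewrite ccE clunitE /=.
rewrite (linZ (@tgenDr _ (cO X U) (E U) 1)) -(linZ (@tgenDl _ (cO X U) (E U) x)).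
by congr (ugen (_, x)); exact: mulr1.
Qed.

Lemma clunitVK E : ccomp (clunit E) (clunitV E) = cid_mor _.
Proof. by apply: cmor_ext => U x; rewrite ccE clunitE scale1r. Qed.

Lemma clunit_nat A B (f : cmor A B) :
  ccomp f (clunit A) = ccomp (clunit B) (tmap (cid_mor (cO X)) f).
Proof.
apply: ctens_ext => U a x; rewrite !ccE tmapE !clunitE.
exact: linZ (cfunL f U) _ _.
Qed.

End CoherentTensor.

Section PullbackTensorCoherence.
Variables (p : nat) (k : fieldType).
Hypothesis charkp : p \in [pchar k].
Variable X : kscheme k.
Implicit Types A B C D E : coh X.

Local Notation F := (frob charkp).
Local Notation pmap := (@Defs.pmap p k charkp X _ _).
Local Notation pmapn n := (@pmapn p k charkp X n _ _).
Local Notation fpull := (fpull charkp).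
Local Notation mu := (@mu p k charkp X).
Local Notation mun := (@mun p k charkp X).

Lemma pmapE D E (f : cmor D E) U x : pmap f U (ugen x) = ugen (f U x).
Proof. exact: pmap_gen. Qed.

Lemma muE D E U x y : mu D E U (ugen (ugen (x, y))) = ugen (ugen x, ugen y).
Proof. exact: mu_gen. Qed.

Lemma ptens_ext D E C (f g : cmor (fpull (ctens D E)) C) :
  (forall U x y, f U (ugen (ugen (x, y))) = g U (ugen (ugen (x, y)))) -> f = g.
Proof.
move=> h; apply: pmap_ext => U.
apply: (umod_semilin_ext (phi := F U) (f := fun t => f U (ugen t)) (g := fun t => g U (ugen t)))
  => [a x y|a x y|[x y]].
- by rewrite bchg_gen (cfun_lin f).
- by rewrite bchg_gen (cfun_lin g).
- exact: h.
Qed.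

Lemma ptens3_ext A B D C (f g : cmor (fpull (ctens (ctens A B) D)) C) :
  (forall U x y z, f U (ugen (ugen (ugen (x, y), z))) = g U (ugen (ugen (ugen (x, y), z)))) ->
  f = g.
Proof.
move=> h; apply: ptens_ext => U t z; move: t.
apply: (umod_semilin_ext (phi := F U) (f := fun t => f U (ugen (ugen (t, z))))
  (g := fun t => g U (ugen (ugen (t, z))))) => [a x y|a x y|[x y]].
- by rewrite (@tgenDl _ (ctens A B U)) bchg_gen (cfun_lin f).
- by rewrite (@tgenDl _ (ctens A B U)) bchg_gen (cfun_lin g).
- exact: h.
Qed.

Lemma mu_nat D D' E E' (f : cmor D D') (g : cmor E E') :
  ccomp (mu D' E') (pmap (tmap f g)) = ccomp (tmap (pmap f) (pmap g)) (mu D E).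
Proof. by apply: ptens_ext => U x y; rewrite !ccE muE pmapE !tmapE muE !pmapE. Qed.

Lemma mu_assoc A B D :
  ccomp (tmap (cid_mor _) (mu B D)) (ccomp (mu A (ctens B D)) (pmap (cassoc A B D))) =
  ccomp (cassoc _ _ _) (ccomp (tmap (mu A B) (cid_mor _)) (mu (ctens A B) D)).
Proof.
by apply: ptens3_ext => U x y z; rewrite !ccE pmapE cassocE !muE !tmapE !muE cassocE.
Qed.

Lemma mu_braid D E : ccomp (mu E D) (pmap (cbraid D E)) = ccomp (cbraid _ _) (mu D E).
Proof. by apply: ptens_ext => U x y; rewrite !ccE pmapE cbraidE !muE cbraidE. Qed.

Lemma mun_nat n D D' E E' (f : cmor D D') (g : cmor E E') :
  ccomp (mun n D' E') (pmapn n (tmap f g)) = ccomp (tmap (pmapn n f) (pmapn n g)) (mun n D E).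
Proof.
elim: n => [|n ih]; first exact: cmor_ext.
rewrite /= -ccompA -pmap_comp ih pmap_comp !ccompA; congr (ccomp _ _).
exact: mu_nat.
Qed.

Lemma mun_assoc n A B D :
  ccomp (tmap (cid_mor _) (mun n B D)) (ccomp (mun n A (ctens B D)) (pmapn n (cassoc A B D))) =
  ccomp (cassoc _ _ _) (ccomp (tmap (mun n A B) (cid_mor _)) (mun n (ctens A B) D)).
Proof.
elim: n => [|n ih].
  by rewrite /= !tmap_id ccomp1f ccompf1 ccomp1f ccompf1.
have e1 : ccomp (tmap (cid_mor _) (pmap (mun n B D))) (mu (fpulln charkp n A) (fpulln charkp n (ctens B D))) =
    ccomp (mu _ _) (pmap (tmap (cid_mor _) (mun n B D))).
  by rewrite mu_nat pmap_id.
have e2 : ccomp (tmap (pmap (mun n A B)) (cid_mor _)) (mu (fpulln charkp n (ctens A B)) (fpulln charkp n D)) =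
    ccomp (mu _ _) (pmap (tmap (mun n A B) (cid_mor _))).
  by rewrite mu_nat pmap_id.
rewrite /= -[cid_mor (fpull (fpulln charkp n A))]ccomp1f tmap_comp.
rewrite -[cid_mor (fpull (fpulln charkp n D))]ccomp1f tmap_comp.
rewrite -!ccompA [ccomp (tmap (cid_mor _) (pmap _)) _]ccompA e1.
rewrite [ccomp (tmap (pmap _) (cid_mor _)) _]ccompA e2 -!ccompA -!pmap_comp ih.
rewrite pmap_comp !ccompA; congr (ccomp _ _).
by rewrite -!ccompA mu_assoc.
Qed.

Lemma mun_braid n D E :
  ccomp (mun n E D) (pmapn n (cbraid D E)) = ccomp (cbraid _ _) (mun n D E).
Proof.
elim: n => [|n ih]; first exact: cmor_ext.
by rewrite /= -ccompA -pmap_comp ih pmap_comp !ccompA mu_braid.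
Qed.

Lemma cinv_etaE (U : aff X) (a : cO X U) :
  cinv (eta_iso charkp (X := X)) U (ugen a) = F U a.
Proof.
apply: (bij_inj (eta_iso charkp (X := X) U)); rewrite cinvK /= /eta_fun.
rewrite -(semilinZ (@bchg_gen _ _ (F U) (cO X U))); congr ugen.
by symmetry; exact: mulr1.
Qed.

Fixpoint theta n : cmor (fpulln charkp n (cO X)) (cO X) :=
  if n is m.+1 then ccomp (cinv (eta_iso charkp (X := X))) (pmap (theta m)) else cid_mor _.

Fixpoint etas n : cmor (fpulln charkp n (cO X)) (fpulln charkp n.+1 (cO X)) :=
  if n is m.+1 then pmap (etas m) else Defs.eta charkp X.

Lemma etas_iso n : ciso (etas n).
Proof. by elim: n => [|n ih]; [exact: eta_iso|exact: pmap_iso]. Qed.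

Lemma theta_etas n : ccomp (theta n.+1) (etas n) = theta n.
Proof.
elim: n => [|n ih].
  by rewrite /= pmap_id ccompf1; apply: cmor_ext => U x; rewrite ccE cinvVK.
by rewrite [theta n.+2]/= -ccompA -pmap_comp ih.
Qed.

Lemma theta_iso n : ciso (theta n).
Proof.
elim: n => [|n ih] /=; first by move=> U; exists id.
by apply: ccomp_iso; [exact: cinv_iso|exact: pmap_iso].
Qed.

Lemma mu_lunit E : ccomp (clunit _) (ccomp (tmap (cinv (eta_iso charkp (X := X))) (cid_mor _))
  (mu (cO X) E)) = pmap (clunit E).
Proof.
apply: ptens_ext => U a x; rewrite !ccE muE tmapE cinv_etaE clunitE pmapE clunitE.
by rewrite (semilinZ (@bchg_gen _ _ (F U) (E U))).
Qed.

Lemma mun_lunit n E : ccomp (clunit _) (ccomp (tmap (theta n) (cid_mor _))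
  (mun n (cO X) E)) = pmapn n (clunit E).
Proof.
elim: n => [|n ih]; first by rewrite /= tmap_id !ccompf1.
rewrite /= -[cid_mor _]ccomp1f tmap_comp -!ccompA.
rewrite [ccomp (tmap (pmap _) _) (ccomp _ _)]ccompA.
have -> : ccomp (tmap (pmap (theta n)) (cid_mor _)) (mu (fpulln charkp n (cO X)) (fpulln charkp n E)) =
    ccomp (mu _ _) (pmap (tmap (theta n) (cid_mor _))).
  by rewrite mu_nat pmap_id.
by rewrite -ccompA -pmap_comp [ccomp (tmap _ _) _]ccompA ccompA mu_lunit -pmap_comp ih.
Qed.

End PullbackTensorCoherence.

(** * The tensor structure on stratified bundles *)

Section StratTensor.
Variables (p : nat) (k : fieldType).
Hypothesis charkp : p \in [pchar k].
Variable X : kscheme k.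
Implicit Types A B C D E : coh X.

Local Notation F := (frob charkp).
Local Notation pmap := (@Defs.pmap p k charkp X _ _).
Local Notation pmapn n := (@pmapn p k charkp X n _ _).
Local Notation fpull := (fpull charkp).
Local Notation fpulln := (fpulln charkp).
Local Notation mu := (@mu p k charkp X).
Local Notation mun := (@mun p k charkp X).
Local Notation mun_iso := (mun_iso charkp).
Local Notation strat := (@stratification p k charkp X).
Local Notation SB := (strat_bundle charkp X).

Lemma cinvKc C D E (f : cmor D E) (hf : ciso f) (g : cmor C E) :
  ccomp f (ccomp (cinv hf) g) = g.
Proof. by apply: cmor_ext => U x; rewrite !ccE cinvK. Qed.

Lemma ciso_inj D E (f : cmor D E) : ciso f -> cinjective f.
Proof. by move=> hf U; exact: bij_inj. Qed.

Definition ttens n m A B A' B' (a : cmor (fpulln m A) (fpulln n A'))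
    (b : cmor (fpulln m B) (fpulln n B')) : cmor (fpulln m (ctens A B)) (fpulln n (ctens A' B')) :=
  locked (ccomp (cinv (mun_iso n A' B')) (ccomp (tmap a b) (mun m A B))).

Section Squares.
Variables n m : nat.

Lemma ttensE A B A' B' (a : cmor (fpulln m A) (fpulln n A')) (b : cmor (fpulln m B) (fpulln n B')) :
  ccomp (mun n A' B') (ttens a b) = ccomp (tmap a b) (mun m A B).
Proof. by rewrite /ttens -lock cinvKc. Qed.

Lemma tmap_square A B A' B' C D C' D' (a : cmor (fpulln m A) (fpulln n A'))
    (b : cmor (fpulln m B) (fpulln n B')) (c : cmor (fpulln m C) (fpulln n C'))
    (d : cmor (fpulln m D) (fpulln n D')) (f : cmor A C) (g : cmor B D) (f' : cmor A' C')
    (g' : cmor B' D') :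
  ccomp (pmapn n f') a = ccomp c (pmapn m f) -> ccomp (pmapn n g') b = ccomp d (pmapn m g) ->
  ccomp (pmapn n (tmap f' g')) (ttens a b) = ccomp (ttens c d) (pmapn m (tmap f g)).
Proof.
move=> fa gb; apply: (cmor_ext_inj (ciso_inj (mun_iso n C' D'))).
rewrite !ccompA mun_nat ttensE -!ccompA ttensE mun_nat !ccompA -!tmap_comp.
by rewrite fa gb.
Qed.

Lemma assoc_square A B D A' B' D' (a : cmor (fpulln m A) (fpulln n A'))
    (b : cmor (fpulln m B) (fpulln n B')) (d : cmor (fpulln m D) (fpulln n D')) :
  ccomp (pmapn n (cassoc A' B' D')) (ttens (ttens a b) d) =
  ccomp (ttens a (ttens b d)) (pmapn m (cassoc A B D)).
Proof.
apply: (cmor_ext_inj (ciso_inj (mun_iso n A' (ctens B' D')))).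
have hid : ciso (cid_mor (fpulln n A')) by move=> U; exists id.
apply: (cmor_ext_inj (ciso_inj (tmap_iso hid (mun_iso n B' D')))).
rewrite [ccomp (mun _ _ _) (ccomp (pmapn n _) _)]ccompA [LHS]ccompA mun_assoc.
rewrite -!ccompA ttensE [ccomp (tmap (mun _ _ _) _) _]ccompA -tmap_comp ttensE ccomp1f.
rewrite [ccomp (mun n _ _) (ccomp _ _)]ccompA ttensE -ccompA [RHS]ccompA -tmap_comp ttensE ccomp1f.
rewrite -[d in LHS]ccompf1 tmap_comp -ccompA [LHS]ccompA -cassoc_nat.
by rewrite -[a in RHS]ccompf1 tmap_comp -!ccompA mun_assoc.
Qed.

Lemma braid_square A B A' B' (a : cmor (fpulln m A) (fpulln n A'))
    (b : cmor (fpulln m B) (fpulln n B')) :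
  ccomp (pmapn n (cbraid A' B')) (ttens a b) = ccomp (ttens b a) (pmapn m (cbraid A B)).
Proof.
apply: (cmor_ext_inj (ciso_inj (mun_iso n B' A'))).
by rewrite !ccompA mun_braid ttensE -!ccompA ttensE mun_braid !ccompA cbraid_nat.
Qed.

Lemma lunit_square A A' (e : cmor (fpulln m (cO X)) (fpulln n (cO X)))
    (a : cmor (fpulln m A) (fpulln n A')) :
  ccomp (theta charkp X n) e = theta charkp X m ->
  ccomp (pmapn n (clunit A')) (ttens e a) = ccomp a (pmapn m (clunit A)).
Proof.
move=> he; rewrite -mun_lunit -!ccompA ttensE [ccomp (tmap _ _) (ccomp _ _)]ccompA -tmap_comp.
rewrite he ccomp1f -[a in LHS]ccompf1 -[theta _ _ m]ccomp1f tmap_comp.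
by rewrite !ccompA -clunit_nat -!ccompA mun_lunit.
Qed.

End Squares.

Lemma ctens4_ext A B D E C (f g : cmor (ctens (ctens (ctens A B) D) E) C) :
  (forall U x y z w, f U (ugen (ugen (ugen (x, y), z), w)) =
     g U (ugen (ugen (ugen (x, y), z), w))) -> f = g.
Proof.
move=> h; apply: ctens3l_ext => U t z w.
apply: (tens_ext (f := fun t => f U (ugen (ugen (t, z), w)))
  (g := fun t => g U (ugen (ugen (t, z), w)))) => // a x y.
- by rewrite (@tgenDl _ (ctens A B U)) (@tgenDl _ (ctens (ctens A B) D U)) (cfun_lin f).
- by rewrite (@tgenDl _ (ctens A B U)) (@tgenDl _ (ctens (ctens A B) D U)) (cfun_lin g).
Qed.

Lemma tmap_linl D D' E E' c (f f' : cmor D D') (g : cmor E E') :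
  tmap (cadd (cscale c f) f') g = cadd (cscale c (tmap f g)) (tmap f' g).
Proof. by apply: ctens_ext => U x y; rewrite /= !tmap_gen /= (@tgenDl _ (D' U)). Qed.

Lemma tmap_linr D D' E E' c (f : cmor D D') (g g' : cmor E E') :
  tmap f (cadd (cscale c g) g') = cadd (cscale c (tmap f g)) (tmap f g').
Proof. by apply: ctens_ext => U x y; rewrite /= !tmap_gen /= (@tgenDr _ (D' U)). Qed.

Lemma mun1 D E : mun 1 D E = mu D E.
Proof. by rewrite /= pmap_id ccompf1. Qed.

Lemma cinv_eq D E (f g : cmor D E) (hf : ciso f) (hg : ciso g) : f = g -> cinv hf = cinv hg.
Proof. by move=> e; case: _ / e hg => hg; rewrite (Prop_irrelevance hf hg). Qed.

Lemma ttens10 A B A' B' (a : cmor A (fpull A')) (b : cmor B (fpull B')) :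
  @ttens 1 0 A B A' B' a b = ccomp (cinv (mu_iso charkp A' B')) (tmap a b).
Proof.
rewrite /ttens -lock /= (cinv_eq _ (mu_iso charkp A' B') (mun1 A' B')).
by congr (ccomp _ _); exact: ccompf1.
Qed.

Section AtStage.
Variable s : nat.

Lemma strat_tens_morE (A B : nat -> coh X) (tau : strat s A) (sigma : strat s B)
    (C : nat -> coh X) (rho : strat s C) (f : forall i, cmor (ctens (A i) (B i)) (C i)) :
  ccomp (pmapn s.+1 (f 1%N)) (@ttens s.+1 s _ _ _ _ (sig0 tau) (sig0 sigma)) =
    ccomp (sig0 rho) (pmapn s (f 0%N)) ->
  (forall i, ccomp (pmapn 1 (f i.+2)) (@ttens 1 0 _ _ _ _ (sig tau i) (sig sigma i)) =
    ccomp (sig rho i) (pmapn 0 (f i.+1))) ->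
  is_strat_mor (strat_tens_at tau sigma) rho f.
Proof.
by move=> h0 h; split=> [|i]; [move: h0; rewrite /ttens -lock|have := h i; rewrite ttens10].
Qed.

Lemma strat_tens_sigE (A B : nat -> coh X) (tau : strat s A) (sigma : strat s B) i :
  sig (strat_tens_at tau sigma) i = @ttens 1 0 _ _ _ _ (sig tau i) (sig sigma i).
Proof. by rewrite ttens10. Qed.

Lemma strat_tens_sig0E (A B : nat -> coh X) (tau : strat s A) (sigma : strat s B) :
  sig0 (strat_tens_at tau sigma) = @ttens s.+1 s _ _ _ _ (sig0 tau) (sig0 sigma).
Proof. by rewrite /ttens -lock. Qed.

Lemma tmap_strat (A B C D : nat -> coh X) (tA : strat s A) (tB : strat s B) (tC : strat s C)
    (tD : strat s D) f g :
  is_strat_mor tA tC f -> is_strat_mor tB tD g ->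
  is_strat_mor (strat_tens_at tA tB) (strat_tens_at tC tD) (fun i => tmap (f i) (g i)).
Proof.
move=> [f0 fS] [g0 gS]; apply: strat_tens_morE => [|i]; first by rewrite !strat_tens_sig0E; exact: tmap_square.
by rewrite strat_tens_sigE; apply: tmap_square; [exact: fS|exact: gS].
Qed.

Lemma assoc_strat (A B D : nat -> coh X) (tA : strat s A) (tB : strat s B) (tD : strat s D) :
  is_strat_mor (strat_tens_at (strat_tens_at tA tB) tD) (strat_tens_at tA (strat_tens_at tB tD))
    (fun i => cassoc (A i) (B i) (D i)).
Proof.
apply: strat_tens_morE => [|i]; first by rewrite !strat_tens_sig0E; exact: assoc_square.
by rewrite !strat_tens_sigE; exact: assoc_square.
Qed.

Lemma braid_strat (A B : nat -> coh X) (tA : strat s A) (tB : strat s B) :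
  is_strat_mor (strat_tens_at tA tB) (strat_tens_at tB tA) (fun i => cbraid (A i) (B i)).
Proof.
apply: strat_tens_morE => [|i]; first by rewrite !strat_tens_sig0E; exact: braid_square.
by rewrite !strat_tens_sigE; exact: braid_square.
Qed.

Definition one_at : strat s (fun=> cO X) :=
  @Stratification p k charkp X s (fun=> cO X) (etas charkp X s) (fun=> Defs.eta charkp X)
    (@etas_iso p k charkp X s) (fun=> @eta_iso p k charkp X).

Lemma lunit_strat (A : nat -> coh X) (tA : strat s A) :
  is_strat_mor (strat_tens_at one_at tA) tA (fun i => clunit (A i)).
Proof.
apply: strat_tens_morE => [|i]; first by apply: lunit_square; exact: theta_etas.
by apply: lunit_square; exact: (@theta_etas p k charkp X 0).
Qed.

End AtStage.

Lemma stratification_ext t (E : nat -> coh X) (sigma tau : strat t E) :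
  sig0 sigma = sig0 tau -> (forall i, sig sigma i = sig tau i) -> sigma = tau.
Proof.
case: sigma tau => [a b ai bi] [c d ci di] /= e0 eS.
have e : b = d by exact: functional_extensionality_dep.
move: e0 e ai bi ci di => -> -> ai bi ci di.
by congr Stratification; exact: Prop_irrelevance.
Qed.

Lemma strat_plus_tens t (A B : nat -> coh X) (tau : strat t A) (sigma : strat t B) :
  strat_plus (strat_tens_at tau sigma) = strat_tens_at (strat_plus tau) (strat_plus sigma).
Proof.
apply: stratification_ext => //=.
apply: (cmor_ext_inj (ciso_inj (mun_iso t.+2 (A 1%N) (B 1%N)))).
rewrite [RHS]cinvKc /= -!ccompA -pmap_comp cinvKc pmap_comp !ccompA.
by rewrite mu_nat.
Qed.

Lemma strat_plus_one t : strat_plus (one_at t) = one_at t.+1.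
Proof. exact: stratification_ext. Qed.

Lemma to_stage_ind (P : nat -> Prop) m : P m ->
  (forall s, (m <= s)%N -> P s -> P s.+1) -> forall s, (m <= s)%N -> P s.
Proof.
move=> Pm PS; elim=> [|s ih]; first by rewrite leqn0 => /eqP <-.
by rewrite leq_eqVlt => /predU1P[<-//|ms]; apply: PS => //; exact: ih.
Qed.

Lemma to_stage_tens_at m s (h : (m <= s)%N) (A B : nat -> coh X) (tau : strat m A)
    (sigma : strat m B) :
  to_stage h (strat_tens_at tau sigma) = strat_tens_at (to_stage h tau) (to_stage h sigma).
Proof.
have ms := h; move: h.
apply: (@to_stage_ind (fun s => forall h : (m <= s)%N, to_stage h (strat_tens_at tau sigma)
  = strat_tens_at (to_stage h tau) (to_stage h sigma)) m) => [h|s' ms' ih h|//].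
- by rewrite !to_stage_id.
- by rewrite !(to_stageS ms') ih strat_plus_tens.
Qed.

Lemma to_stage_trans t m s (h : (t <= m)%N) (h' : (m <= s)%N) (h'' : (t <= s)%N)
    (A : nat -> coh X) (tau : strat t A) : to_stage h' (to_stage h tau) = to_stage h'' tau.
Proof.
have ms := h'; move: h' h''.
apply: (@to_stage_ind (fun s => forall (h' : (m <= s)%N) (h'' : (t <= s)%N),
  to_stage h' (to_stage h tau) = to_stage h'' tau) m) => [h' h''|s' ms' ih h' h''|//].
- by rewrite to_stage_id (bool_irrelevance h h'').
- by rewrite (to_stageS ms') (to_stageS (leq_trans h ms')) (ih _ (leq_trans h ms')).
Qed.

Lemma to_stage_one s (h : (0 <= s)%N) : to_stage h (sstr (strat_one charkp X)) = one_at s.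
Proof.
elim: s h => [|s ih] h; first by rewrite to_stage_id; exact: stratification_ext.
by rewrite (to_stageS (leq0n s)) ih strat_plus_one.
Qed.

Lemma to_stage_tens s (A B : SB) (hA : (stg A <= s)%N) (hB : (stg B <= s)%N)
    (h : (stg (strat_tens A B) <= s)%N) :
  to_stage h (sstr (strat_tens A B)) = strat_tens_at (to_stage hA (sstr A)) (to_stage hB (sstr B)).
Proof. by rewrite to_stage_tens_at !(to_stage_trans _ _ hA) !(to_stage_trans _ _ hB). Qed.

Lemma stage_tens s (A B : SB) : (stg A <= s)%N -> (stg B <= s)%N -> (stg (strat_tens A B) <= s)%N.
Proof. by move=> hA hB; rewrite geq_max hA. Qed.

Lemma tmap_colim (A B C D : SB) (f : shom A C) (g : shom B D) :
  @is_colim_mor p k charkp X (strat_tens A B) (strat_tens C D) (fun i => tmap (f i) (g i)).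
Proof.
have [s [a [b [c [d [hf hg]]]]]] := colim_mor2 (hfunP f) (hfunP g).
exists s, (stage_tens a c), (stage_tens b d).
by rewrite (to_stage_tens a c) (to_stage_tens b d); exact: tmap_strat.
Qed.

Lemma assoc_colim (A B D : SB) : @is_colim_mor p k charkp X (strat_tens (strat_tens A B) D)
  (strat_tens A (strat_tens B D)) (fun i => cassoc (A i) (B i) (D i)).
Proof.
pose s := (stg A + stg B + stg D)%N.
have hA : (stg A <= s)%N by rewrite /s -addnA leq_addr.
have hB : (stg B <= s)%N by rewrite /s addnAC leq_addl.
have hD : (stg D <= s)%N by exact: leq_addl.
exists s, (stage_tens (stage_tens hA hB) hD), (stage_tens hA (stage_tens hB hD)).
rewrite (to_stage_tens (stage_tens hA hB) hD) (to_stage_tens hA (stage_tens hB hD)).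
by rewrite (to_stage_tens hA hB) (to_stage_tens hB hD); exact: assoc_strat.
Qed.

Lemma braid_colim (A B : SB) : @is_colim_mor p k charkp X (strat_tens A B) (strat_tens B A)
  (fun i => cbraid (A i) (B i)).
Proof.
have hA := leq_addr (stg B) (stg A); have hB := leq_addl (stg A) (stg B).
exists (stg A + stg B)%N, (stage_tens hA hB), (stage_tens hB hA).
by rewrite (to_stage_tens hA hB) (to_stage_tens hB hA); exact: braid_strat.
Qed.

Lemma lunit_colim (A : SB) : @is_colim_mor p k charkp X (strat_tens (strat_one charkp X) A) A
  (fun i => clunit (A i)).
Proof.
have hI : (stg (strat_one charkp X) <= stg A)%N by [].
exists (stg A), (stage_tens hI (leqnn _)), (leqnn _).
by rewrite (to_stage_tens hI (leqnn _)) to_stage_one; exact: lunit_strat.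
Qed.

Lemma strat_mor_inv t (D E : nat -> coh X) (tau : strat t D) (sigma : strat t E)
    (f : forall i, cmor (D i) (E i)) (g : forall i, cmor (E i) (D i)) :
  (forall i, ccomp (g i) (f i) = cid_mor _) -> (forall i, ccomp (f i) (g i) = cid_mor _) ->
  is_strat_mor tau sigma f -> is_strat_mor sigma tau g.
Proof.
move=> gf fg [f0 fS]; split=> [|i].
- rewrite -[RHS]ccomp1f -pmapn_id -(gf 1%N) pmapn_comp -!ccompA; congr (ccomp _ _).
  by rewrite ccompA f0 -ccompA -pmapn_comp fg pmapn_id ccompf1.
- rewrite -[RHS]ccomp1f -pmap_id -(gf i.+2) pmap_comp -!ccompA; congr (ccomp _ _).
  by rewrite ccompA fS -ccompA fg ccompf1.
Qed.

Lemma colim_inv (D E : SB) (f : shom D E) (g : forall i, cmor (E i) (D i)) :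
  (forall i, ccomp (g i) (f i) = cid_mor _) -> (forall i, ccomp (f i) (g i) = cid_mor _) ->
  is_colim_mor g.
Proof.
move=> gf fg; have [s [a [b hf]]] := hfunP f; exists s, b, a.
exact: strat_mor_inv gf fg hf.
Qed.

End StratTensor.

Section TensorStructure.
Variables (p : nat) (k : fieldType).
Hypothesis charkp : p \in [pchar k].
Hypothesis kperf : forall a : k, exists b, b ^+ p = a.
Variable X : kscheme k.

Local Notation SB := (strat_bundle charkp X).
Local Notation cat := (strat_infty charkp kperf X).
Local Notation I := (strat_one charkp X).
Local Notation T := (@strat_tens p k charkp X).
Local Notation H := (@Defs.hom k cat).

Lemma shom_eq (A B : SB) (f g : shom A B) :
  (forall i, (f i : cmor (A i) (B i)) = g i) -> f = g.
Proof. by move=> h; apply: shom_ext => i U s; rewrite h. Qed.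

Definition st_tmor (A A' B B' : cat) (f : H A A') (g : H B B') : H (T A B) (T A' B') :=
  SHom (tmap_colim f g).
Definition st_assoc (A B D : cat) : H (T (T A B) D) (T A (T B D)) := SHom (assoc_colim A B D).
Definition st_assocV (A B D : cat) : H (T A (T B D)) (T (T A B) D) :=
  SHom (colim_inv (f := SHom (assoc_colim A B D)) (fun i => cassocK _ _ _) (fun i => cassocVK _ _ _)).
Definition st_braid (A B : cat) : H (T A B) (T B A) := SHom (braid_colim A B).
Definition st_lunit (A : cat) : H (T I A) A := SHom (lunit_colim A).
Definition st_lunitV (A : cat) : H A (T I A) :=
  SHom (colim_inv (f := SHom (lunit_colim A)) (fun i => clunitK _) (fun i => clunitVK _)).
Definition st_runit (A : cat) : H (T A I) A := Defs.comp (st_lunit A) (st_braid A I).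
Definition st_runitV (A : cat) : H A (T A I) := Defs.comp (st_braid I A) (st_lunitV A).

Definition strat_tensor : @tensor_structure k cat T I.
Proof.
apply: (@TensorStructure k cat T I st_tmor st_assoc st_assocV st_braid st_lunit st_runit).
- move=> A A' B B'; split=> [g|f] a x y; apply: shom_eq => i; [exact: tmap_linl|exact: tmap_linr].
- by move=> A B; apply: shom_eq => i; exact: tmap_id.
- by move=> *; apply: shom_eq => i; exact: tmap_comp.
- by move=> *; apply: shom_eq => i; exact: cassocK.
- by move=> *; apply: shom_eq => i; exact: cassocVK.
- by move=> *; apply: shom_eq => i; exact: cassoc_nat.
- by move=> *; apply: shom_eq => i; exact: cbraid_nat.
- by move=> *; apply: shom_eq => i; exact: cbraidK.
- move=> A; exists (st_lunitV A); split; apply: shom_eq => i; [exact: clunitK|exact: clunitVK].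
- by move=> *; apply: shom_eq => i; exact: clunit_nat.
- move=> A; exists (st_runitV A); split; apply: shom_eq => i.
    rewrite /= -ccompA [ccomp (clunitV _) _]ccompA clunitK ccomp1f; exact: cbraidK.
  by rewrite /= -ccompA [ccomp (cbraid _ _) _]ccompA cbraidK ccomp1f; exact: clunitVK.
- move=> A B f; apply: shom_eq => i; rewrite /= -[RHS]ccompA -cbraid_nat !ccompA.
  by congr (ccomp _ _); exact: clunit_nat.
- move=> A B D E; apply: shom_eq => i; apply: ctens4_ext => U x y z w.
  by rewrite !ccE !tmapE !cassocE tmapE cassocE.
- move=> A B; apply: shom_eq => i; apply: ctens3l_ext => U x a z.
  rewrite ccE cassocE !tmapE [X in ugen (_, X)]clunitE ccE cbraidE clunitE.
  by rewrite (linZ (@tgenDl _ (A i U) _ _)) (linZ (@tgenDr _ (A i U) _ _)).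
- move=> A B D; apply: shom_eq => i; apply: ctens3l_ext => U x y z.
  by rewrite !ccE cassocE !cbraidE cassocE !tmapE cbraidE cassocE tmapE cbraidE.
- by move=> A; exact: shom_eq.
Defined.

End TensorStructure.

(** * Dual sheaves *)

Section DualSheaf.
Variable X : scheme.
Variable E : coh X.
Hypothesis Eproj : forall U, ffree (E U) 1.

Definition cdC (U : aff X) : set (E U -> rO U) := [set u | lin (u : E U -> cO X U)].

Lemma cd_closed U : hom_closed (@cdC U).
Proof.
split=> [a x y|u v lu lv a x y|u lu a x y|s u lu a x y|u lu]; rewrite /cdC /=.
- by rewrite scaler0 addr0.
- by rewrite lu lv scalerDr addrACA.
- by rewrite lu scalerN opprD.
- by rewrite scalerDr !scalerA mulrC -scalerA lu.
- exact: linD lu.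
Qed.

Definition cdsec (U : aff X) : lmodType (rO U) := homm (@cd_closed U).

Definition cdval U (u : cdsec U) : E U -> cO X U := (u : homc (@cdC U)).

Lemma cdval_lin U (u : cdsec U) : lin (cdval u). Proof. exact: hcP. Qed.

Lemma cdvalL U a (u v : cdsec U) x : cdval (a *: u + v) x = a *: cdval u x + cdval v x.
Proof. by rewrite /cdval hommD hommZ -(linZ (cdval_lin u)). Qed.

Lemma cdval_ext U (u v : cdsec U) : (forall x, cdval u x = cdval v x) -> u = v.
Proof. exact: homm_ext. Qed.

Lemma cd_basis U : exists (T : finType) (f : T -> cdsec U) (v : T -> E U),
  (forall x, x = \sum_t (cdval (f t) x : rO U) *: v t) /\
  (forall u, u = \sum_t (cdval u (v t) : rO U) *: f t).
Proof.
have [T [f [v [lf fE]]]] := Eproj U.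
pose g t : cdsec U := HomC (lf t : @cdC U (f t)).
exists T, g, v; have xE x : x = \sum_t (cdval (g t) x : rO U) *: v t.
  by rewrite -[LHS]scale1r fE.
split=> // u; apply: cdval_ext => x; rewrite {1}(xE x) (lin_sum _ _ (cdval_lin u)).
rewrite [RHS]homm_sum; apply: eq_bigr => t _; rewrite (linZ (cdval_lin u)) hommZ.
by rewrite [RHS](linZ (cdval_lin (g t))); exact: mulrC.
Qed.

Section Res.
Variables (U V : aff X) (h : (V : set X) `<=` U).

Lemma cdres_ex (u : cdsec U) : exists u' : cdsec V, forall x, cdval u' (cres h x) = rres h (cdval u x).
Proof.
have [|g lg gE] := bchg_univ (cresL E h) (cqc E h) (P := cO X V)
  (h := fun x => rres h (cdval u x)).
  by move=> a x y; rewrite (cdval_lin u) rmorphD rmorphM.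
by exists (HomC (lg : @cdC V g)).
Qed.

Definition cdres (u : cdsec U) : cdsec V := sval (cid (cdres_ex u)).

Lemma cdresE u x : cdval (cdres u) (cres h x) = rres h (cdval u x).
Proof. exact: (svalP (cid (cdres_ex u))). Qed.

Lemma cdval_extres (u v : cdsec V) :
  (forall x, cdval u (cres h x) = cdval v (cres h x)) -> u = v.
Proof.
move=> e; apply: cdval_ext.
exact: (bchg_uniq (cresL E h) (cqc E h) (cdval_lin u) (cdval_lin v) e).
Qed.

Lemma cdres_lin : semilin (rres h) cdres.
Proof.
move=> a u v; apply: cdval_extres => x.
by rewrite cdvalL !cdresE cdvalL rmorphD rmorphM.
Qed.

Lemma cdqc : bijective (ulift cdres : bchg (rres h) (cdsec U) -> cdsec V).
Proof.
have [T [f [v [xE uE]]]] := cd_basis U.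
have xE' x : x = \sum_t (cdval (cdres (f t)) x : rO V) *: cres h (v t).
  apply: (bchg_uniq (cresL E h) (cqc E h) (h := id)
    (h' := fun x => \sum_t (cdval (cdres (f t)) x : rO V) *: cres h (v t))) => // [|{}x].
    exact: (lin_expand (fun t => cres h (v t)) (fun t => cdval_lin (cdres (f t)))).
  rewrite {1}(xE x) (semilin_sum _ _ (cresL E h)).
  by apply: eq_bigr => t _; rewrite (semilinZ (cresL E h)) cdresE.
have uE' u : u = \sum_t (cdval u (cres h (v t)) : rO V) *: cdres (f t).
  apply: cdval_ext => x; rewrite {1}(xE' x) (lin_sum _ _ (cdval_lin u)).
  rewrite [RHS]homm_sum; apply: eq_bigr => t _; rewrite (linZ (cdval_lin u)) hommZ.
  by rewrite [RHS](linZ (cdval_lin (cdres (f t)))); exact: mulrC.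
apply: bchg_bij cdres_lin _ _ => [P g lg|P g g' lg lg' gE u].
- exists (fun u : cdsec V => \sum_t (cdval u (cres h (v t)) : rO V) *: g (f t)) => [a u w|u].
    rewrite scaler_sumr -big_split; apply: eq_bigr => t _.
    by rewrite cdvalL scalerDl scalerA.
  rewrite [in RHS](uE u) (semilin_sum _ _ lg).
  by apply: eq_bigr => t _; rewrite cdresE (semilinZ lg).
- rewrite (uE' u) (lin_sum _ _ lg) (lin_sum _ _ lg'); apply: eq_bigr => t _.
  by rewrite (linZ lg) (linZ lg') gE.
Qed.

End Res.

Lemma cdres_id (U : aff X) (h : (U : set X) `<=` U) u : cdres h u = u.
Proof. by apply: (cdval_extres (h := h)) => x; rewrite cdresE rres_id cres_id. Qed.

Lemma cdres_comp (U V W : aff X) (h : (V : set X) `<=` U)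
  (h' : (W : set X) `<=` V) (h'' : (W : set X) `<=` U) u :
  cdres h' (cdres h u) = cdres h'' u.
Proof.
apply: (cdval_extres (h := h'')) => x.
by rewrite cdresE -(cres_comp h h' h'') !cdresE; exact: rres_comp.
Qed.

Lemma cdfg (U : aff X) : fingen (cdsec U).
Proof.
have [T [f [v [_ uE]]]] := cd_basis U.
by exists T, f => u; exists (fun t => cdval u (v t)).
Qed.

Definition cdual : coh X := Coh cdres_lin cdres_id cdres_comp cdqc cdfg.

Lemma cdev_bl U : bilin (fun (u : cdual U) (x : E U) => cdval u x : cO X U).
Proof. by split=> [x|u] a y z; [exact: cdvalL|exact: cdval_lin]. Qed.

Definition cdev : cmor (ctens cdual E) (cO X) :=
  ctl cdev_bl (fun U V h u x => cdresE h u x).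

End DualSheaf.

Section DualPairs.
Variable X : scheme.
Implicit Types D E : coh X.

Definition dual_basis E' E (ev : cmor (ctens E' E) (cO X)) (U : aff X) (T : finType)
    (f : T -> E' U) (v : T -> E U) :=
  (forall x, x = \sum_t (ev U (ugen (f t, x)) : rO U) *: v t) /\
  (forall u, u = \sum_t (ev U (ugen (u, v t)) : rO U) *: f t).

Definition dpair E' E (ev : cmor (ctens E' E) (cO X)) :=
  forall U, exists (T : finType) (f : T -> E' U) (v : T -> E U), dual_basis ev f v.

Lemma cdev_dpair E (Eproj : forall U, ffree (E U) 1) : dpair (cdev Eproj).
Proof.
move=> U; have [T [f [v [xE uE]]]] := cd_basis Eproj U; exists T, f, v.
split=> [x|u].
- by rewrite {1}(xE x); apply: eq_bigr => t _; rewrite ctlE.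
- by rewrite {1}(uE u); apply: eq_bigr => t _; rewrite ctlE.
Qed.

Section Pairing.
Variables (E' E : coh X) (ev : cmor (ctens E' E) (cO X)).

Lemma evl U (x : E U) : lin (fun u : E' U => ev U (ugen (u, x))).
Proof. by move=> a u v; rewrite (@tgenDl _ (E' U)) (cfun_lin ev). Qed.

Lemma evr U (u : E' U) : lin (fun x : E U => ev U (ugen (u, x))).
Proof. by move=> a x y; rewrite (@tgenDr _ (E' U)) (cfun_lin ev). Qed.

Lemma ev_res (U V : aff X) (h : (V : set X) `<=` U) u x :
  ev V (ugen (cres h u, cres h x)) = rres h (ev U (ugen (u, x)) : rO U) :> rO V.
Proof. by rewrite -tres_gen; exact: (cfun_res ev). Qed.

Hypothesis evP : dpair ev.

Lemma dpair_inj U (u w : E' U) : (forall x, ev U (ugen (u, x)) = ev U (ugen (w, x))) -> u = w.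
Proof.
have [T [f [v [_ uE]]]] := evP U => e.
by rewrite (uE u) (uE w); apply: eq_bigr => t _; rewrite e.
Qed.

Lemma dual_basis_indep U (T S : finType) (f : T -> E' U) (v : T -> E U) (g : S -> E' U)
    (w : S -> E U) : dual_basis ev f v -> dual_basis ev g w ->
  \sum_t (ugen (v t, f t) : ctens E E' U) = \sum_s ugen (w s, g s).
Proof.
move=> [xf uf] [xg ug].
rewrite (eq_bigr (fun t => \sum_s (ev U (ugen (f t, w s)) : rO U) *: (ugen (v t, g s) : ctens E E' U))).
  rewrite exchange_big; apply: eq_bigr => s _; rewrite [w s in RHS]xf.
  rewrite (lin_sum _ _ (@tgenDl _ (E U) (E' U) (g s))); apply: eq_bigr => t _.
  by rewrite (linZ (@tgenDl _ (E U) (E' U) (g s))).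
move=> t _; rewrite [f t in LHS]ug (lin_sum _ _ (@tgenDr _ (E U) (E' U) (v t))).
by apply: eq_bigr => s _; rewrite (linZ (@tgenDr _ (E U) (E' U) (v t))).
Qed.

Lemma dual_basis_res (U V : aff X) (h : (V : set X) `<=` U) (T : finType) (f : T -> E' U)
    (v : T -> E U) : dual_basis ev f v ->
  dual_basis ev (fun t => cres h (f t)) (fun t => cres h (v t)).
Proof.
move=> [xE uE]; split.
- apply: (bchg_uniq (cresL E h) (cqc E h) (h := id) (h' := fun x =>
    \sum_t (ev V (ugen (cres h (f t), x)) : rO V) *: cres h (v t))) => // [|x].
    exact: (lin_expand (fun t => cres h (v t)) (fun t => @evr V (cres h (f t)))).
  rewrite {1}(xE x) (semilin_sum _ _ (cresL E h)).
  by apply: eq_bigr => t _; rewrite (semilinZ (cresL E h)) ev_res.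
- apply: (bchg_uniq (cresL E' h) (cqc E' h) (h := id) (h' := fun u =>
    \sum_t (ev V (ugen (u, cres h (v t))) : rO V) *: cres h (f t))) => // [|u].
    exact: (lin_expand (fun t => cres h (f t)) (fun t => @evl V (cres h (v t)))).
  rewrite {1}(uE u) (semilin_sum _ _ (cresL E' h)).
  by apply: eq_bigr => t _; rewrite (semilinZ (cresL E' h)) ev_res.
Qed.

Definition is_coev (c : cmor (cO X) (ctens E E')) := forall U,
  exists (T : finType) (f : T -> E' U) (v : T -> E U),
    dual_basis ev f v /\ c U 1 = \sum_t ugen (v t, f t).

Lemma cO_ext D (c d : cmor (cO X) D) : (forall U, c U 1 = d U 1) -> c = d.
Proof.
move=> cd; apply: cmor_ext => U a.
have -> : a = (a : rO U) *: (1 : cO X U) by symmetry; exact: mulr1.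
by rewrite (linZ (cfunL c U)) cd (linZ (cfunL d U)).
Qed.

Lemma is_coev_uniq c d : is_coev c -> is_coev d -> c = d.
Proof.
move=> hc hd; apply: cO_ext => U.
have [T [f [v [fv ->]]]] := hc U; have [S [g [w [gw ->]]]] := hd U.
exact: dual_basis_indep fv gw.
Qed.

Lemma exists_coev : exists c, is_coev c.
Proof.
have H U : exists z : ctens E E' U, exists (T : finType) (f : T -> E' U) (v : T -> E U),
    dual_basis ev f v /\ z = \sum_t ugen (v t, f t).
  have [T [f [v fv]]] := evP U; exists (\sum_t ugen (v t, f t)), T, f, v.
  by split.
pose z U := sval (cid (H U)); have zP U := svalP (cid (H U)).
have cl U : lin (fun a : cO X U => (a : rO U) *: z U).
  by move=> a x y; rewrite scalerDl scalerA.
have cr (U V : aff X) (h : (V : set X) `<=` U) (a : cO X U) :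
    (cres h a : rO V) *: z V = cres h ((a : rO U) *: z U).
  rewrite (semilinZ (cresL (ctens E E') h)); congr (_ *: _).
  have [T [f [v [fv zE]]]] := zP U; have [S [g [w [gw wE]]]] := zP V.
  rewrite [z V]wE [z U]zE -(dual_basis_indep (dual_basis_res h fv) gw).
  rewrite (semilin_sum _ _ (cresL (ctens E E') h)).
  by apply: eq_bigr => t _; rewrite /= tres_gen.
exists (CMor cl cr) => U; have [T [f [v [fv zE]]]] := zP U; exists T, f, v.
by rewrite /= scale1r.
Qed.

Lemma coev_triangle1 c : is_coev c ->
  ccomp (ccomp (clunit E) (cbraid E (cO X))) (ccomp (tmap (cid_mor E) ev)
    (ccomp (cassoc E E' E) (tmap c (cid_mor E)))) = clunit E.
Proof.
move=> hc; apply: ctens_ext => U a x; rewrite !ccE tmapE clunitE.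
have -> : a = (a : rO U) *: (1 : cO X U) by symmetry; exact: mulr1.
have [T [f [v [[xE uE] cE]]]] := hc U.
rewrite (linZ (cfunL c U)) cE (linZ (@tgenDl _ (ctens E E' U) (E U) _)).
rewrite (lin_sum _ _ (@tgenDl _ (ctens E E' U) (E U) _)).
pose L := ccomp (clunit E) (ccomp (cbraid E (cO X)) (ccomp (tmap (cid_mor E) ev) (cassoc E E' E))).
rewrite [LHS](_ : _ = L U ((a : rO U) *: \sum_t ugen (ugen (v t, f t), x))) //.
rewrite (linZ (cfunL L U)) (lin_sum _ _ (cfunL L U)).
rewrite (eq_bigr (fun t => (ev U (ugen (f t, x)) : rO U) *: v t)) => [|t _]; last first.
  by rewrite !ccE cassocE tmapE cbraidE clunitE.
by rewrite -xE; congr (_ *: _); symmetry; exact: mulr1.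
Qed.

Lemma coev_triangle2 c : is_coev c ->
  ccomp (clunit E') (ccomp (tmap ev (cid_mor E'))
    (ccomp (cassocV E' E E') (tmap (cid_mor E') c))) = ccomp (clunit E') (cbraid E' (cO X)).
Proof.
move=> hc; apply: ctens_ext => U u a; rewrite !ccE tmapE cbraidE clunitE.
have -> : a = (a : rO U) *: (1 : cO X U) by symmetry; exact: mulr1.
have [T [f [v [[xE uE] cE]]]] := hc U.
rewrite (linZ (cfunL c U)) cE (linZ (@tgenDr _ (E' U) (ctens E E' U) _)).
rewrite (lin_sum _ _ (@tgenDr _ (E' U) (ctens E E' U) _)).
pose L := ccomp (clunit E') (ccomp (tmap ev (cid_mor E')) (cassocV E' E E')).
rewrite [LHS](_ : _ = L U ((a : rO U) *: \sum_t ugen (u, ugen (v t, f t)))) //.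
rewrite (linZ (cfunL L U)) (lin_sum _ _ (cfunL L U)).
rewrite (eq_bigr (fun t => (ev U (ugen (u, v t)) : rO U) *: f t)) => [|t _]; last first.
  by rewrite !ccE cassocVE tmapE clunitE.
by rewrite -uE; congr (_ *: _); symmetry; exact: mulr1.
Qed.

End Pairing.

Section Mate.
Variables (E' E D' D : coh X) (ev : cmor (ctens E' E) (cO X)) (ev1 : cmor (ctens D' D) (cO X)).
Hypotheses (evP : dpair ev) (evP1 : dpair ev1).
Variables (sigma : cmor E D) (hsigma : ciso sigma).

Lemma exists_mate : exists2 sigma' : cmor E' D', ciso sigma' &
  ccomp ev1 (tmap sigma' sigma) = ev.
Proof.
pose si := cinv hsigma.
have H U (u : E' U) : exists u', forall y, ev1 U (ugen (u', y)) = ev U (ugen (u, si U y)).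
  have [T [g [w [yE _]]]] := evP1 U.
  exists (\sum_t (ev U (ugen (u, si U (w t))) : rO U) *: g t) => y.
  rewrite (lin_sum _ _ (@evl _ _ ev1 U y)) [in RHS](yE y) (lin_sum _ _ (cfunL si U)).
  rewrite (lin_sum _ _ (@evr _ _ ev U u)); apply: eq_bigr => t _.
  rewrite (linZ (@evl _ _ ev1 U y)) (linZ (cfunL si U)) (linZ (@evr _ _ ev U u)).
  exact: mulrC.
pose g U u := sval (cid (H U u)).
have gE U u y : ev1 U (ugen (g U u, y)) = ev U (ugen (u, si U y)).
  exact: (svalP (cid (H U u))).
have gl U : lin (g U).
  move=> a u w; apply: (dpair_inj evP1) => y.
  by rewrite gE (@evl _ _ ev1 U y a) !gE (@evl _ _ ev U (si U y) a).
have gr (U V : aff X) (h : (V : set X) `<=` U) u : g V (cres h u) = cres h (g U u).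
  apply: (dpair_inj evP1); apply: (bchg_uniq (cresL D h) (cqc D h)
    (@evr _ _ ev1 V (g V (cres h u))) (@evr _ _ ev1 V (cres h (g U u)))) => y.
  by rewrite gE cfun_res !ev_res gE.
have gsE U u x : ev1 U (ugen (g U u, sigma U x)) = ev U (ugen (u, x)).
  by rewrite gE cinvVK.
exists (CMor gl gr); last by apply: ctens_ext => U u x; rewrite ccE tmapE; exact: gsE.
move=> U; apply: inj_surj_bij => [u w e|u'].
  by apply: (dpair_inj evP) => x; rewrite -!gsE; congr (ev1 U (ugen (_, _))).
have [T [f [v [xE _]]]] := evP U.
exists (\sum_t (ev1 U (ugen (u', sigma U (v t))) : rO U) *: f t).
apply: (dpair_inj evP1) => y; rewrite gE -[in RHS](cinvK hsigma y) -/si; move: (si U y) => x.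
rewrite (lin_sum _ _ (@evl _ _ ev U x)) [in RHS](xE x) (lin_sum _ _ (cfunL sigma U)).
rewrite (lin_sum _ _ (@evr _ _ ev1 U u')); apply: eq_bigr => t _.
rewrite (linZ (@evl _ _ ev U x)) (linZ (cfunL sigma U)) (linZ (@evr _ _ ev1 U u')).
exact: mulrC.
Qed.

Variables (sigma' : cmor E' D') (hsigma' : ciso sigma').
Hypothesis mate : ccomp ev1 (tmap sigma' sigma) = ev.

Lemma mate_coev c d : is_coev ev c -> is_coev ev1 d -> ccomp (tmap sigma sigma') c = d.
Proof.
move=> hc hd; apply: (is_coev_uniq (ev := ev1)) => // U.
have [T [f [v [[xE uE] cE]]]] := hc U.
have mE u x : ev1 U (ugen (sigma' U u, sigma U x)) = ev U (ugen (u, x)).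
  by rewrite -mate ccE tmapE.
exists T, (fun t => sigma' U (f t)), (fun t => sigma U (v t)); split; last first.
  rewrite ccE cE (lin_sum _ _ (cfunL (tmap sigma sigma') U)).
  by apply: eq_bigr => t _; rewrite tmapE.
split=> [y|u].
- have [x <-] : exists x, sigma U x = y by exists (cinv hsigma U y); exact: cinvK.
  rewrite {1}(xE x) (lin_sum _ _ (cfunL sigma U)); apply: eq_bigr => t _.
  by rewrite (linZ (cfunL sigma U)) mE.
- have [w <-] : exists w, sigma' U w = u by exists (cinv hsigma' U u); exact: cinvK.
  rewrite {1}(uE w) (lin_sum _ _ (cfunL sigma' U)); apply: eq_bigr => t _.
  by rewrite (linZ (cfunL sigma' U)) mE.
Qed.

End Mate.

End DualPairs.

(** * Rigidity *)

Section PullbackDual.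
Variables (p : nat) (k : fieldType).
Hypothesis charkp : p \in [pchar k].
Variable X : kscheme k.
Implicit Types A B C D E : coh X.

Local Notation F := (frob charkp).
Local Notation pmap := (@Defs.pmap p k charkp X _ _).
Local Notation pmapn n := (@pmapn p k charkp X n _ _).
Local Notation fpull := (fpull charkp).
Local Notation fpulln := (fpulln charkp).
Local Notation mu := (@mu p k charkp X).
Local Notation mun := (@mun p k charkp X).
Local Notation strat := (@stratification p k charkp X).
Local Notation SB := (strat_bundle charkp X).
Local Notation etaV := (cinv (eta_iso charkp (X := X))).
Local Notation theta := (theta charkp X).

Definition evF E' E (ev : cmor (ctens E' E) (cO X)) : cmor (ctens (fpull E') (fpull E)) (cO X) :=
  ccomp etaV (ccomp (pmap ev) (cinv (mu_iso charkp E' E))).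

Section EvF.
Variables (E' E : coh X) (ev : cmor (ctens E' E) (cO X)).

Lemma evF_mu : ccomp (evF ev) (mu E' E) = ccomp etaV (pmap ev).
Proof.
rewrite /evF -!ccompA; congr (ccomp _ _); rewrite -[RHS]ccompf1; congr (ccomp _ _).
by apply: cmor_ext => U x; rewrite ccE cinvVK.
Qed.

Lemma evF_gen U u x : evF ev U (ugen (ugen u, ugen x)) = F U (ev U (ugen (u, x))).
Proof.
rewrite -muE; have := congr1 (fun f : cmor (fpull (ctens E' E)) (cO X) => f U (ugen (ugen (u, x)))) evF_mu.
by rewrite !ccE => ->; rewrite pmapE cinv_etaE.
Qed.

Lemma evF_basis U (T : finType) (f : T -> E' U) (v : T -> E U) : dual_basis ev f v ->
  dual_basis (evF ev) (fun t => ugen (f t) : fpull E' U) (fun t => ugen (v t) : fpull E U).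
Proof.
move=> [xE uE]; split.
- apply: (umod_lin_ext (f := id) (g := fun x : fpull E U =>
    \sum_t (evF ev U (ugen (ugen (f t) : fpull E' U, x)) : rO U) *: (ugen (v t) : fpull E U))) => // [|x].
    exact: (lin_expand (fun t => ugen (v t)) (fun t => @evr _ _ _ (evF ev) U (ugen (f t)))).
  have lg := @bchg_gen _ _ (F U) (E U).
  rewrite {1}(xE x) (semilin_sum _ _ lg).
  by apply: eq_bigr => t _; rewrite (semilinZ lg) evF_gen.
- apply: (umod_lin_ext (f := id) (g := fun u : fpull E' U =>
    \sum_t (evF ev U (ugen (u, ugen (v t) : fpull E U)) : rO U) *: (ugen (f t) : fpull E' U))) => // [|u].
    exact: (lin_expand (fun t => ugen (f t)) (fun t => @evl _ _ _ (evF ev) U (ugen (v t)))).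
  have lg := @bchg_gen _ _ (F U) (E' U).
  rewrite {1}(uE u) (semilin_sum _ _ lg).
  by apply: eq_bigr => t _; rewrite (semilinZ lg) evF_gen.
Qed.

Lemma evF_dpair : dpair ev -> dpair (evF ev).
Proof.
move=> h U; have [T [f [v fv]]] := h U.
by exists T, (fun t => ugen (f t)), (fun t => ugen (v t)); exact: evF_basis.
Qed.

Lemma evF_coev c d : is_coev ev c -> is_coev (evF ev) d ->
  ccomp (mu E E') (pmap c) = ccomp d etaV.
Proof.
move=> hc hd.
suff e : ccomp (ccomp (mu E E') (pmap c)) (Defs.eta charkp X) = d.
  by rewrite -e -[LHS]ccompf1 -[RHS]ccompA; congr (ccomp _ _); apply: cmor_ext => U x; rewrite ccE cinvK.
apply: (is_coev_uniq (ev := evF ev)) => // U; have [T [f [v [fv cE]]]] := hc U.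
exists T, (fun t => ugen (f t)), (fun t => ugen (v t)); split; first exact: evF_basis.
rewrite !ccE /= /eta_fun scale1r.
have lm := cfunL (mu E E') U; have lg := @bchg_gen _ _ (F U) (ctens E E' U).
rewrite pmap_gen cE (semilin_sum _ _ lg).
have := lin_sum (index_enum T) (fun t => ugen (ugen (v t, f t)) : fpull (ctens E E') U) lm.
by move=> /= ->; apply: eq_bigr => t _; rewrite mu_gen.
Qed.

End EvF.

Fixpoint evFn n E' E (ev : cmor (ctens E' E) (cO X)) :
    cmor (ctens (fpulln n E') (fpulln n E)) (cO X) :=
  if n is m.+1 then evF (evFn m ev) else ev.

Lemma evFn_dpair n E' E (ev : cmor (ctens E' E) (cO X)) : dpair ev -> dpair (evFn n ev).
Proof. by move=> h; elim: n => //= n; exact: evF_dpair. Qed.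

Lemma evFn_mun n E' E (ev : cmor (ctens E' E) (cO X)) :
  ccomp (evFn n ev) (mun n E' E) = ccomp (theta n) (pmapn n ev).
Proof.
elim: n => [|n ih]; first exact: cmor_ext.
by rewrite /= ccompA evF_mu -!ccompA -!pmap_comp ih.
Qed.

Lemma evFn_coev n E' E (ev : cmor (ctens E' E) (cO X)) c d : dpair ev ->
  is_coev ev c -> is_coev (evFn n ev) d -> ccomp (mun n E E') (pmapn n c) = ccomp d (theta n).
Proof.
move=> evP hc; elim: n d => [|n ih] d hd.
  by rewrite (is_coev_uniq hc hd) /= ccomp1f ccompf1.
have [e he] := exists_coev (evFn_dpair n evP).
rewrite /= -ccompA -pmap_comp (ih e he) pmap_comp !ccompA; congr (ccomp _ _).
exact: evF_coev he hd.
Qed.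

Section Squares.
Variables (n m : nat) (E' E D' D : coh X).
Variables (ev : cmor (ctens E' E) (cO X)) (ev1 : cmor (ctens D' D) (cO X)).
Variables (sigma : cmor (fpulln m E) (fpulln n D)) (sigma' : cmor (fpulln m E') (fpulln n D')).
Hypotheses (hsigma : ciso sigma) (hsigma' : ciso sigma').
Hypothesis mate : ccomp (evFn n ev1) (tmap sigma' sigma) = evFn m ev.
Variable e : cmor (fpulln m (cO X)) (fpulln n (cO X)).
Hypothesis he : ccomp (theta n) e = theta m.

Lemma ev_square : ccomp (pmapn n ev1) (ttens sigma' sigma) = ccomp e (pmapn m ev).
Proof.
apply: (cmor_ext_inj (ciso_inj (@theta_iso p k charkp X n))).
by rewrite !ccompA -evFn_mun he -ccompA ttensE ccompA mate evFn_mun.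
Qed.

Lemma coev_square c d : dpair ev -> dpair ev1 -> is_coev ev c -> is_coev ev1 d ->
  ccomp (pmapn n d) e = ccomp (ttens sigma sigma') (pmapn m c).
Proof.
move=> evP evP1 hc hd.
have [c' hc'] := exists_coev (evFn_dpair m evP).
have [d' hd'] := exists_coev (evFn_dpair n evP1).
apply: (cmor_ext_inj (ciso_inj (mun_iso charkp n D D'))).
rewrite !ccompA (evFn_coev evP1 hd hd') ttensE -!ccompA he (evFn_coev evP hc hc') ccompA.
by rewrite (mate_coev hsigma hsigma' mate hc' hd').
Qed.

End Squares.

Lemma strat_dual s (E E' : nat -> coh X) (tau : strat s E) (ev : forall i, cmor (ctens (E' i) (E i)) (cO X))
    (c : forall i, cmor (cO X) (ctens (E i) (E' i))) :
  (forall i, dpair (ev i)) -> (forall i, is_coev (ev i) (c i)) ->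
  exists kappa : strat s E', is_strat_mor (strat_tens_at kappa tau) (one_at charkp X s) ev /\
    is_strat_mor (one_at charkp X s) (strat_tens_at tau kappa) c.
Proof.
move=> evP hc.
have [s0 i0 m0] := exists_mate (evFn_dpair s (evP 0%N)) (evFn_dpair s.+1 (evP 1%N)) (sig0_iso tau).
have H i : exists g : cmor (E' i.+1) (fpull (E' i.+2)),
    ciso g /\ ccomp (evFn 1 (ev i.+2)) (tmap g (sig tau i)) = evFn 0 (ev i.+1).
  have [g gi gm] := exists_mate (evFn_dpair 0 (evP i.+1)) (evFn_dpair 1 (evP i.+2)) (sig_iso tau i).
  by exists g.
pose g i := sval (cid (H i)); have gP i := svalP (cid (H i)).
have gi i : ciso (g i) by case: (gP i).
exists (@Stratification p k charkp X s E' s0 g i0 gi); split.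
- apply: strat_tens_morE => [|i].
    by apply: ev_square; [exact: m0|exact: theta_etas].
  by apply: ev_square; [exact: (gP i).2|exact: (@theta_etas p k charkp X 0)].
- split=> [|i].
    rewrite strat_tens_sig0E.
    by apply: (coev_square (sig0_iso tau) i0 m0 _ (evP _) (evP _)) => //; exact: theta_etas.
  rewrite strat_tens_sigE.
  apply: (@coev_square 1 0 _ _ _ _ _ _ _ _ (sig_iso tau i) (gi i) (gP i).2 _ _ _ _ (evP _) (evP _)) => //.
  exact: (@theta_etas p k charkp X 0).
Qed.

End PullbackDual.

Section Rigid.
Variables (p : nat) (k : fieldType).
Hypothesis charkp : p \in [pchar k].
Hypothesis kperf : forall a : k, exists b, b ^+ p = a.
Variable X : kscheme k.
Hypotheses (Xsm : smooth X) (Xirr : geom_irreducible X).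

Lemma rigid_strat : rigid (strat_tensor charkp kperf X).
Proof.
move=> A; pose pj i := strat_ffree1 kperf Xsm Xirr (sstr A) i.
pose E' i := cdual (pj i); pose ev i : cmor (ctens (E' i) (A i)) (cO X) := cdev (pj i).
have evP i : dpair (ev i) by exact: cdev_dpair.
pose c i := sval (cid (exists_coev (evP i))).
have hc i : is_coev (ev i) (c i) by exact: svalP (cid (exists_coev (evP i))).
have [kappa [hev hco]] := strat_dual (sstr A) evP hc.
pose A' : strat_bundle charkp X := StratBundle kappa.
have hI : (stg (strat_one charkp X) <= stg A)%N by [].
have hA' : (stg A' <= stg A)%N by exact: leqnn.
have Pev : @is_colim_mor p k charkp X (strat_tens A' A) (strat_one charkp X) ev.
  exists (stg A), (stage_tens hA' (leqnn _)), hI.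
  by rewrite (to_stage_tens hA' (leqnn _)) !to_stage_id to_stage_one.
have Pco : @is_colim_mor p k charkp X (strat_one charkp X) (strat_tens A A') c.
  exists (stg A), hI, (stage_tens (leqnn _) hA').
  by rewrite (to_stage_tens (leqnn _) hA') !to_stage_id to_stage_one.
exists A', (SHom Pev), (SHom Pco); split; apply: shom_eq => i.
- exact: (coev_triangle1 (hc i)).
- exact: (coev_triangle2 (hc i)).
Qed.

End Rigid.

(** * The fibre functor *)

Lemma bchg_unique (R S : comPzRingType) (phi : {rmorphism R -> S}) (M : lmodType R)
    (N1 N2 : lmodType S) (g1 : M -> N1) (g2 : M -> N2) :
  semilin phi g1 -> bijective (ulift g1 : bchg phi M -> N1) ->
  semilin phi g2 -> bijective (ulift g2 : bchg phi M -> N2) ->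
  exists J : N1 -> N2, [/\ lin J, bijective J & forall x, J (g1 x) = g2 x].
Proof.
move=> h1 b1 h2 b2.
have [J lJ JE] := bchg_univ h1 b1 h2; have [J' lJ' J'E] := bchg_univ h2 b2 h1.
exists J; split=> //; exists J'.
- apply: (bchg_uniq h1 b1 (h := J' \o J) (h' := id)) => [a x y|//|x] /=.
    by rewrite lJ lJ'.
  by rewrite JE J'E.
- apply: (bchg_uniq h2 b2 (h := J \o J') (h' := id)) => [a x y|//|x] /=.
    by rewrite lJ' lJ.
  by rewrite J'E JE.
Qed.

Section Fibers.
Variables (k : fieldType) (X : kscheme k) (x : rational_point X).
Implicit Types E D : coh X.

Section Germ.
Variable E : coh X.

Definition germ (U : aff X) (hU : U (rpt x)) (s : E U) : fiber x E := ugen (LocalSection hU s).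

Lemma germ_lin (U : aff X) (hU : U (rpt x)) : semilin (Defs.rev hU) (germ hU).
Proof.
move=> a s t; apply: (@umod_ext _ _ (@local_adm k X x E)) => P g ag.
rewrite (ulift_lin ag) /germ !ulift_gen //; exact: ag.1.
Qed.

Lemma germ_res (U V : aff X) (h : (V : set X) `<=` U) (hU : U (rpt x)) (hV : V (rpt x)) s :
  germ hV (cres h s) = germ hU s.
Proof.
apply: (@umod_ext _ _ (@local_adm k X x E)) => P g ag.
by rewrite /germ !ulift_gen //; exact: ag.2.
Qed.

Lemma point_nbhs (U V : aff X) : U (rpt x) -> V (rpt x) ->
  exists W : aff X, [/\ (W : set X) `<=` U, (W : set X) `<=` V & W (rpt x)].
Proof.
by move=> hU hV; have [f [W [h [Wx WV _]]]] := affine_nbhs hU hV; exists W.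
Qed.

Variables (U : aff X) (hU : U (rpt x)).

Lemma fiber_ext (P : lmodType k) (f g : fiber x E -> P) : lin f -> lin g ->
  (forall s, f (germ hU s) = g (germ hU s)) -> forall y, f y = g y.
Proof.
move=> lf lg fg; apply: umod_lin_ext => // -[V hV s].
have [W [WU WV hW]] := point_nbhs hU hV.
rewrite -[ugen _]/(germ hV s) -(germ_res WV hV hW).
move: (cres WV s); apply: (bchg_uniq (cresL E WU) (cqc E WU) (P := rscal (Defs.rev hW) P)
  (h := fun t => f (germ hW t)) (h' := fun t => g (germ hW t))) => [a t t'|a t t'|t].
- by rewrite germ_lin lf.
- by rewrite germ_lin lg.
- by rewrite (germ_res WU hU hW) fg.
Qed.

Lemma germ_surj y : exists s, germ hU s = y.
Proof.
have lg := germ_lin hU.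
have hC : submod [set y : fiber x E | exists s, germ hU s = y].
  split=> [|a _ _ [s <-] [t <-]]; first by exists 0; exact: semilin0 lg.
  by exists (kst U a *: s + t); rewrite lg rev_kst.
have : mpi hC y = 0.
  apply: (fiber_ext (f := mpi hC) (g := fun=> 0)); first exact: mpi_lin.
    by move=> a s t; rewrite scaler0 addr0.
  by move=> s; apply/mpi_eq0; exists s.
by move/mpi_eq0.
Qed.

Definition nbhs_ext (P : lmodType k) (h : E U -> P) (W : aff X) (WU : (W : set X) `<=` U)
    (hW : W (rpt x)) (hw : E W -> P) :=
  semilin (Defs.rev hW) hw /\ forall t, hw (cres WU t) = h t.

Lemma exists_nbhs_ext (P : lmodType k) (h : E U -> P) (W : aff X) (WU : (W : set X) `<=` U)
    (hW : W (rpt x)) : semilin (Defs.rev hU) h -> exists hw, nbhs_ext h WU hW hw.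
Proof.
move=> lh; have [|hw lw wE] := bchg_univ (cresL E WU) (cqc E WU)
  (P := rscal (Defs.rev hW) P) (h := h).
  by move=> a s t; rewrite lh -(rev_res WU hU hW).
by exists hw.
Qed.

Lemma nbhs_ext_res (P : lmodType k) (h : E U -> P) (W W' : aff X) (WU : (W : set X) `<=` U)
    (W'W : (W' : set X) `<=` W) (W'U : (W' : set X) `<=` U) (hW : W (rpt x)) (hW' : W' (rpt x)) hw hw' :
  nbhs_ext h WU hW hw -> nbhs_ext h W'U hW' hw' ->
  forall t, hw t = hw' (cres W'W t).
Proof.
move=> [lw wE] [lw' wE'].
apply: (bchg_uniq (cresL E WU) (cqc E WU) (P := rscal (Defs.rev hW) P)
  (h := hw) (h' := fun t => hw' (cres W'W t))) => [a t t'|a t t'|t].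
- exact: lw.
- by rewrite (cresL E W'W) lw' (rev_res W'W hW hW').
- by rewrite wE (cres_comp WU W'W W'U) wE'.
Qed.

Lemma fiber_bchg : bijective (ulift (germ hU) : bchg (Defs.rev hU) (E U) -> fiber x E).
Proof.
apply: bchg_bij (germ_lin hU) _ _ => [P h lh|P g g' lg lg' gE y]; last exact: fiber_ext gE y.
pose val (z : local_section x E) (y : P) := forall (W : aff X) (WU : (W : set X) `<=` U)
  (WV : (W : set X) `<=` lsU z) (hW : W (rpt x)) hw, nbhs_ext h WU hW hw -> hw (cres WV (lss z)) = y.
have /choice[g gP] : forall z, exists y, val z y.
  move=> z; have [W [WU WV hW]] := point_nbhs hU (lsx z).
  have [hw hwP] := exists_nbhs_ext WU hW lh; exists (hw (cres WV (lss z))).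
  move=> W' W'U W'V hW' hw' hwP'; have [W'' [W''W W''W' hW'']] := point_nbhs hW hW'.
  have W''U := subset_trans W''W WU; have W''V := subset_trans W''W WV.
  have [hw'' hwP''] := exists_nbhs_ext W''U hW'' lh.
  rewrite (nbhs_ext_res W''W hwP hwP'') (nbhs_ext_res W''W' hwP' hwP'').
  by rewrite (cres_comp WV W''W W''V) (cres_comp W'V W''W' W''V).
have ag : local_adm g.
  split=> [V hV a s t|V V' hV'V hV hV' s].
    have [W [WU WV hW]] := point_nbhs hU hV; have [hw hwP] := exists_nbhs_ext WU hW lh.
    have gE r : g (LocalSection hV r) = hw (cres WV r).
      by symmetry; exact: (gP (LocalSection hV r) W WU WV hW hw hwP).
    by rewrite !gE (cresL E WV) hwP.1 (rev_res WV hV hW).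
  have [W [WU WV' hW]] := point_nbhs hU hV'; have [hw hwP] := exists_nbhs_ext WU hW lh.
  rewrite -(gP (LocalSection hV' _) W WU WV' hW hw hwP) /=.
  rewrite (cres_comp hV'V WV' (subset_trans WV' hV'V)).
  exact: (gP (LocalSection hV s) W WU (subset_trans WV' hV'V) hW hw hwP).
exists (ulift g : fiber x E -> P); first exact: ulift_lin.
move=> s; rewrite /germ ulift_gen //.
have hU' : nbhs_ext h (@subset_refl _ (U : set X)) hU h by split=> // t; rewrite cres_id.
by rewrite -(gP (LocalSection hU s) U (@subset_refl _ _) (@subset_refl _ _) hU h hU') cres_id.
Qed.

End Germ.

Section FiberMap.
Variables (E D : coh X) (f : cmor E D).

Lemma fiber_map_adm :
  local_adm (fun z : local_section x E => ugen (LocalSection (lsx z) (f (lsU z) (lss z))) : fiber x D).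
Proof.
split=> [U hU a s t|U V h hU hV s] /=.
- by rewrite (cfun_lin f); exact: germ_lin.
- by rewrite cfun_res; exact: germ_res.
Qed.

Lemma fiber_map_lin : lin (fiber_map f : fiber x E -> fiber x D).
Proof. exact: ulift_lin fiber_map_adm. Qed.

Lemma fiber_map_germ (U : aff X) (hU : U (rpt x)) (s : E U) :
  fiber_map f (germ hU s) = germ hU (f U s).
Proof. by rewrite /germ /fiber_map ulift_gen //; exact: fiber_map_adm. Qed.

End FiberMap.

Lemma fiber_fingen (E : coh X) : fingen (fiber x E).
Proof.
have [U [aU hU]] := scheme_cover (rpt x); pose U' : aff X := Aff aU.
have [I [v vE]] := cfg E U'; exists I, (fun i => germ (hU : U' (rpt x)) (v i)) => y.
have [s <-] := germ_surj (hU : U' (rpt x)) y; have [c cE] := vE s.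
have lg := @germ_lin E U' hU.
exists (fun i => Defs.rev hU (c i)); rewrite {1}cE (semilin_sum _ _ lg).
by apply: eq_bigr => i _; rewrite (semilinZ lg).
Qed.

Lemma rev_semilin (U : aff X) (hU : U (rpt x)) :
  semilin (Defs.rev hU) (Defs.rev hU : cO X U -> k^o).
Proof. by move=> a s t; rewrite rmorphD rmorphM. Qed.

Lemma rev_bchg (U : aff X) (hU : U (rpt x)) :
  bijective (ulift (Defs.rev hU : cO X U -> k^o) : bchg (Defs.rev hU) (cO X U) -> k^o).
Proof.
apply: (bchg_bij (rev_semilin hU)) => [P h lh|P h h' lh lh' hE c].
- exists (fun c : k^o => (c : k) *: h 1) => [a s t|s]; first by rewrite scalerDl scalerA.
  by rewrite -(semilinZ lh); congr h; exact: mulr1.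
- have e (f : k^o -> P) : lin f -> f c = (c : k) *: f 1.
    by move=> lf; rewrite -(linZ lf); congr f; symmetry; exact: mulr1.
  by rewrite (e h) // (e h') //; have := hE 1; rewrite rmorph1 => ->.
Qed.

End Fibers.

Section FiberFunctor.
Variables (p : nat) (k : fieldType).
Hypothesis charkp : p \in [pchar k].
Hypothesis kperf : forall a : k, exists b, b ^+ p = a.
Variable X : kscheme k.
Hypotheses (Xsm : smooth X) (Xirr : geom_irreducible X).
Variable x : rational_point X.

Local Notation SB := (strat_bundle charkp X).
Local Notation cat := (strat_infty charkp kperf X).
Local Notation Hom := (@Defs.hom k cat).

Lemma kernel_splitker (A B D : SB) (f : Hom A B) (g : Hom B D) :
  is_kernel g f -> forall i, splitker ((f : shom A B) i) ((g : shom B D) i).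
Proof.
move=> [/hom_eq0 gf0 fker] i.
have [K [j hj]] := exists_ker kperf Xsm Xirr (g : shom B D).
have [gj jker] := splitker_is_kernel kperf hj.
have [u [fu _]] := fker K (j : Hom K B) gj.
have gf : Defs.comp g f = 0 by exact/hom_eq0.
have [v [jv _]] := jker A f gf.
have fuE U y : (f : shom A B) i U ((u : shom K A) i U y) = j i U y by rewrite -fu.
have uv : Defs.comp u v = @idm k cat A.
  have [w [_ wu]] := fker A f gf.
  rewrite -(wu (@idm k cat A)); last by rewrite compm1.
  by symmetry; apply: wu; rewrite Defs.compA fu jv.
have uvE U y : (u : shom K A) i U ((v : shom A K) i U y) = y.
  exact: (congr1 (fun h : Hom A A => (h : shom A A) i U y) uv).
have jvE U y : j i U ((v : shom A K) i U y) = (f : shom A B) i U y by rewrite -jv.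
have [_ hs] := hj i; split=> [U y|U]; first exact: gf0.
have [e [t [le lt eK eE]]] := hs U.
exists (fun y => (u : shom K A) i U (e y)), t; split=> //.
- exact: lin_comp (cfunL ((u : shom K A) i) U) le.
- by move=> y; rewrite -jvE eK uvE.
- by move=> y; rewrite fuE -eE.
Qed.

Lemma cokernel_surj (A B D : SB) (f : Hom A B) (g : Hom B D) :
  is_cokernel f g -> forall i U z, exists y, (g : shom B D) i U y = z.
Proof.
move=> [gf gcok]; have ge : Defs.epic g.
  move=> C h h' e; have [|w [_ wu]] := gcok C (Defs.comp h g).
    rewrite -Defs.compA gf; apply/hom_eq0 => i U s /=.
    exact: lin0 (cfunL ((h : shom D C) i) U).
  by rewrite -(wu h) // -(wu h').
have [Q [q hq]] := exists_coker (g : shom B D).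
exact: epic_coker ge hq.
Qed.

Lemma termwise_strat : termwise (strat_tensor charkp kperf X).
Proof.
split.
- by move=> A A' B B' f g i U u v; exact: tmapE.
- by move=> A B D i U u v w; exact: cassocE.
- by move=> A B i U u v; exact: cbraidE.
- by move=> A i U a u; exact: clunitE.
- by move=> A i U a u; rewrite [LHS](_ : _ = clunit (A i) U (cbraid (A i) (cO X) U (ugen (u, a)))) // cbraidE clunitE.
Qed.

Lemma fiber_functor_strat : is_fiber_functor (strat_tensor charkp kperf X)
  (@omega p k charkp kperf X x) (@omega_mor p k charkp kperf X x).
Proof.
have [U0 [aU hU]] := scheme_cover (rpt x); pose U : aff X := Aff aU.
have {}hU : U (rpt x) := hU.
have gl (E : coh X) := @germ_lin k X x E U hU.
split.
- move=> A; exact: fiber_fingen.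
- move=> A B f; exact: fiber_map_lin.
- move=> A y; have [s <-] := germ_surj hU y.
  by rewrite /omega_mor fiber_map_germ.
- move=> A B D g f y; have [s <-] := germ_surj hU y.
  by rewrite /omega_mor !fiber_map_germ.
- move=> A B a f g y; have [s <-] := germ_surj hU y.
  rewrite /omega_mor !fiber_map_germ /= (semilinD (gl _)) (semilinZ (gl _)).
  congr (_ *: _ + _); exact: rev_kst.
- move=> A B D f g [fker gcok].
  have [fg hs] := kernel_splitker fker 0%N; have [e [t [le lt eK eE]]] := hs U.
  have [|e' le' e'E] := bchg_univ (gl (B 0%N)) (fiber_bchg (B 0%N) hU) (h := fun y => germ hU (e y)).
    by move=> a u v; rewrite le (gl (A 0%N)).
  have [|t' lt' t'E] := bchg_univ (gl (D 0%N)) (fiber_bchg (D 0%N) hU) (h := fun y => germ hU (t y)).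
    by move=> a u v; rewrite lt (gl (B 0%N)).
  split.
  + move=> y z; have [s <-] := germ_surj hU y; have [r <-] := germ_surj hU z.
    rewrite /omega_mor !fiber_map_germ => /(congr1 e').
    by rewrite !e'E !eK.
  + move=> y; have [s <-] := germ_surj hU y; split=> [|[z <-]].
      rewrite /omega_mor fiber_map_germ => gs; exists (e' (germ hU s)).
      rewrite e'E fiber_map_germ [in RHS](eE s) (semilinD (gl (B 0%N))) -t'E gs (lin0 lt').
      by rewrite addr0.
    have [r <-] := germ_surj hU z; rewrite /omega_mor !fiber_map_germ fg.
    exact: semilin0 (gl (D 0%N)).
  + move=> z; have [r <-] := germ_surj hU z.
    have [s <-] := @cokernel_surj A B D f g gcok 0%N U r; exists (germ hU s).
    by rewrite /omega_mor fiber_map_germ.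
- have [u [lu ub uE]] := bchg_unique (rev_semilin hU) (rev_bchg hU) (gl (cO X)) (fiber_bchg (cO X) hU).
  have HJ (A B : cat) : exists J : tens (@omega p k charkp kperf X x A) (@omega p k charkp kperf X x B) ->
      @omega p k charkp kperf X x (strat_tens A B),
      [/\ lin J, bijective J & forall a b, J (ugen (germ hU a, germ hU b)) =
        germ (E := ctens ((A : SB) 0%N) ((B : SB) 0%N)) hU (ugen (a, b))].
    have [J [lJ Jb JE]] := bchg_unique (tens_bchg_lin (gl ((A : SB) 0%N)) (gl ((B : SB) 0%N)))
      (tens_bchg_bij (gl ((A : SB) 0%N)) (gl ((B : SB) 0%N)) (fiber_bchg _ hU) (fiber_bchg _ hU))
      (gl (ctens ((A : SB) 0%N) ((B : SB) 0%N))) (fiber_bchg _ hU).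
    exists J; split=> // a b; rewrite -JE tens_bchg_gen //; exact: gl.
  pose J A B := sval (cid (HJ A B)).
  have JP A B := svalP (cid (HJ A B)).
  have JE (A B : SB) a b : J A B (ugen (germ hU a, germ hU b)) =
      germ (E := ctens (A 0%N) (B 0%N)) hU (ugen (a, b)).
    by have [_ _ h] := JP A B; exact: h.
  have u1 : u 1 = germ hU (1 : cO X U) by rewrite -uE rmorph1.
  exists u, J; split=> //.
  + by move=> A B; have [lJ bJ _] := JP A B.
  + move=> A A' B B' f g y z; have [a <-] := germ_surj hU y; have [b <-] := germ_surj hU z.
    rewrite JE /omega_mor !fiber_map_germ JE; congr (germ _ _).
    exact: tmapE.
  + move=> A B D y z w; have [a <-] := germ_surj hU y; have [b <-] := germ_surj hU z.
    have [c <-] := germ_surj hU w; rewrite !JE /omega_mor fiber_map_germ; congr (germ _ _).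
    exact: cassocE.
  + split.
    * move=> A B y z; have [a <-] := germ_surj hU y; have [b <-] := germ_surj hU z.
      rewrite !JE /omega_mor fiber_map_germ; congr (germ _ _); exact: cbraidE.
    * move=> A y; have [a <-] := germ_surj hU y; rewrite u1 JE /omega_mor fiber_map_germ.
      by congr (germ _ _); rewrite [LHS]clunitE scale1r.
    * move=> A y; have [a <-] := germ_surj hU y; rewrite u1 JE /omega_mor fiber_map_germ.
      by congr (germ _ _); rewrite [LHS](runit_termwise termwise_strat) scale1r.
Qed.

End FiberFunctor.

Theorem corollary3p5 (p : nat) (k : fieldType) (charkp : p \in [pchar k])
    (kperf : forall a : k, exists b, b ^+ p = a)
    (X : kscheme k) (Xsmooth : smooth X) (Xirr : geom_irreducible X) :
  abelian (strat_infty charkp kperf X) /\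
  exists S : @tensor_structure k (strat_infty charkp kperf X)
               (@strat_tens p k charkp X) (strat_one charkp X),
    [/\ termwise S, rigid S
      & forall x : rational_point X,
          is_fiber_functor S (@omega p k charkp kperf X x)
            (@omega_mor p k charkp kperf X x)].
Proof.
split; first exact: abelian_strat.
exists (strat_tensor charkp kperf X); split.
- exact: termwise_strat.
- exact: rigid_strat.
- exact: fiber_functor_strat.
Qed.
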